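(* Let $q\ge2$ be an integer, $\mathcal{T}$ the homogeneous tree of degree $q+1$, $\mathcal{L}$ its combinatorial Laplacian and $h_t$ the associated continuous-time heat kernel. Let $p\in[1,\infty]$, and let $f:\mathcal{T}\to\mathbb{C}$ be such that either $f\in\ell^1(w_p)$, or $f$ is radial and belongs to $\ell^1_{\delta_p}(\mathcal{T})$. Let $u(t;\cdot)=e^{-t\mathcal{L}}f$, i.e. $u(t;x)=\sum_{y\in\mathcal{T}}f(y)\,h_t(x,y)$. Then $$\lim_{t\to\infty}\frac{1}{\|h_t\|_{\ell^p}}\,\big\|u(t;\cdot)-M_p(f)(\cdot)\,h_t\big\|_{\ell^p}=0,$$ where $M_p(f)$ is the $p$-mass function of $f$.
   Context: The homogeneous tree $\mathcal{T}$ of degree $q+1$ is the infinite connected graph without loops (cycles) in which every vertex has exactly $q+1$ neighbours; it is identified with its vertex set and carries the counting measure (which defines $\ell^p=\ell^p(\mathcal{T})$). $d$ is the graph distance, $o$ a fixed base point, $|x|=d(x,o)$; a function is radial if it depends only on $|x|$. The Laplacian is $\mathcal{L}f(x)=f(x)-\frac1{q+1}\sum_{y:\,d(x,y)=1}f(y)$. The heat kernel is $h_t(x,y)=(e^{-t\mathcal{L}}\delta_y)(x)$, which depends only on $t$ and $d(x,y)$, and $h_t(x)=h_t(x,o)$. Boundary: $\Omega$ is the set of infinite geodesic rays starting at $o$; $\Omega(o,x)=\{\omega\in\Omega: x\in\omega\}$; $\nu$ is the probability measure on $\Omega$ (harmonic measure centered at $o$) such that $\nu(\Omega(o,x))$ depends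 only on $|x|$. For $x\in\mathcal{T}$, $\omega\in\Omega$, $c(x,\omega)$ is the last point of the geodesic path from $o$ to $x$ lying on $\omega$, and $h_\omega(x)=2|c(x,\omega)|-|x|$ is the Busemann (height) function. The symbol $\fint_{\Omega(o,x)}F\,d\nu$ means $\frac{1}{\nu(\Omega(o,x))}\int_{\Omega(o,x)}F\,d\nu$. Spherical functions: for $\lambda\in\mathbb{C}$, $\varphi_\lambda$ is the unique radial function with $\varphi_\lambda(o)=1$ and $\mathcal{L}\varphi_\lambda=(1-\gamma(\lambda))\varphi_\lambda$, $\gamma(\lambda)=\frac{q^{i\lambda}+q^{-i\lambda}}{q^{1/2}+q^{-1/2}}$; in particular $\varphi_0(x)=\big(1+\frac{q-1}{q+1}|x|\big)q^{-|x|/2}$. For a function $f$ on $\mathcal{T}$, $(f\ast\varphi_0)(x)=\sum_{y}f(y)\varphi_0(d(x,y))$, where radial functions are also regarded as functions of the distance. Function spaces: $\delta_p=\frac1p-\frac12$ for $1\le p<2$ and $\delta_p=0$ for $2\le p\le\infty$. The weight is $w_p(y)=q^{|y|/p}$ for $p\in[1,2)$ and $w_p(y)=q^{|y|/2}$ for $p\in[2,\infty]$. $\ell^1(w_p)$ is the set of $f:\mathcal{T}\to\mathbb{C}$ with $\sum_y|f(y)|w_p(y)<\infty$, and $\ell^1_{\delta_p}(\mathcal{T})$ is the set of $f:\mathcal{T}\to\mathbb{C}$ with $\sum_y|f(y)|\varphi_{i\delta_p}(y)<\infty$. Mass functions: for $f\in\ell^1(w_p)$, $$M_p(f)(x)=\sum_{y\in\mathcal{T}}f(y)\fint_{\Omega(o,x)}q^{\frac1p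 h_\omega(y)}\,d\nu(\omega)\quad (1\le p<2),\qquad M_p(f)(x)=\frac{(f\ast\varphi_0)(x)}{\varphi_0(x)}\quad (2\le p\le\infty).$$ For $f$ radial in $\ell^1_{\delta_p}(\mathcal{T})$, $M_p(f)$ is the constant $M_p(f)=\sum_{y\in\mathcal{T}}f(y)\varphi_{i\delta_p}(y)$ (the two definitions agree when both apply). *)

(* Defs.v *)
(* MathComp-Analysis, with the complex numbers R[i] of mathcomp-real-closed. *)
From HB Require Import structures.
From mathcomp Require Export all_boot all_order all_algebra.
From mathcomp Require Export all_classical all_reals all_analysis.
From mathcomp Require Export complex.

Set Implicit Arguments.
Unset Strict Implicit.
Unset Printing Implicit Defensive.

Import Order.TTheory GRing.Theory Num.Theory.
Import numFieldNormedType.Exports.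

Local Open Scope classical_set_scope.
Local Open Scope ring_scope.
Local Open Scope complex_scope.

Section Tree.
Variables (T : choiceType) (e : rel T).

Record homogeneous_tree (q : nat) : Prop := HomogeneousTree {
  tree_infinite : infinite_set [set: T];
  tree_sym : symmetric e;
  tree_irr : irreflexive e;
  tree_connected : forall x y, exists2 s : seq T, path e x s & last x s = y;
  tree_acyclic : forall s : seq T, (2 < size s)%N -> ~ ucycle e s;
  tree_degree : forall x, ([set y | e x y] #= `I_q.+1)%card
}.

(* The path x :: s is a shortest path from x to y; its length is size s. *)
Definition geodesic (x : T) (s : seq T) (y : T) : Prop :=
  [/\ path e x s, last x s = y
    & forall s', path e x s' -> last x s' = y -> (size s <= size s')%N].

Definition dist (x y : T) : nat :=
  xget 0%N [set n | exists2 s, geodesic x s y & size s = n].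

Definition radial (U : Type) (o : T) (F : T -> U) : Prop :=
  forall x y, dist x o = dist y o -> F x = F y.

(* A radial function F seen as a function of the distance to o. *)
Definition radial_profile (K : nmodType) (o : T) (F : T -> K) (n : nat) : K :=
  xget 0 [set F z | z in [set z | dist z o = n]].

Definition is_ray (o : T) (w : nat -> T) : Prop :=
  w 0%N = o /\ forall m n, dist (w m) (w (m + n)%N) = n.

(* Omega(o, x); the whole boundary Omega is Omega(o, o). *)
Definition boundary_arc (o x : T) : set (nat -> T) :=
  [set w | is_ray o w /\ range w x].

(* c(x, w) *)
Definition confluent (o : T) (x : T) (w : nat -> T) : T :=
  xget o [set c | exists s1 s2 : seq T,
    [/\ geodesic o (s1 ++ s2) x, last o s1 = c, range w c
      & forall z, z \in s2 -> ~ range w z]].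

Definition height (o : T) (w : nat -> T) (x : T) : int :=
  (2 * dist (confluent o x w) o)%:Z - (dist x o)%:Z.

End Tree.

(* A measurableType has to be pointed, so measures on Omega are encoded as
   measures on all vertex sequences, with the sigma-algebra generated by the
   sets Omega(o, x), that give full mass to Omega = Omega(o, o). *)
Definition vertex_seq (T : choiceType) (o : T) : Type := nat -> T.
HB.instance Definition _ (T : choiceType) (o : T) :=
  Choice.copy (vertex_seq o) (nat -> T).
HB.instance Definition _ (T : choiceType) (o : T) :=
  isPointed.Build (vertex_seq o) (fun=> o).

Definition boundary (T : choiceType) (e : rel T) (o : T) :=
  g_sigma_algebraType (range (boundary_arc e o) : set (set (vertex_seq o))).

Section Analysis.
Variables (R : realType) (q : nat) (T : choiceType) (e : rel T) (o : T).
Local Notation C := R[i].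
Local Notation d := (dist e).
Local Notation normc := (@Normc.normc R).

Definition harmonic_measure (nu : probability (boundary e o) R) : Prop :=
  nu (boundary_arc e o o) = 1%E /\
  radial e o (fun x => nu (boundary_arc e o x)).

Definition average (nu : probability (boundary e o) R)
    (A : set (boundary e o)) (F : boundary e o -> R) : R :=
  (fine (nu A))^-1 * Rintegral nu A F.

(* Sums over the vertex set are meaningful for absolutely summable families. *)
Definition rsum (g : T -> R) : R :=
  fine (\esum_(x in [set: T]) ((EFin \o g)^\+ x)%E)
  - fine (\esum_(x in [set: T]) ((EFin \o g)^\- x)%E).

Definition csum (F : T -> C) : C :=
  rsum (fun x => complex.Re (F x)) +i* rsum (fun x => complex.Im (F x)).

Definition lpnorm (p : \bar R) (F : T -> C) : \bar R :=
  match p with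
  | r%:E =>
      ((\esum_(x in [set: T]) ((normc (F x) `^ r)%:E)) `^ r^-1)%E
  | +oo%E => ereal_sup (range (fun x => (normc (F x))%:E))
  | -oo%E => 0%E
  end.

Definition laplacian (K : fieldType) (g : T -> K) (x : T) : K :=
  g x - (q.+1)%:R^-1 * \sum_(y \in [set y | d x y = 1%N]) g y.

(* exp (- t * laplacian) as the exponential series of a bounded operator *)
Definition heat_semigroup (t : R) (g : T -> R) (x : T) : R :=
  limn (series (fun n => exp_coeff (- t) n * iter n (@laplacian R) g x)).

Definition heat_kernel (t : R) (x y : T) : R :=
  heat_semigroup t (fun z => (z == y)%:R) x.

Definition heat_solution (f : T -> C) (t : R) (x : T) : C :=
  csum (fun y => f y * (heat_kernel t x y)%:C).

(* q ^ (i * lam) *)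
Definition qexpi (lam : C) : C :=
  let r := q%:R `^ (- complex.Im lam) in
  let theta := complex.Re lam * ln q%:R in
  (r * cos theta) +i* (r * sin theta).

Definition gamma (lam : C) : C :=
  (qexpi lam + qexpi (- lam)) / (q%:R `^ 2^-1 + q%:R `^ (- 2^-1))%:C.

Definition is_spherical (lam : C) (phi : T -> C) : Prop :=
  [/\ radial e o phi, phi o = 1
    & forall x, laplacian phi x = (1 - gamma lam) * phi x].

Definition spherical (lam : C) : T -> C := xget (fun=> 0) (is_spherical lam).

Definition convolution (f phi : T -> C) (x : T) : C :=
  csum (fun y => f y * radial_profile e o phi (d x y)).

Definition delta (p : \bar R) : R :=
  if (p < 2%:E)%E then (fine p)^-1 - 2^-1 else 0.

(* phi_{i delta_p}, which takes positive real values *)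
Definition spherical_delta (p : \bar R) : T -> C :=
  spherical (0 +i* delta p).

Definition weight (p : \bar R) (y : T) : R :=
  if (p < 2%:E)%E then q%:R `^ ((d y o)%:R / fine p)
  else q%:R `^ ((d y o)%:R / 2).

Definition l1_weight (p : \bar R) (f : T -> C) : Prop :=
  summable [set: T] (fun y => (normc (f y) * weight p y)%:E).

Definition l1_delta (p : \bar R) (f : T -> C) : Prop :=
  summable [set: T]
    (fun y => (normc (f y) * complex.Re (spherical_delta p y))%:E).

Definition mass (nu : probability (boundary e o) R) (p : \bar R)
    (f : T -> C) (x : T) : C :=
  if (p < 2%:E)%E then
    csum (fun y => f y *
      (average nu (boundary_arc e o x)
         (fun w => q%:R `^ ((height e o w y)%:~R / fine p)))%:C)
  else convolution f (spherical 0) x / spherical 0 x.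

Definition mass_radial (p : \bar R) (f : T -> C) : C :=
  csum (fun y => f y * spherical_delta p y).

End Analysis.

(* Main.v *)
(** Write h_t(x, y) = h_t(d(x, y)). With c0 = sqrt q / (q + 1) and s = c0 t, the heat
    kernel is exp (- (1 + 2 c0) t) q^(-n/2) J_s(n), where J_s is obtained from the
    one-dimensional profile B_s(k) = exp (2 s) I_k(2 s) by the recursion
    J(n) = B(n) - B(n+2) + J(n+2) / q. Everything is derived from Stein's identity
    B(k-1) - B(k+1) = (k / s) B(k).

    Put psi(n) = q^(-n/p) for p < 2 and psi = phi_0 for p >= 2. Stein's identity
    shows that the increments of h_t / psi, weighted by psi, are negligible in l^p
    compared with h_t: for p < 2 because h_t(n) q^(n/p) is a tilt of B with mean of
    order s and standard deviation of order sqrt s, for p >= 2 by a second order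
    expansion of J_s(n) / (n + (q+1)/(q-1)). Telescoping along the geodesic
    from o to y gives
      h_t(x, y) = psi(d(x, y)) / psi(|x|) * h_t(x) + negligible,
    and this quotient is the kernel of the mass function: for p >= 2 by definition,
    for p < 2 because h_w(y) = |x| - d(x, y) for all rays w through x as soon as
    |y| <= |x|. Jensen's inequality and a dominated convergence argument then sum
    over y. For radial f the sum is first grouped by spheres centred at o; the
    domination is a Schur test against q^(-d(., z)/p) with z far away if p <= 2, and
    the bound h_t <= C h_t(o) phi_0 with the product formula of phi_0 if p > 2. *)

(* The walk is made lazy so that B decreases in k; a simple walk would alternate with the parity.
   The tree walk and the half-line walk differ only at the root, whence the recursion for J. Its
   last term carries a factor 1/q, so it is a contraction: estimates of J follow from those of B by
   absorbing that term. No asymptotic expansion of Bessel functions enters. All bounds are relative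
   to B(0) or to the mass of the tilted profile, and these quantities cancel in the quotient by the
   norm. The delicate exponent is p = 2: there is no drift to exploit, and phi_0 just fails to be in
   l^2, so pointwise bounds on the increments lose too much; a fourth moment of B replaces them. For
   p < 2 the mass kernel differs from the quotient of profiles when |x| < |y|. This is harmless
   because bounded neighbourhoods of o carry a vanishing proportion of the norm. For radial f only
   the spherical function of |y| is summable against f. It is much smaller than the weight of the
   other case, so bounds on single kernels cannot be summed; the average over a sphere has the right
   size. *)
Require Import Defs.
From mathcomp Require Import zify ring lra.

Set Implicit Arguments.
Unset Strict Implicit.
Unset Printing Implicit Defensive.

Import Order.TTheory GRing.Theory Num.Theory.
Import numFieldNormedType.Exports.

Local Open Scope classical_set_scope.
Local Open Scope ring_scope.
Local Open Scope complex_scope.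

(** * Distances and spheres in a homogeneous tree *)

Section TreeMetric.
Variables (T : choiceType) (e : rel T) (q : nat) (hT : homogeneous_tree e q).
Local Notation d := (dist e).

(** Connectedness and minimisation of the length: the default value in [dist] is never taken. *)
Lemma geodesic_dist x y : exists2 s, geodesic e x s y & size s = d x y.
Proof.
have [s0 ps0 ls0] := tree_connected hT x y.
pose P n := `[< exists s, [/\ path e x s, last x s = y & size s = n] >].
have exP : exists n, P n by exists (size s0); apply/asboolP; exists s0.
case: (ex_minnP exP) => n /asboolP[s [ps ls sn]] nmin.
have gs : geodesic e x s y.
  split=> // s' ps' ls'; rewrite sn; apply: nmin; apply/asboolP; by exists s'.
have : [set n | exists2 s, geodesic e x s y & size s = n] (d x y).
  by rewrite /dist; apply: (xgetPex 0%N); exists n; exists s.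
by [].
Qed.

Lemma geodesic_size x y s : geodesic e x s y -> size s = d x y.
Proof.
case=> ps ls sm; have [s' [ps' ls' s'm] <-] := geodesic_dist x y.
by apply/eqP; rewrite eqn_leq sm //= s'm.
Qed.

Lemma dist_path x s : path e x s -> (d x (last x s) <= size s)%N.
Proof.
move=> ps; have [s' [ps' ls' s'm] <-] := geodesic_dist x (last x s).
exact: s'm.
Qed.

Lemma dist_refl x : d x x = 0%N.
Proof. by apply/eqP; rewrite -leqn0; apply: (@dist_path x [::]). Qed.

Lemma dist_eq0 x y : (d x y == 0%N) = (x == y).
Proof.
apply/eqP/eqP => [|->]; last exact: dist_refl.
by have [s [_ ls _] <-] := geodesic_dist x y; case: s ls.
Qed.

Lemma dist_le_sym x y : (d x y <= d y x)%N.
Proof.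
have [s [ps ls _] <-] := geodesic_dist y x.
have pr : path e x (rev (belast y s)).
  rewrite -ls rev_path.
  by rewrite (@eq_path _ _ e) // => u v; rewrite (tree_sym hT).
have lr : last x (rev (belast y s)) = y.
  by case: s ls {ps pr} => [<-|u s] //= _; rewrite rev_cons last_rcons.
by have := dist_path pr; rewrite lr size_rev size_belast.
Qed.

Lemma dist_sym x y : d x y = d y x.
Proof. by apply/eqP; rewrite eqn_leq !dist_le_sym. Qed.

Lemma dist_triangle x y z : (d x z <= d x y + d y z)%N.
Proof.
have [s [ps ls _] <-] := geodesic_dist x y.
have [s' [ps' ls' _] <-] := geodesic_dist y z.
have := @dist_path x (s ++ s'); rewrite cat_path ps ls ps' last_cat ls ls' size_cat.
by apply.
Qed.

Lemma dist_edge x y b : e x y -> (d x b <= (d y b).+1)%N.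
Proof.
move=> exy; apply: leq_trans (dist_triangle x y b) _; rewrite -add1n leq_add2r.
by apply: (@dist_path x [:: y]); rewrite /= exy.
Qed.

Lemma dist_parent x b n : d x b = n.+1 -> exists2 z, e x z & d z b = n.
Proof.
move=> dx; have [s [ps ls sm] ss] := geodesic_dist x b.
case: s ps ls sm ss => [|z s] /=; first by rewrite dx.
move=> /andP[exz ps] ls sm; rewrite dx => -[sn]; exists z => //.
apply/eqP; rewrite eqn_leq -{1}sn -{1}ls dist_path //= -ltnS -dx.
exact: dist_edge.
Qed.

(* The path is prolonged by the parents of its two ends until these coincide,
   which closes a cycle. *)
Lemma level_path_false b m u v s : u != v -> d u b = m -> d v b = m ->
  path e u s -> last u s = v -> uniq (u :: s) ->
  (forall w, w \in s -> w != v -> (m < d w b)%N) -> False.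
Proof.
elim: m u v s => [|m IH] u v s uv du dv ps ls us lev.
  move/eqP: du; move/eqP: dv; rewrite !dist_eq0 => /eqP vb /eqP ub.
  by rewrite vb ub eqxx in uv.
have [u' eu du'] := dist_parent du.
have [v' ev dv'] := dist_parent dv.
have s0 : (0 < size s)%N by case: s ls {ps us lev} uv => //= ->; rewrite eqxx.
have lev' w : w \in u :: s -> (m < d w b)%N.
  rewrite inE => /orP[/eqP->|ws]; first by rewrite du.
  by have [->|wv] := eqVneq w v; [rewrite dv | apply: leq_trans (lev _ ws wv)].
have [uv'|uv'] := eqVneq u' v'.
  apply: (tree_acyclic hT (s := u' :: u :: s)); first by rewrite /= !ltnS.
  rewrite /ucycle /= rcons_path ls ps [e u' u](tree_sym hT) eu uv' ev /=.
  move: us; rewrite cons_uniq => /andP[-> ->]; rewrite !andbT.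
  by apply/negP => /lev'; rewrite dv' ltnn.
apply: (IH u' v' (rcons (u :: s) v')) => //.
- by rewrite rcons_path /= ls ps [e u' u](tree_sym hT) eu ev.
- by rewrite last_rcons.
- rewrite cons_uniq mem_rcons inE (negbTE uv') rcons_uniq us andbT.
  by apply/andP; split; apply/negP => /lev'; rewrite ?du' ?dv' ltnn.
- move=> w; rewrite mem_rcons inE => /orP[/eqP->|]; first by rewrite eqxx.
  by move=> /lev'.
Qed.

(** An edge inside a level would be a level path of length one, which [level_path_false]
    excludes. *)
Lemma dist_edge_neq x y b : e x y -> d x b <> d y b.
Proof.
move=> exy dxy; have xy : x != y.
  by apply/eqP => xy; move: exy; rewrite xy (tree_irr hT).
apply: (@level_path_false b (d y b) x y [:: y]) => //=.
- by rewrite exy.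
- by rewrite inE xy.
- by move=> w; rewrite inE => /eqP->; rewrite eqxx.
Qed.

(** Two parents of x would be joined through x by a path staying above their level. *)
Lemma dist_parent_uniq x y z b n : d x b = n.+1 -> e x y -> e x z ->
  d y b = n -> d z b = n -> y = z.
Proof.
move=> dx exy exz dy dz; apply/eqP/negP => /negP yz.
have nx w : d w b = n -> w != x.
  by move=> dw; apply/eqP => wx; move: dx; rewrite -wx dw; lia.
apply: (@level_path_false b n y z [:: x; z]) => //=.
- by rewrite exz [e y x](tree_sym hT) exy.
- by rewrite !inE negb_or nx //= yz [x == z]eq_sym nx.
- move=> w; rewrite !inE => /orP[/eqP->|/eqP->]; first by rewrite dx.
  by rewrite eqxx.
Qed.

Lemma dist_edgeP x y b : e x y -> d y b = (d x b).+1 \/ d x b = (d y b).+1.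
Proof.
move=> exy; have := dist_edge b exy; have := @dist_edge_neq _ _ b exy.
by rewrite (tree_sym hT) in exy; have := dist_edge b exy; lia.
Qed.

Lemma dist1 x y : (d x y == 1%N) = e x y.
Proof.
apply/eqP/idP => [dx|exy].
  have [z exz /eqP] := dist_parent dx; rewrite dist_eq0 => /eqP <-.
  by rewrite exz.
by have [] := dist_edgeP y exy; rewrite dist_refl.
Qed.

Definition nb x : seq T := finmap.enum_fset (fset_set [set y | e x y]).

Lemma nb_uniq x : uniq (nb x).
Proof. exact: finmap.fset_uniq. Qed.

Lemma size_nb x : size (nb x) = q.+1.
Proof. by rewrite -(card_fset_set (tree_degree hT x)). Qed.

Lemma mem_nb x y : (y \in nb x) = e x y.
Proof.
rewrite [LHS]in_fset_set; first by apply/asboolP/idP.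
by exists q.+1; exact: tree_degree hT x.
Qed.

Lemma size_nb_parents w b n : d w b = n.+1 ->
  size [seq v <- nb w | d v b == n] = 1%N.
Proof.
move=> dw; have [z ewz dz] := dist_parent dw.
rewrite -[1%N]/(size [:: z]); apply: perm_size; apply: uniq_perm => //.
  by rewrite filter_uniq // nb_uniq.
move=> v; rewrite mem_filter mem_nb inE; apply/andP/eqP => [[/eqP dv ewv]|->].
  exact: dist_parent_uniq dw ewv ewz dv dz.
by rewrite dz.
Qed.

Lemma size_nb_children w b n : d w b = n.+1 ->
  size [seq v <- nb w | d v b == n.+2] = q.
Proof.
move=> dw; have := count_predC (fun v => d v b == n) (nb w).
rewrite -!size_filter size_nb_parents // size_nb add1n => -[] <-.
rewrite !size_filter; apply: eq_in_count => v; rewrite mem_nb => ewv /=.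
case: (dist_edgeP b ewv); rewrite dw; [move=> ->|case=> <-].
  by rewrite eqxx; apply/esym/eqP; lia.
by rewrite eqxx; apply/negbTE/eqP; lia.
Qed.

(** Spheres are duplicate-free lists, so that sums over them are plain big operators; [undup] spares
    the proof that distinct parents have disjoint children. *)
Fixpoint sphere (y : T) (n : nat) : seq T :=
  if n is n'.+1 then
    undup [seq v <- flatten [seq nb w | w <- sphere y n'] | d v y == n]
  else [:: y].

Lemma sphere_uniq y n : uniq (sphere y n).
Proof. by case: n => [|n] //=; exact: undup_uniq. Qed.

Lemma mem_sphere y n v : (v \in sphere y n) = (d v y == n).
Proof.
elim: n v => [|n IH] v /=; first by rewrite inE dist_eq0.
rewrite mem_undup mem_filter; apply/andP/idP => [[]//|dv]; split=> //.
have [z evz dz] := dist_parent (eqP dv).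
apply/flattenP; exists (nb z); last by rewrite mem_nb (tree_sym hT).
by apply/mapP; exists z => //; rewrite IH dz.
Qed.

Definition ball y n : seq T := flatten [seq sphere y k | k <- iota 0 n].

Lemma mem_ball y n v : (v \in ball y n) = (d v y < n)%N.
Proof.
apply/flattenP/idP => [[s /mapP[k]]|dv].
  by rewrite mem_iota add0n => /= kn ->; rewrite mem_sphere => /eqP->.
exists (sphere y (d v y)); last by rewrite mem_sphere.
by apply/mapP; exists (d v y) => //; rewrite mem_iota.
Qed.

Lemma ball_uniq y n : uniq (ball y n).
Proof.
elim: n => [|n IH] //; rewrite /ball -addn1 iotaD map_cat flatten_cat /= cats0.
rewrite cat_uniq IH sphere_uniq andbT; apply/hasPn => v.
by rewrite mem_sphere add0n => /eqP dv; rewrite mem_ball dv ltnn.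
Qed.

Lemma big_ball (V : nmodType) y n (g : T -> V) :
  \sum_(v <- ball y n) g v = \sum_(0 <= k < n) \sum_(v <- sphere y k) g v.
Proof. by rewrite /ball big_flatten big_map /index_iota subn0. Qed.

Lemma sub_ball y (s : seq T) : exists n, {subset s <= ball y n}.
Proof.
elim: s => [|v s [n sn]]; first by exists 0%N.
exists (n + (d v y).+1)%N => w; rewrite inE mem_ball => /orP[/eqP->|/sn]; first lia.
by rewrite mem_ball; lia.
Qed.

Lemma sum_nb_sphere (V : nmodType) (y w : T) n (g : T -> V) :
  \sum_(v <- nb w | d v y == n) g v = \sum_(v <- sphere y n | e w v) g v.
Proof.
rewrite -big_filter -[RHS]big_filter; apply: perm_big; apply: uniq_perm.
- by rewrite filter_uniq // nb_uniq.
- by rewrite filter_uniq // sphere_uniq.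
- by move=> v; rewrite !mem_filter mem_nb mem_sphere andbC.
Qed.

Definition branching n : nat := if n is _.+1 then q else q.+1.

Lemma size_filter_children y n v : v \in sphere y n ->
  size [seq w <- sphere y n.+1 | e v w] = branching n.
Proof.
rewrite mem_sphere => /eqP dv.
have -> : size [seq w <- sphere y n.+1 | e v w] =
          size [seq w <- nb v | d w y == n.+1].
  apply: perm_size; apply: uniq_perm.
  - by rewrite filter_uniq // sphere_uniq.
  - by rewrite filter_uniq // nb_uniq.
  - by move=> w; rewrite !mem_filter mem_nb mem_sphere andbC.
case: n dv => [|n] dv /=; last exact: size_nb_children.
rewrite -[RHS](size_nb v) size_filter -[RHS]count_predT.
apply: eq_in_count => w; rewrite mem_nb => /(dist_edgeP y); rewrite dv => -[->|] //.
Qed.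

Lemma size_filter_parents y n v : v \in sphere y n.+1 ->
  size [seq w <- sphere y n | e v w] = 1%N.
Proof.
rewrite mem_sphere => /eqP dv; rewrite -(size_nb_parents dv).
apply: perm_size; apply: uniq_perm.
- by rewrite filter_uniq // sphere_uniq.
- by rewrite filter_uniq // nb_uniq.
- by move=> w; rewrite !mem_filter mem_nb mem_sphere andbC.
Qed.

(** Double counting of the edges between two spheres: v is counted once for each of its neighbours
    on the other sphere. *)
Lemma sum_sphere_edges (V : nmodType) y m n k (g : T -> V) :
  (forall v, v \in sphere y m -> size [seq w <- sphere y n | e v w] = k) ->
  \sum_(w <- sphere y n) \sum_(v <- sphere y m | e w v) g v =
  (\sum_(v <- sphere y m) g v) *+ k.
Proof.
move=> sz; under eq_bigr do rewrite big_mkcond.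
rewrite exchange_big -sumrMnl /=; apply: eq_big_seq => v vm.
rewrite -big_mkcond /= -(sz v vm) -big_filter.
rewrite (eq_filter (a2 := e v)); last by move=> w; rewrite (tree_sym hT).
by rewrite big_const_seq count_predT iter_addr_0.
Qed.

(** A vertex at level n + 2 is reached once, from its parent; a vertex at level n once from each
    child. This recursion is the source of every mean value formula below. *)
Lemma sum_sphere_nb (V : nmodType) y n (g : T -> V) :
  \sum_(w <- sphere y n.+1) \sum_(v <- nb w) g v =
  \sum_(v <- sphere y n.+2) g v + (\sum_(v <- sphere y n) g v) *+ branching n.
Proof.
rewrite -(sum_sphere_edges _ (@size_filter_children y n)).
rewrite -[X in X + _]mulr1n -(sum_sphere_edges _ (@size_filter_parents y n.+1)).
rewrite -big_split; apply: eq_big_seq => w.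
rewrite mem_sphere => /eqP dw; rewrite -!sum_nb_sphere /=.
rewrite (bigID (fun v => d v y == n.+2)) /=; congr (_ + _).
rewrite big_seq_cond [RHS]big_seq_cond; apply: eq_bigl => v.
rewrite mem_nb; case: (boolP (e w v)) => //= ewv.
case: (dist_edgeP y ewv); rewrite dw; [move=> ->|case=> <-].
  by rewrite eqxx; apply/esym/negbTE/eqP; lia.
by rewrite eqxx; apply/eqP; lia.
Qed.

Lemma sum_nb (V : nmodType) y (g : T -> V) :
  \sum_(v <- nb y) g v = \sum_(v <- sphere y 1) g v.
Proof.
apply: perm_big; apply: uniq_perm; rewrite ?nb_uniq ?sphere_uniq // => v.
by rewrite mem_nb mem_sphere dist1 (tree_sym hT).
Qed.

Lemma size_sphere y n : size (sphere y n.+1) = (q.+1 * q ^ n)%N.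
Proof.
have sz k : size (sphere y k) = \sum_(v <- sphere y k) 1%N by rewrite sum1_size.
have s1 : size (sphere y 1) = q.+1.
  by rewrite sz -sum_nb sum1_size size_nb.
have rec k : (size (sphere y k.+1) * q.+1 =
              size (sphere y k.+2) + size (sphere y k) * branching k)%N.
  have := @sum_sphere_nb nat y k (fun=> 1%N).
  rewrite -!sz; under eq_bigr do rewrite sum1_size size_nb.
  have mulrnE (a m : nat) : a *+ m = (a * m)%N.
    by elim: m => [|m IHm]; rewrite ?muln0 // mulrS IHm mulnS.
  by rewrite big_const_seq count_predT iter_addr_0 !mulrnE mulnC => ->.
suff : size (sphere y n.+1) = (q.+1 * q ^ n)%N /\
       size (sphere y n.+2) = (q.+1 * q ^ n.+1)%N by case.
elim: n => [|n [IH1 IH2]].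
  split; first by rewrite s1 muln1.
  have := rec 0%N; rewrite s1 /= mul1n expn1; lia.
split=> //; have := rec n.+1; rewrite IH1 IH2 /= !expnS; nia.
Qed.

(** The orthogonal polynomials of the tree, relatives of the Chebyshev polynomials: they express the
    sum over a sphere as a polynomial in the adjacency operator, of which [mu] is an eigenvalue. *)
Fixpoint sphere_coef (K : pzRingType) (mu : K) n : K :=
  match n with
  | 0 => 1
  | n1.+1 => match n1 with
             | 0 => mu
             | n2.+1 => mu * sphere_coef mu n1 - (branching n2)%:R * sphere_coef mu n2
             end
  end.

(** The eigenvalue equation is asked only at distance less than n from y. This matters for al ^ d(.,
    z), which is an eigenfunction only away from z. *)
Lemma mean_value (K : pzRingType) (mu : K) (g : T -> K) y n :
  (forall w, (d w y < n)%N -> \sum_(v <- nb w) g v = mu * g w) ->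
  \sum_(v <- sphere y n) g v = sphere_coef mu n * g y.
Proof.
move=> eig; suff : forall k, (k <= n)%N ->
    \sum_(v <- sphere y k) g v = sphere_coef mu k * g y /\
    ((k < n)%N -> \sum_(v <- sphere y k.+1) g v = sphere_coef mu k.+1 * g y).
  by move=> /(_ n (leqnn n)) [].
elim=> [|k IH] kn; first split.
- by rewrite big_seq1 mul1r.
- by move=> n0; rewrite -sum_nb eig // dist_refl.
have [IH1 IH2] := IH (ltnW kn); split; first exact: IH2.
move=> kn'; have := sum_sphere_nb y k g.
under eq_big_seq => w.
  by rewrite mem_sphere => /eqP dw; rewrite eig ?dw //; over.
rewrite -mulr_sumr IH1 (IH2 kn) => /esym/(canRL (addrK _)) ->.
by rewrite /= mulrBl -mulrA mulr_natl mulrnAl.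
Qed.

End TreeMetric.

(** * Exponential generating functions and walks *)

Section ExponentialGeneratingFunctions.
Variable R : realType.
Implicit Types (a b : nat -> R) (t : R).

(** Geometric growth gives absolute convergence of the exponential generating function at every t,
    and is stable under the operations used here. *)
Definition geo_bounded a := exists A K : R,
  [/\ 0 <= A, 0 <= K & forall m, `|a m| <= A * K ^+ m].

Definition egf a t : R := limn (series (fun m => exp_coeff t m * a m)).

Lemma normed_egf_term_le a t A K m : 0 <= A -> 0 <= K ->
  (forall m, `|a m| <= A * K ^+ m) ->
  `|exp_coeff t m * a m| <= A * exp_coeff (K * `|t|) m.
Proof.
move=> A0 K0 aK; rewrite normrM /exp_coeff /= normrM normrX.
rewrite [`|(_)^-1|]ger0_norm ?invr_ge0 //.
have -> : A * ((K * `|t|) ^+ m / m`!%:R) = `|t| ^+ m / m`!%:R * (A * K ^+ m).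
  by rewrite exprMn; ring.
by apply: ler_wpM2l => //; rewrite mulr_ge0 ?exprn_ge0 ?invr_ge0.
Qed.

Lemma egf_normed_cvg a t : geo_bounded a ->
  cvgn [normed series (fun m => exp_coeff t m * a m)].
Proof.
move=> [A [K [A0 K0 aK]]].
apply: (@series_le_cvg _ _ (fun m => A * exp_coeff (K * `|t|) m)).
- by move=> m /=.
- by move=> m /=; rewrite mulr_ge0 // exp_coeff_ge0 // mulr_ge0.
- by move=> m /=; apply: normed_egf_term_le.
- by apply: (@is_cvg_seriesZ R _ A); apply: is_cvg_series_exp_coeff.
Qed.

Lemma egf_cvg a t : geo_bounded a -> cvgn (series (fun m => exp_coeff t m * a m)).
Proof. by move=> ga; apply: normed_cvg; exact: egf_normed_cvg. Qed.

Lemma geo_boundedD a b : geo_bounded a -> geo_bounded b ->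
  geo_bounded (fun m => a m + b m).
Proof.
move=> [A [K [A0 K0 aK]]] [B [L [B0 L0 bL]]].
exists (A + B), (K + L); split; rewrite ?addr_ge0 // => m.
apply: le_trans (ler_normD _ _) _; rewrite mulrDl lerD //.
- by apply: le_trans (aK m) _; rewrite ler_wpM2l // lerXn2r ?nnegrE ?addr_ge0 // lerDl.
- by apply: le_trans (bL m) _; rewrite ler_wpM2l // lerXn2r ?nnegrE ?addr_ge0 // lerDr.
Qed.

Lemma geo_boundedZ a c : geo_bounded a -> geo_bounded (fun m => c * a m).
Proof.
move=> [A [K [A0 K0 aK]]]; exists (`|c| * A), K; split; rewrite ?mulr_ge0 // => m.
by rewrite normrM -mulrA ler_wpM2l.
Qed.

Lemma geo_bounded_scale a c : geo_bounded a -> geo_bounded (fun m => c ^+ m * a m).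
Proof.
move=> [A [K [A0 K0 aK]]]; exists A, (`|c| * K); split; rewrite ?mulr_ge0 // => m.
by rewrite normrM normrX exprMn mulrCA ler_wpM2l // exprn_ge0.
Qed.

Lemma egfD a b t : geo_bounded a -> geo_bounded b ->
  egf (fun m => a m + b m) t = egf a t + egf b t.
Proof.
move=> ga gb; rewrite /egf -lim_seriesD; try exact: egf_cvg.
by congr (limn (series _)); apply/funext => m; rewrite mulrDr.
Qed.

Lemma egfZ a c t : geo_bounded a -> egf (fun m => c * a m) t = c * egf a t.
Proof.
move=> ga; rewrite /egf -[RHS]lim_seriesZ; last exact: egf_cvg.
by congr (limn (series _)); apply/funext => m; rewrite mulrCA.
Qed.

Lemma egf_le a b t : 0 <= t -> geo_bounded a -> geo_bounded b ->
  (forall m, a m <= b m) -> egf a t <= egf b t.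
Proof.
move=> t0 ga gb ab; apply: lim_series_le; try exact: egf_cvg.
by move=> m; rewrite ler_wpM2l // exp_coeff_ge0.
Qed.

Lemma geo_bounded0 : geo_bounded (fun=> 0).
Proof. by exists 0, 0; split => // m; rewrite normr0 mul0r. Qed.

Lemma egf0 t : egf (fun=> 0) t = 0.
Proof.
rewrite /egf (_ : series _ = cst 0) ?lim_cst //.
by apply/funext => n; rewrite /series /= big1 // => m _; rewrite mulr0.
Qed.

Lemma egf_ge0 a t : 0 <= t -> geo_bounded a -> (forall m, 0 <= a m) -> 0 <= egf a t.
Proof.
by move=> t0 ga a0; rewrite -(egf0 t); apply: egf_le => //; exact: geo_bounded0.
Qed.

Lemma egf_ge_head a t : 0 <= t -> geo_bounded a -> (forall m, 0 <= a m) ->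
  a 0%N <= egf a t.
Proof.
move=> t0 ga a0; have -> : a 0%N = series (fun m => exp_coeff t m * a m) 1.
  by rewrite /series /= big_nat1 /exp_coeff /= expr0 fact0 divr1 mul1r.
apply: nondecreasing_cvgn_le; last exact: egf_cvg.
by apply: nondecreasing_series => m _ _; rewrite mulr_ge0 // exp_coeff_ge0.
Qed.

(** The identity t * t^m / m! = (m+1) t^(m+1) / (m+1)! shifts the index. It carries the Stein
    identity from the walk to the Bessel profile. *)
Lemma egf_shift a b t : t != 0 -> geo_bounded a -> geo_bounded b -> b 0%N = 0 ->
  (forall m, b m.+1 = m.+1%:R * a m) -> egf b t = t * egf a t.
Proof.
move=> t0 ga gb b0 ba; rewrite /egf -[RHS]lim_seriesZ; last exact: egf_cvg.
apply: cvg_lim => //; rewrite -(cvg_shiftS).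
rewrite (_ : (fun n => _) = series (t *: (fun m => exp_coeff t m * a m))).
  by apply: is_cvg_seriesZ; exact: egf_cvg.
apply/funext => n; rewrite /series /= big_nat_recl // b0 mulr0 add0r.
apply: eq_bigr => m _; rewrite ba /exp_coeff /= /GRing.scale /= factS natrM exprS.
have fm : m`!%:R != 0 :> R by rewrite pnatr_eq0 -lt0n fact_gt0.
have m1 : m.+1%:R != 0 :> R by rewrite pnatr_eq0.
rewrite -[_ *: _]/(t * (t ^+ m / m`!%:R * a m)).
by move: (m.+1%:R) m1 (m`!%:R) fm => u u0 v v0; field; rewrite ?u0 ?v0.
Qed.

Lemma sum_antidiag (F : nat -> nat -> R) M :
  \sum_(0 <= n < M) \sum_(0 <= j < n.+1) F j (n - j)%N =
  \sum_(0 <= j < M) \sum_(0 <= i < M | (i + j < M)%N) F j i.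
Proof.
transitivity (\sum_(0 <= n < M) \sum_(0 <= j < M | (j <= n)%N) F j (n - j)%N).
  by apply: eq_big_nat => n /andP[_ nM]; rewrite (big_nat_widen 0 _ M).
rewrite (exchange_big_dep_nat xpredT) //=; apply: eq_big_nat => j /andP[_ jM].
transitivity (\sum_(j <= n < M) F j (n - j)%N).
  by rewrite [RHS](big_nat_widenl _ 0).
rewrite -{1}[j]add0n big_addn (big_nat_widen 0 _ M) ?leq_subr //.
by apply: eq_big => i; [rewrite ltn_subRL addnC | rewrite addnK].
Qed.

Lemma cauchy_product (u v U V : nat -> R) :
  (forall n, `|u n| <= U n) -> (forall n, `|v n| <= V n) ->
  cvgn (series (fun n => \sum_(0 <= j < n.+1) U j * V (n - j)%N)) ->
  cvgn (series u) -> cvgn (series v) ->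
  limn (series (fun n => \sum_(0 <= j < n.+1) u j * v (n - j)%N)) =
  limn (series u) * limn (series v).
Proof.
move=> uU vV cUV cu cv; apply: cvg_lim => //.
pose w := fun n => \sum_(0 <= j < n.+1) u j * v (n - j)%N.
pose W := fun n => \sum_(0 <= j < n.+1) U j * V (n - j)%N.
have cuv : series u n * series v n @[n --> \oo] --> limn (series u) * limn (series v).
  exact: cvgM.
(* The square of side n lies between the triangles of sides n and 2n, so what the Cauchy product of
   length n misses of the product of partial sums is bounded by the mass of W between these
   triangles. *)
have cW : series W n.*2 - series W n @[n --> \oo] --> (0 : R).
  rewrite -(subrr (limn (series W))); apply: cvgB => //.
  apply: (@cvg_comp _ _ _ double (series W) _ \oo) => //.
  by move=> A [N _ NA]; exists N => // n /= Nn; apply: NA => /=; lia.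
have dW : series u n * series v n - series w n @[n --> \oo] --> (0 : R).
  apply: norm_cvg0; apply: (squeeze_cvgr _ (cvg_cst 0) cW).
  apply: nearW => n; rewrite normr_ge0 /=.
  have EU M : series W M = \sum_(0 <= j < M) \sum_(0 <= i < M | (i + j < M)%N) U j * V i.
    exact: (sum_antidiag (fun j i => U j * V i)).
  have -> : series w n = \sum_(0 <= j < n) \sum_(0 <= i < n | (i + j < n)%N) u j * v i.
    exact: (sum_antidiag (fun j i => u j * v i)).
  rewrite !EU /series /=.
  rewrite big_distrlr /=.
  have idE (f : nat -> nat -> R) : \sum_(0 <= j < n) \sum_(0 <= i < n) f j i =
      \sum_(0 <= j < n) \sum_(0 <= i < n | (i + j < n)%N) f j i +
      \sum_(0 <= j < n) \sum_(0 <= i < n | ~~ (i + j < n)%N) f j i.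
    rewrite -big_split; apply: eq_bigr => j _.
    by rewrite [LHS](bigID (fun i => (i + j < n)%N))/=.
  rewrite idE addrC addKr.
  apply: (@le_trans _ _ (\sum_(0 <= j < n) \sum_(0 <= i < n | ~~ (i + j < n)%N) U j * V i)).
    apply: le_trans (ler_norm_sum _ _ _) _; apply: ler_sum => j _.
    apply: le_trans (ler_norm_sum _ _ _) _; apply: ler_sum => i _.
    by rewrite normrM ler_pM.
  rewrite lerBrDl -idE.
  have U0 k : 0 <= U k by apply: le_trans (uU k).
  have V0 k : 0 <= V k by apply: le_trans (vV k).
  rewrite -addnn [leRHS](big_cat_nat _ (n := n)) ?leq_addr //=.
  rewrite -[leLHS]addr0 lerD //; last first.
    by apply: sumr_ge0 => j _; apply: sumr_ge0 => i _; rewrite mulr_ge0.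
  rewrite big_nat_cond [leRHS]big_nat_cond; apply: ler_sum => j; rewrite andbT => /andP[_ jn].
  rewrite (big_nat_widen 0 n (n + n)) ?leq_addr //= big_mkcond [leRHS]big_mkcond /=.
  apply: ler_sum => i _; case: ifP => [iN|_]; last by case: ifP; rewrite ?mulr_ge0.
  by rewrite ifT //; move: iN jn; lia.
rewrite (_ : series w = fun n => series u n * series v n -
                                  (series u n * series v n - series w n)).
  rewrite -[X in _ --> X]subr0; exact: cvgB.
by apply/funext => n; rewrite subKr.
Qed.

(** The binomial transform is the Cauchy product with an exponential series. It serves to split off
    the scalar part of the Laplacian. *)
Lemma egf_mul_expR (a : nat -> R) (x t : R) : geo_bounded a ->
  egf (fun n => \sum_(0 <= j < n.+1) 'C(n, j)%:R * x ^+ (n - j) * a j) t =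
  egf a t * expR (x * t).
Proof.
move=> ga; have [A [K [A0 K0 aK]]] := ga.
rewrite /egf /expR -(@cauchy_product _ _ (fun j => A * exp_coeff (K * `|t|) j)
  (exp_coeff `|x * t|)); first last.
- exact: is_cvg_series_exp_coeff.
- exact: egf_cvg.
- rewrite (_ : (fun n => _) = fun n => A * exp_coeff (K * `|t| + `|x * t|) n).
    by apply: (@is_cvg_seriesZ R _ A); apply: is_cvg_series_exp_coeff.
  apply/funext => n; rewrite /exp_coeff /= addrC exprDn big_mkord mulr_suml mulr_sumr.
  apply: eq_bigr => -[j /= jn] _.
  have fE : n`!%:R = 'C(n, j)%:R * (j`!%:R * (n - j)`!%:R) :> R.
    by rewrite -(bin_fact (m := j)) // !natrM.
  rewrite -mulr_natr fE.
  have [b0 j0 nj0] : [/\ 'C(n, j)%:R != 0 :> R, j`!%:R != 0 :> R & (n - j)`!%:R != 0 :> R].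
    by rewrite !pnatr_eq0 -!lt0n !fact_gt0 bin_gt0.
  by field; rewrite ?b0 ?j0 ?nj0.
- by move=> n; rewrite /exp_coeff /= normrM normrX [`|(_)^-1|]ger0_norm ?invr_ge0.
- by move=> n; exact: normed_egf_term_le.
congr (limn (series _)); apply/funext => n; rewrite mulr_sumr.
apply: eq_big_nat => j /andP[_ jn].
have fE : n`!%:R = 'C(n, j)%:R * (j`!%:R * (n - j)`!%:R) :> R.
  by rewrite -(bin_fact (m := j)) // !natrM.
rewrite /exp_coeff /= fE.
have [b0 j0 nj0] : [/\ 'C(n, j)%:R != 0 :> R, j`!%:R != 0 :> R & (n - j)`!%:R != 0 :> R].
  by rewrite !pnatr_eq0 -!lt0n !fact_gt0 bin_gt0.
have tE : t ^+ n = t ^+ j * t ^+ (n - j) by rewrite -exprD subnKC.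
rewrite exprMn tE.
by field; rewrite ?b0 ?j0 ?nj0.
Qed.

Lemma egf_scale (a : nat -> R) (c t : R) : egf (fun j => c ^+ j * a j) t = egf a (c * t).
Proof.
congr (limn (series _)); apply/funext => n; rewrite /exp_coeff /= exprMn; ring.
Qed.

End ExponentialGeneratingFunctions.

(** * The lazy walk on the half-line and its tree analogue *)

Section LazyWalk.
Variables (R : realType) (q : nat).
Hypothesis q_gt1 : (1 < q)%N.

(* lazy_walk m k = 'C(2 * m, m + k) counts the paths of the walk with step
   weights 1, 2, 1; tree_walk is its analogue for the distance to o in the
   tree, conjugated by q ^ (k / 2). *)
Fixpoint lazy_walk (m k : nat) : R :=
  if m is m'.+1 then
    (if k is k'.+1 then lazy_walk m' k' else lazy_walk m' 1) +
    2 * lazy_walk m' k + lazy_walk m' k.+1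
  else (k == 0%N)%:R.

Fixpoint tree_walk (m k : nat) : R :=
  if m is m'.+1 then
    if k is k'.+1 then tree_walk m' k' + 2 * tree_walk m' k + tree_walk m' k.+1
    else 2 * tree_walk m' 0 + (1 + q%:R^-1) * tree_walk m' 1
  else (k == 0%N)%:R.

Local Notation b := lazy_walk.
Local Notation a := tree_walk.

Lemma lazy_walk_ge0 m k : 0 <= b m k.
Proof.
elim: m k => [|m IH] [|k] /=; rewrite ?ler0n //.
  by have := IH 1%N; have := IH 0%N; lra.
by have := IH k; have := IH k.+1; have := IH k.+2; lra.
Qed.

Lemma tree_walk_ge0 m k : 0 <= a m k.
Proof.
elim: m k => [|m IH] [|k] /=; rewrite ?ler0n //.
  by rewrite addr_ge0 // mulr_ge0 // addr_ge0 // invr_ge0.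
by have := IH k; have := IH k.+1; have := IH k.+2; lra.
Qed.

Lemma lazy_walk_decr m k : b m k.+1 <= b m k.
Proof.
elim: m k => [|m IH] [|k] /=; rewrite ?ler01 //.
  by have := IH 0%N; have := IH 1%N; lra.
by have := IH k; have := IH k.+1; have := IH k.+2; lra.
Qed.

Lemma tree_walk_le m k : a m k <= b m k.
Proof.
elim: m k => [|m IH] [|k] //=; last first.
  by have := IH k; have := IH k.+1; have := IH k.+2; lra.
have : (1 + q%:R^-1) * a m 1 <= 2 * b m 1.
  apply: ler_pM (IH 1%N); rewrite ?tree_walk_ge0 // ?addr_ge0 ?invr_ge0 //.
  have : (q%:R : R)^-1 <= 1 by rewrite invf_le1 ?ler1n ?ltr0n; lia.
  lra.
have := IH 0%N; lra.
Qed.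

(** Away from 0 both walks obey the same recursion in m, which propagates the relation. At k = 0 the
    excess weight 1/q of [tree_walk] is matched by the step from level 1 to level 2 in the last
    term, and the doubled step of [lazy_walk] by the subtracted one. *)
Lemma tree_walk_rec m k : a m k = b m k - b m k.+2 + q%:R^-1 * a m k.+2.
Proof.
elim: m k => [|m IH] [|k] /=.
- by rewrite mulr0 subr0 addr0.
- by rewrite mulr0 subr0 addr0.
- by have := IH 0%N; have := IH 1%N; lra.
- by have := IH k; have := IH k.+1; have := IH k.+2; lra.
Qed.

(** The binomial form of the Bessel relation I_(k-1)(z) - I_(k+1)(z) = (2k/z) I_k(z). *)
Lemma lazy_walk_stein m k :
  k.+1%:R * b m.+1 k.+1 = m.+1%:R * (b m k - b m k.+2).
Proof.
elim: m k => [|m IH] k.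
  by case: k => [|[|k]] /=; ring.
case: k => [|k].
  have := IH 0%N; have := IH 1%N; rewrite /= -!natr1; lra.
have := IH k; have := IH k.+1; have := IH k.+2; rewrite /= -!natr1; lra.
Qed.

(** The function y^(-k) is an eigenfunction of the step with eigenvalue y + 2 + 1/y for k > 0, and a
    supersolution at k = 0 because y >= 1. *)
Lemma lazy_walk_decay (y : R) m k : 1 <= y -> b m k <= (y + 2 + y^-1) ^+ m * y ^- k.
Proof.
move=> y1; have y0 : 0 < y by lra.
have yV : 0 < y^-1 by rewrite invr_gt0.
elim: m k => [|m IH] k.
  by case: k => [|k] /=; rewrite mul1r ?expr0 ?invr1 // invr_ge0 exprn_ge0 // ltW.
have C0 : 0 <= (y + 2 + y^-1) ^+ m by rewrite exprn_ge0 //; lra.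
rewrite exprS; case: k => [|k] /=.
  have := IH 0%N; have := IH 1%N; rewrite expr0 expr1 invr1 => I1 I0.
  have yV1 : y^-1 <= 1 by rewrite invf_le1.
  have : (y + 2 + y^-1) ^+ m * y^-1 <= (y + 2 + y^-1) ^+ m * 1 by rewrite ler_wpM2l.
  have : (y + 2 + y^-1) ^+ m <= (y + 2 + y^-1) ^+ m * y by rewrite ler_peMr.
  lra.
have E1 : y ^- k = y * y ^- k.+1 by rewrite exprS invfM mulrA mulfV ?mul1r // gt_eqF.
have E2 : y ^- k.+2 = y^-1 * y ^- k.+1 by rewrite exprS invfM.
have := IH k; have := IH k.+1; have := IH k.+2; rewrite E1 E2.
lra.
Qed.

Lemma lazy_walk_geo k : geo_bounded (fun m => b m k).
Proof.
exists 1, 4; split=> // m; rewrite ger0_norm ?lazy_walk_ge0 // mul1r.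
have := @lazy_walk_decay 1 m k (lexx 1).
by rewrite expr1n invr1 mulr1 (_ : 1 + 2 + 1 = 4 :> R) //; ring.
Qed.

Lemma tree_walk_geo k : geo_bounded (fun m => a m k).
Proof.
have [A [K [A0 K0 bK]]] := lazy_walk_geo k; exists A, K; split=> // m.
apply: le_trans (bK m); rewrite !ger0_norm ?lazy_walk_ge0 ?tree_walk_ge0 //.
exact: tree_walk_le.
Qed.

End LazyWalk.

(** * Bessel profiles *)

Section BesselProfiles.
Variables (R : realType) (q : nat).
Hypothesis q_gt1 : (1 < q)%N.

(* bessel s k is exp (2 * s) times the modified Bessel function I_k (2 * s). *)
Definition bessel (s : R) k : R := egf (fun m => lazy_walk R m k) s.
Definition tree_bessel (s : R) k : R := egf (fun m => tree_walk R q m k) s.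

Local Notation B := bessel.
Local Notation J := tree_bessel.

Lemma bessel_ge0 s k : 0 <= s -> 0 <= B s k.
Proof. by move=> s0; apply: egf_ge0 => // *; [exact: lazy_walk_geo | exact: lazy_walk_ge0]. Qed.

Lemma bessel_decr s k : 0 <= s -> B s k.+1 <= B s k.
Proof. by move=> s0; apply: egf_le => // *; [exact: lazy_walk_geo.. | exact: lazy_walk_decr]. Qed.

Lemma le_bessel0 s k : 0 <= s -> B s k <= B s 0.
Proof. by move=> s0; elim: k => // k; apply: le_trans; exact: bessel_decr. Qed.

Lemma bessel0_ge1 s : 0 <= s -> 1 <= B s 0.
Proof.
by move=> s0; apply: (egf_ge_head s0 (lazy_walk_geo R 0)) => m; exact: lazy_walk_ge0.
Qed.

Lemma bessel_stein s k : 0 < s -> B s k - B s k.+2 = k.+1%:R / s * B s k.+1.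
Proof.
move=> s0; have gB := lazy_walk_geo R.
rewrite -[B s k - _]/(egf _ s + - egf _ s) -mulN1r -egfZ // -egfD //; last exact: geo_boundedZ.
have : egf (fun m => k.+1%:R * lazy_walk R m k.+1) s =
       s * egf (fun m => lazy_walk R m k + -1 * lazy_walk R m k.+2) s.
  apply: egf_shift; rewrite ?gt_eqF //.
  - by apply: geo_boundedD => //; exact: geo_boundedZ.
  - exact: geo_boundedZ.
  - by rewrite /= mulr0.
  - by move=> m; rewrite lazy_walk_stein mulN1r.
rewrite egfZ // -/(B s k.+1) => /(congr1 (fun z => z / s)).
by rewrite mulrAC [s * _]mulrC mulfK ?gt_eqF // => ->.
Qed.

Lemma tree_bessel_ge0 s k : 0 <= s -> 0 <= J s k.
Proof. by move=> s0; apply: egf_ge0 => // *; [exact: tree_walk_geo | exact: tree_walk_ge0]. Qed.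

Lemma tree_bessel0_ge1 s : 0 <= s -> 1 <= J s 0.
Proof.
by move=> s0; apply: (egf_ge_head s0 (tree_walk_geo R q_gt1 0)) => m; exact: tree_walk_ge0.
Qed.

Lemma tree_bessel_le s k : 0 <= s -> J s k <= B s k.
Proof.
move=> s0; apply: egf_le => // *; [exact: tree_walk_geo|exact: lazy_walk_geo|].
exact: tree_walk_le.
Qed.

Lemma tree_bessel_rec s k : J s k = B s k - B s k.+2 + q%:R^-1 * J s k.+2.
Proof.
have gB := lazy_walk_geo R; have gJ := tree_walk_geo R q_gt1.
rewrite -[B s k - _]/(egf _ s + - egf _ s) -mulN1r -egfZ // -egfD //; last exact: geo_boundedZ.
rewrite -egfZ // -egfD; last 2 first.
- by apply: geo_boundedD => //; exact: geo_boundedZ.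
- exact: geo_boundedZ.
by congr egf; apply/funext => m; rewrite tree_walk_rec mulN1r.
Qed.

(** As y is arbitrary, the decay for fixed s beats every geometric rate. This gives the convergence
    of all series in k, but nothing uniform in s. *)
Lemma bessel_decay (s y : R) : 0 <= s -> 1 <= y ->
  exists2 C, 0 <= C & forall k, B s k <= C * y ^- k.
Proof.
move=> s0 y1; have K0 : 0 <= y + 2 + y^-1 by rewrite !addr_ge0 ?invr_ge0 //; lra.
have gK : geo_bounded (fun m => (y + 2 + y^-1) ^+ m).
  by exists 1, (y + 2 + y^-1); split => // m; rewrite mul1r ger0_norm ?exprn_ge0.
exists (egf (fun m => (y + 2 + y^-1) ^+ m) s).
  by apply: egf_ge0 => // m; rewrite exprn_ge0.
move=> k; rewrite mulrC -egfZ //; apply: egf_le => //.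
- exact: lazy_walk_geo.
- exact: geo_boundedZ.
- by move=> m; rewrite mulrC lazy_walk_decay.
Qed.

End BesselProfiles.

(** * Monotone partial sums and elementary power inequalities *)

Section Sums.
Variable R : realType.

(** Disposes of the boundary terms w left by a truncated summation by parts: as u increases, the
    bound at infinity holds at every stage. *)
Lemma le_of_vanishing (u w : nat -> R) c : {homo u : m n / (m <= n)%N >-> m <= n} ->
  w n @[n --> \oo] --> (0 : R) -> (forall n, u n <= c + w n) -> forall n, u n <= c.
Proof.
move=> u_incr w0 uw n; have cw : c + w n @[n --> \oo] --> c.
  by rewrite -[X in _ --> X]addr0; apply: cvgD => //; exact: cvg_cst.
rewrite -(cvg_lim _ cw) //; apply: limr_ge; first by apply/cvg_ex; exists c.
by exists n => // m /= nm; apply: le_trans (uw m); exact: u_incr.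
Qed.

Lemma sum_homo (u : nat -> R) : (forall n, 0 <= u n) ->
  {homo (fun K => \sum_(0 <= k < K) u k) : m n / (m <= n)%N >-> m <= n}.
Proof.
move=> u0 m n mn; rewrite [leRHS](big_cat_nat _ (n := m)) //= lerDl.
by rewrite sumr_ge0.
Qed.

Lemma powR_succr (p w : R) : 0 < w -> w `^ p = w `^ (p - 1) * w.
Proof.
move=> w0; rewrite -{1}[p](subrK 1) [LHS]powRD ?powRr1 ?ltW //.
by apply/implyP => _; rewrite gt_eqF.
Qed.

(** A substitute for Hölder's inequality: summed over K points it bounds an l^p sum below by
    lam^(p-1) times the l^1 mass minus K lam. *)
Lemma powR_ge_affine (p lam w : R) : 1 <= p -> 0 <= lam -> 0 <= w ->
  lam `^ (p - 1) * (w - lam) <= w `^ p.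
Proof.
move=> p1 l0 w0; have [wl|lw] := leP w lam.
  apply: (@le_trans _ _ 0); last exact: powR_ge0.
  by rewrite mulr_ge0_le0 ?powR_ge0 // subr_le0.
have wp : 0 < w by apply: le_lt_trans lw.
rewrite [leRHS]powR_succr //.
apply: ler_pM; rewrite ?powR_ge0 ?subr_ge0 ?(ltW lw) //; last by rewrite gerBl.
by apply: ge0_ler_powR; rewrite ?nnegrE ?subr_ge0 // ltW.
Qed.

(** Interpolation: an l^p sum is controlled by the supremum and the l^1 sum. *)
Lemma powR_le_mul (p mu w : R) : 1 <= p -> 0 <= w -> w <= mu -> w `^ p <= mu `^ (p - 1) * w.
Proof.
move=> p1; rewrite le_eqVlt => /predU1P[<-|w0] wm.
  by rewrite powR0 ?mulr0 // gt_eqF //; lra.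
rewrite [leLHS]powR_succr //.
rewrite ler_wpM2r //; first exact: ltW.
by apply: ge0_ler_powR; rewrite ?nnegrE ?subr_ge0 // ltW // (lt_le_trans w0).
Qed.

End Sums.

(** * Drifted profiles *)

Section Drift.
Variables (R : realType) (s x : R).
Hypotheses (s_gt0 : 0 < s) (x_gt1 : 1 < x).
Local Notation B := (bessel s).

Let s_ge0 := ltW s_gt0.
Let B_ge0 k : 0 <= B k. Proof. exact: bessel_ge0. Qed.
Let B0_ge1 : 1 <= B 0%N. Proof. exact: bessel0_ge1. Qed.
Let B_stein k := bessel_stein k s_gt0.
Let x_gt0 : 0 < x. Proof. exact: lt_trans x_gt1. Qed.
(** On all of Z the tilted weights x^k I_k(2s) sum to exp(s (x + 1/x)); differentiating in log x
    gives the mean v s and the variance c s. This is where [v] and [c] come from. *)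
Let W k := x ^+ k * B k.
Let v := x - x^-1.
Let c := x + x^-1.
Let D k := W k - W k.+1.
Let A := limn (series W).

Let v_gt0 : 0 < v. Proof. by rewrite subr_gt0 (lt_trans _ x_gt1) // invf_lt1. Qed.
Let c_gt0 : 0 < c. Proof. by rewrite addr_gt0 ?invr_gt0. Qed.

Lemma tilt_ge0 k : 0 <= W k.
Proof. by rewrite mulr_ge0 // exprn_ge0 // ltW. Qed.

Lemma tilt_stein k : x * W k - W k.+2 / x = k.+1%:R / s * W k.+1.
Proof.
have -> : x * W k - W k.+2 / x = x ^+ k.+1 * (B k - B k.+2).
  rewrite /W !exprS; field; exact: lt0r_neq0.
by rewrite B_stein /W; ring.
Qed.

Lemma tilt_geometric : exists2 C, 0 <= C & forall k, W k <= C * 2^-1 ^+ k.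
Proof.
(* The rate 2x absorbs the tilt x^k and leaves 2^(-k). *)
have [|C C0 BC] := @bessel_decay _ s (2 * x) s_ge0; first by have := x_gt1; lra.
exists C => // k; have xk := exprn_gt0 k x_gt0.
have -> : C * 2^-1 ^+ k = x ^+ k * (C * (2 * x) ^- k).
  by rewrite exprMn exprVn; field; rewrite !expf_neq0 ?lt0r_neq0.
by rewrite /W ler_wpM2l // ltW.
Qed.

Lemma tilt_summable : cvgn (series W).
Proof.
have [C C0 WC] := tilt_geometric.
apply: (@series_le_cvg _ _ (geometric C 2^-1)) => [n|n|n|].
- exact: tilt_ge0.
- by rewrite /= mulr_ge0 // exprn_ge0 // invr_ge0.
- exact: WC.
- by apply: is_cvg_geometric_series; rewrite ger0_norm ?invr_ge0 //; lra.
Qed.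

Lemma tilt_vanish : W n @[n --> \oo] --> (0 : R).
Proof. exact: cvg_series_cvg_0 tilt_summable. Qed.

Lemma tilt_sum_le K : \sum_(0 <= k < K) W k <= A.
Proof.
apply: (@nondecreasing_cvgn_le _ (series W)); last exact: tilt_summable.
by apply: nondecreasing_series => n _ _; exact: tilt_ge0.
Qed.

Lemma tilt_mass_ge1 : 1 <= A.
Proof.
apply: le_trans (tilt_sum_le 1); by rewrite big_nat1 /W expr0 mul1r.
Qed.

(* By Stein's identity (bessel_stein) the probability W / A on the integers
   k >= 0 has mean about v * s and variance of order s. *)
Lemma tilt_second_moment_trunc K :
  \sum_(0 <= k < K.+1) (k%:R / s - v) ^+ 2 * W k <=
  c / s * \sum_(0 <= k < K.+1) W k + v * x * W K + v / x * W K.+1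
  - K.+1%:R / s * x * W K - K%:R / s / x * W K.+1.
Proof.
have xn0 : x != 0 by exact: lt0r_neq0.
have sn0 : s != 0 by exact: lt0r_neq0.
elim: K => [|K IH].
  rewrite !big_nat1 -subr_ge0.
  have -> : c / s * W 0%N + v * x * W 0%N + v / x * W 1%N - 1 / s * x * W 0%N
     - 0 / s / x * W 1%N - (0 / s - v) ^+ 2 * W 0%N =
     (x * s)^-1 * W 0%N + v / x * W 0%N + v / x * W 1%N.
    by rewrite /c /v; field; rewrite xn0 sn0.
  by rewrite !addr_ge0 // mulr_ge0 ?tilt_ge0 // ?divr_ge0 ?invr_ge0 ?mulr_ge0 // ltW.
rewrite big_nat_recr //= [in leRHS]big_nat_recr //=.
apply: le_trans (lerD IH (lexx _)) _.
have -> : W K = (W K.+2 / x + K.+1%:R / s * W K.+1) / x.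
  by rewrite -tilt_stein; field.
by rewrite le_eqVlt; apply/orP; left; apply/eqP; rewrite /c /v -!natr1; field; rewrite xn0 sn0.
Qed.

Lemma tilt_second_moment K :
  \sum_(0 <= k < K) (k%:R / s - v) ^+ 2 * W k <= c / s * A.
Proof.
apply: (@le_of_vanishing _ (fun K => \sum_(0 <= k < K) (k%:R / s - v) ^+ 2 * W k)
  (fun n => v * x * W n + v / x * W n.+1)).
- by apply: sum_homo => n; rewrite mulr_ge0 ?sqr_ge0 ?tilt_ge0.
- rewrite -[X in _ --> X]addr0 -[X in X + _](mulr0 (v * x)) -[X in _ + X](mulr0 (v / x)).
  apply: cvgD; apply: cvgM; try exact: cvg_cst; first exact: tilt_vanish.
  by rewrite (cvg_shiftS W); exact: tilt_vanish.
- move=> n; have h k : 0 <= (k%:R / s - v) ^+ 2 * W k by rewrite mulr_ge0 ?sqr_ge0 ?tilt_ge0.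
  apply: le_trans (sum_homo h (leqnSn n)) _.
  apply: le_trans (tilt_second_moment_trunc n) _.
  have := tilt_sum_le n.+1.
  rewrite -(ler_pM2l (_ : 0 < c / s)) ?divr_gt0 // => h1.
  have h2 : 0 <= n.+1%:R / s * x * W n.
    by rewrite mulr_ge0 ?tilt_ge0 // mulr_ge0 ?divr_ge0 // ltW.
  have h3 : 0 <= n%:R / s / x * W n.+1.
    by rewrite mulr_ge0 ?tilt_ge0 // !divr_ge0 // ltW.
  lra.
Qed.

(** This is the single term k = 0 of the second moment, where the squared deviation is v^2. *)
Lemma tilt_head : W 0%N <= c / (v ^+ 2) * (A / s).
Proof.
have := tilt_second_moment 1; rewrite big_nat1 mul0r sub0r sqrrN => h.
rewrite -(ler_pM2l (_ : 0 < v ^+ 2)) ?exprn_gt0 //.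
apply: le_trans h _; rewrite le_eqVlt; apply/orP; left; apply/eqP.
by field; rewrite !lt0r_neq0.
Qed.

Lemma tilt_first_moment K :
  \sum_(0 <= k < K) `|k%:R / s - v| * W k <= (c + 1) / 2 * (A / Num.sqrt s).
Proof.
have r0 : 0 < Num.sqrt s by rewrite sqrtr_gt0.
have rr : Num.sqrt s * Num.sqrt s = s by rewrite -expr2 sqr_sqrtr // ltW.
(* Young's inequality, weighted by sqrt s because k / s deviates from v by about 1 / sqrt s. *)
apply: (@le_trans _ _ (\sum_(0 <= k < K)
   (Num.sqrt s / 2 * ((k%:R / s - v) ^+ 2 * W k) + (Num.sqrt s)^-1 / 2 * W k))).
  apply: ler_sum => k _; rewrite -[_ ^+ 2]real_normK ?num_real //.
  rewrite [leRHS]addrC; have -> (y z w : R) : z * w + y * (`|k%:R / s - v| ^+ 2 * w) =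
    (y * `|k%:R / s - v| ^+ 2 + z) * w by ring.
  rewrite ler_wpM2r ?tilt_ge0 //; set u := `|_|; rewrite -subr_ge0.
  rewrite [X in 0 <= X](_ : _ =
     (Num.sqrt s)^-1 / 2 * (Num.sqrt s * u - 1) ^+ 2); last first.
    by field; rewrite lt0r_neq0.
  by rewrite mulr_ge0 ?sqr_ge0 // divr_ge0 // invr_ge0 ltW.
rewrite big_split /= -!mulr_sumr.
have h1 := tilt_second_moment K; have h2 := tilt_sum_le K.
apply: (@le_trans _ _ (Num.sqrt s / 2 * (c / s * A) + (Num.sqrt s)^-1 / 2 * A)).
  by rewrite lerD // ler_wpM2l // divr_ge0 // ?invr_ge0 ltW.
rewrite le_eqVlt; apply/orP; left; apply/eqP; rewrite -{2}rr.
by field; rewrite lt0r_neq0.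
Qed.

Let C1 := (c + 1) / 2 / (x * (1 - x ^- 2)).
Let mu := C1 * (A / Num.sqrt s).

Let x2_lt1 : x ^- 2 < 1. Proof. by rewrite invf_lt1 ?exprn_gt0 // exprn_egt1. Qed.

(* Stein's identity also reads x D(k) + D(k+1) / x = ((k+1) / s - v) W(k+1), which
   turns the first moment bound into a bound of the total variation. *)
Lemma tilt_variation K : \sum_(0 <= k < K) `|D k| <= mu.
Proof.
have xn0 : x != 0 by exact: lt0r_neq0.
have d0 : 0 < 1 - x ^- 2 by rewrite subr_gt0.
apply: (@le_of_vanishing _ (fun K => \sum_(0 <= k < K) `|D k|)
  (fun n => x ^- 2 / (1 - x ^- 2) * `|D n|)).
- exact: sum_homo.
- rewrite -[X in _ --> X](mulr0 (x ^- 2 / (1 - x ^- 2))); apply: cvgM; first exact: cvg_cst.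
  rewrite -(normr0 R); apply: cvg_norm; rewrite -(subrr (0 : R)); apply: cvgB.
    exact: tilt_vanish.
  by rewrite (cvg_shiftS W); exact: tilt_vanish.
- move=> n.
  have step k : `|D k| <= x ^- 2 * `|D k.+1| + x^-1 * (`|k.+1%:R / s - v| * W k.+1).
    have -> : D k = - (x ^- 2) * D k.+1 + x^-1 * ((k.+1%:R / s - v) * W k.+1).
      rewrite mulrBl -tilt_stein /D /v; field; exact: xn0.
    apply: le_trans (ler_normD _ _) _; apply: lerD.
      by rewrite normrM normrN [`|x ^- 2|]ger0_norm // invr_ge0 exprn_ge0 // ltW.
    rewrite normrM [`|x^-1|]ger0_norm ?invr_ge0 ?(ltW x_gt0) //.
    by rewrite [`|_ * W _|]normrM [`|W _|]ger0_norm ?tilt_ge0.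
  have h1 : \sum_(0 <= k < n) `|D k| <= x ^- 2 * \sum_(0 <= k < n) `|D k.+1| +
       x^-1 * \sum_(0 <= k < n) (`|k.+1%:R / s - v| * W k.+1).
    by rewrite !mulr_sumr -big_split; apply: ler_sum => k _; exact: step.
  have h2 : \sum_(0 <= k < n) `|D k.+1| <= \sum_(0 <= k < n) `|D k| + `|D n|.
    by rewrite -big_nat_recr //= [leRHS]big_nat_recl //= lerDr.
  have h3 : \sum_(0 <= k < n) (`|k.+1%:R / s - v| * W k.+1) <= (c + 1) / 2 * (A / Num.sqrt s).
    apply: le_trans (tilt_first_moment n.+1); rewrite [leRHS]big_nat_recl //= lerDr.
    by rewrite mulr_ge0 ?tilt_ge0.
  rewrite -(ler_pM2l d0).
  have -> : (1 - x ^- 2) * (mu + x ^- 2 / (1 - x ^- 2) * `|D n|) =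
     x ^- 2 * `|D n| + x^-1 * ((c + 1) / 2 * (A / Num.sqrt s)).
    have xs : x ^+ 2 - 1 != 0 by rewrite gt_eqF // subr_gt0 exprn_egt1.
    by rewrite /mu /C1; field; rewrite xn0 xs lt0r_neq0 ?sqrtr_gt0.
  rewrite -(ler_pM2l (_ : 0 < x ^- 2)) ?invr_gt0 ?exprn_gt0 // in h2.
  rewrite -(ler_pM2l (_ : 0 < x^-1)) ?invr_gt0 // in h3.
  move: h1 h2 h3; move: ((c + 1) / 2 * _) (x ^- 2) (x^-1) => a1 a2 a3.
  set S1 := \sum_(0 <= k < n) `|D k|; set S2 := \sum_(0 <= k < n) _; set S3 := \sum_(0 <= k < n) _.
  move: S1 S2 S3 (`|D n|) => S1 S2 S3 S4; lra.
Qed.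

(** A sequence that vanishes at infinity is bounded by its total variation. *)
Lemma tilt_sup k : W k <= mu.
Proof.
apply: (@le_of_vanishing _ (fun=> W k) (fun n => W (n + k)%N)) => [m n _ //||n|//].
  rewrite (cvg_shiftn k W).
  exact: tilt_vanish.
rewrite addnC -lerBlDr.
have -> : W k - W (k + n)%N = \sum_(k <= i < k + n) D i.
  elim: n => [|n IH]; first by rewrite addn0 big_geq // subrr.
  by rewrite addnS big_nat_recr ?leq_addr //= -IH /D; ring.
apply: le_trans (tilt_variation (k + n)); rewrite [leRHS](big_cat_nat _ (n := k)) ?leq_addr //=.
rewrite -[leLHS]add0r lerD ?sumr_ge0 //; apply: ler_sum => i _; exact: ler_norm.
Qed.

Lemma tilt_mass_gt0 : 0 < A.
Proof. exact: lt_le_trans tilt_mass_ge1. Qed.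

(** Chebyshev's inequality: beyond twice the mean, k / s deviates from v by at least v. *)
Lemma tilt_tail K0 : 2 * v * s <= K0%:R ->
  A - \sum_(0 <= k < K0) W k <= c / v ^+ 2 * (A / s).
Proof.
move=> vK; rewrite lerBlDr; apply: limr_le; first exact: tilt_summable.
exists K0 => // K /= K0K; rewrite /series /= (big_cat_nat _ (n := K0)) //= addrC lerD2r.
rewrite -(ler_pM2l (_ : 0 < v ^+ 2)) ?exprn_gt0 //.
have -> : v ^+ 2 * (c / v ^+ 2 * (A / s)) = c / s * A.
  by field; rewrite !lt0r_neq0.
apply: le_trans (tilt_second_moment K); rewrite [leRHS](big_cat_nat _ (n := K0)) //=.
rewrite -[leLHS]add0r lerD ?mulr_sumr //.
  by apply: sumr_ge0 => k _; rewrite mulr_ge0 ?sqr_ge0 ?tilt_ge0.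
rewrite [leLHS]big_nat_cond [leRHS]big_nat_cond; apply: ler_sum => k /andP[/andP[kK _] _].
have vk : v <= k%:R / s - v.
  have kR : K0%:R <= k%:R :> R by rewrite ler_nat.
  by rewrite lerBrDr ler_pdivlMr //; move: vK kR; lra.
rewrite ler_wpM2r ?tilt_ge0 //; apply: lerXn2r => //; rewrite nnegrE; first exact: ltW.
by apply: le_trans vk; exact: ltW.
Qed.

Variable q : nat.
Hypothesis q_gt1 : (1 < q)%N.
Local Notation J := (tree_bessel q s).

Let J_ge0 k : 0 <= J k. Proof. exact: tree_bessel_ge0. Qed.
Let J_le k : J k <= B k. Proof. exact: tree_bessel_le. Qed.
Let J_rec k := tree_bessel_rec q_gt1 s k.

Let g n := x ^+ n * J n.
Let b := x ^- 2.

Let b_gt0 : 0 < b. Proof. by rewrite invr_gt0 exprn_gt0. Qed.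
Let th_ge0 : 0 <= b / q%:R. Proof. by rewrite divr_ge0 // ltW. Qed.
Let th_le : b / q%:R <= b.
Proof. by rewrite ler_pdivrMr ?ltr0n ?(ltnW q_gt1) // ler_peMr ?(ltW b_gt0) // ler1n ltnW. Qed.
Let th_lt1 : b / q%:R < 1. Proof. exact: le_lt_trans x2_lt1. Qed.

Lemma tilted_ge0 n : 0 <= g n.
Proof. by rewrite mulr_ge0 // exprn_ge0 // ltW. Qed.

Lemma tilted_le n : g n <= W n.
Proof. by rewrite ler_wpM2l // exprn_ge0 // ltW. Qed.

Lemma tilted_rec n : g n = W n - b * W n.+2 + b / q%:R * g n.+2.
Proof.
rewrite /g J_rec /W /b !exprS; field; rewrite pnatr_eq0 (lt0r_neq0 x_gt0) andbT.
by rewrite -lt0n ltnW.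
Qed.

Lemma tilted_ge n : W n - b * W n.+2 <= g n.
Proof. by rewrite [leRHS]tilted_rec lerDl mulr_ge0 // tilted_ge0. Qed.

(** By [tilted_rec] an increment of g is made of two increments of W and b/q < 1 times the increment
    of g two steps ahead; the latter is absorbed in the left-hand side. *)
Lemma tilted_variation K :
  \sum_(0 <= n < K) `|g n - g n.+1| <= (1 + b) / (1 - b / q%:R) * mu.
Proof.
have d0 : 0 < 1 - b / q%:R by rewrite subr_gt0.
pose G n := g n - g n.+1; rewrite -/(G _).
have cG : `|G n| @[n --> \oo] --> (0 : R).
  apply: (squeeze_cvgr _ (cvg_cst 0) (_ : (fun n => W n + W n.+1) @ \oo --> 0)).
    apply: nearW => n; rewrite normr_ge0 /= /G.
    have := tilted_ge0 n; have := tilted_ge0 n.+1; have := tilted_le n; have := tilted_le n.+1.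
    by rewrite ler_norml; lra.
  rewrite -[X in _ --> X](addr0 (0 : R)); apply: cvgD; first exact: tilt_vanish.
  by rewrite (cvg_shiftS W); exact: tilt_vanish.
apply: (@le_of_vanishing _ (fun K => \sum_(0 <= k < K) `|G k|)
  (fun n => b / q%:R / (1 - b / q%:R) * (`|G n| + `|G n.+1|))).
- exact: sum_homo.
- rewrite -[X in _ --> X](mulr0 (b / q%:R / (1 - b / q%:R))); apply: cvgM; first exact: cvg_cst.
  rewrite -[X in _ --> X](addr0 (0 : R)); apply: cvgD; first exact: cG.
  by rewrite (cvg_shiftS (fun n => `|G n|)); exact: cG.
- move=> n.
  have step k : `|G k| <= `|D k| + b * `|D k.+2| + b / q%:R * `|G k.+2|.
    have -> : G k = D k + - b * D k.+2 + b / q%:R * G k.+2.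
      by rewrite /G (tilted_rec k) (tilted_rec k.+1) /D; ring.
    apply: le_trans (ler_normD _ _) _; apply: lerD.
      apply: le_trans (ler_normD _ _) _; rewrite lerD // normrM normrN.
      by rewrite (ger0_norm (ltW b_gt0)).
    by rewrite normrM [`|b / _|]ger0_norm.
  have h1 : \sum_(0 <= k < n) `|G k| <= \sum_(0 <= k < n) `|D k| +
       b * \sum_(0 <= k < n) `|D k.+2| + b / q%:R * \sum_(0 <= k < n) `|G k.+2|.
    by rewrite !mulr_sumr -!big_split; apply: ler_sum => k _; exact: step.
  have h2 : \sum_(0 <= k < n) `|D k| <= mu by exact: tilt_variation.
  have h3 : b * \sum_(0 <= k < n) `|D k.+2| <= b * mu.
    rewrite ler_wpM2l ?(ltW b_gt0) //; apply: le_trans (tilt_variation n.+2).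
    by rewrite [leRHS]big_nat_recl //= big_nat_recl //= addrA lerDr addr_ge0.
  have h4 : b / q%:R * \sum_(0 <= k < n) `|G k.+2| <=
            b / q%:R * (\sum_(0 <= k < n) `|G k| + (`|G n| + `|G n.+1|)).
    rewrite ler_wpM2l // addrA -big_nat_recr //= -big_nat_recr //=.
    by rewrite [leRHS]big_nat_recl //= big_nat_recl //= addrA lerDr addr_ge0.
  rewrite -(ler_pM2l d0).
  have -> : (1 - b / q%:R) * ((1 + b) / (1 - b / q%:R) * mu + b / q%:R / (1 - b / q%:R) * (`|G n| + `|G n.+1|)) =
    (1 + b) * mu + b / q%:R * (`|G n| + `|G n.+1|).
    have := lt0r_neq0 d0; move: (b / q%:R) (1 + b) mu (`|G n| + _) => u1 u2 u3 u4 n0.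
    by field.
  move: h1 h2 h3 h4; set S1 := \sum_(0 <= k < n) `|G k|; set S2 := \sum_(0 <= k < n) _.
  set S3 := \sum_(0 <= k < n) _; set S4 := \sum_(0 <= k < n) _.
  move: (b / q%:R) b mu (`|G n| + _) S1 S2 S3 S4 => u1 u2 u3 u4 S1 S2 S3 S4; lra.
Qed.

Lemma tilted_step n : `|g n - g n.+1| <= mu.
Proof.
have := tilted_ge0 n; have := tilted_ge0 n.+1; have := tilted_le n; have := tilted_le n.+1.
have := tilt_sup n; have := tilt_sup n.+1; rewrite ler_norml; lra.
Qed.

Lemma tilted_powR_variation p K : 1 <= p ->
  \sum_(0 <= n < K) `|g n - g n.+1| `^ p <= (1 + b) / (1 - b / q%:R) * mu `^ p.
Proof.
move=> p1; have mu0 : 0 < mu.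
  apply: lt_le_trans (tilt_sup 0); rewrite /W expr0 mul1r.
  exact: lt_le_trans B0_ge1.
rewrite [_ `^ p]powR_succr // [leRHS]mulrCA.
apply: le_trans (_ : mu `^ (p - 1) * \sum_(0 <= n < K) `|g n - g n.+1| <= _); last first.
  by rewrite ler_wpM2l ?powR_ge0 // tilted_variation.
by rewrite mulr_sumr; apply: ler_sum => n _; rewrite powR_le_mul // tilted_step.
Qed.

(** The subtracted terms b W(n+2) cost at most the fraction b of A, and the tail beyond K0 at most
    (1 - b) / 2 of A, by [tilt_tail] and the assumption on s. *)
Lemma tilted_mass K0 : 2 * v * s <= K0%:R -> c / v ^+ 2 / s <= (1 - b) / 2 ->
  (1 - b) / 2 * A <= \sum_(0 <= n < K0) g n.
Proof.
move=> vK sb; have A0 := tilt_mass_gt0.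
have h1 : A - \sum_(0 <= k < K0) W k <= (1 - b) / 2 * A.
  apply: le_trans (tilt_tail vK) _; rewrite mulrA mulrAC.
  by rewrite ler_wpM2r // ltW.
have h2 : \sum_(0 <= k < K0) W k.+2 <= A.
  apply: le_trans (tilt_sum_le K0.+2).
  by rewrite [leRHS]big_nat_recl //= big_nat_recl //= addrA lerDr addr_ge0 ?tilt_ge0.
have h3 : \sum_(0 <= k < K0) W k - b * \sum_(0 <= k < K0) W k.+2 <= \sum_(0 <= n < K0) g n.
  by rewrite mulr_sumr -sumrB; apply: ler_sum => n _; exact: tilted_ge.
have h4 : b * \sum_(0 <= k < K0) W k.+2 <= b * A by rewrite ler_wpM2l // ltW.
lra.
Qed.

Lemma tilted_powR_mass p K0 : 1 <= p -> (0 < K0)%N -> 2 * v * s <= K0%:R ->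
  c / v ^+ 2 / s <= (1 - b) / 2 ->
  ((1 - b) / 4 * (A / K0%:R)) `^ (p - 1) * ((1 - b) / 4 * A) <=
  \sum_(0 <= n < K0) g n `^ p.
Proof.
move=> p1 K00 vK sb; have h := tilted_mass vK sb; have A0 := tilt_mass_gt0.
(* K0 lam is half of the lower bound in [tilted_mass], so subtracting lam at K0 points leaves the
   other half. *)
set lam := (1 - b) / 4 * (A / K0%:R).
have l0 : 0 <= lam.
  by rewrite mulr_ge0 // divr_ge0 // ?subr_ge0 ?(ltW x2_lt1) // ltW.
apply: (@le_trans _ _ (\sum_(0 <= n < K0) lam `^ (p - 1) * (g n - lam))); last first.
  by apply: ler_sum => n _; rewrite powR_ge_affine // tilted_ge0.
rewrite -mulr_sumr ler_wpM2l ?powR_ge0 // sumrB sumr_const_nat subn0.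
have -> : lam *+ K0 = (1 - b) / 4 * A.
  by rewrite -mulr_natr /lam; field; rewrite pnatr_eq0 -lt0n.
lra.
Qed.

Lemma tilted_head n : g n <= x ^+ n * (c / (v ^+ 2) * (A / s)).
Proof.
rewrite ler_wpM2l ?exprn_ge0 ?(ltW x_gt0) //.
apply: le_trans (J_le n) (le_trans (le_bessel0 n s_ge0) _).
by have := tilt_head; rewrite /W expr0 mul1r.
Qed.

End Drift.

(** * The critical profile *)

(** A maximum principle: iterating towards infinity halves the bound M again and again. *)
Lemma halving_le0 (R : realType) (D : nat -> R) M :
  (forall n, D n <= D n.+2 / 2) -> (forall n, D n <= M) -> forall n, D n <= 0.
Proof.
move=> Dh DM n.
have h k : D n <= M / 2 ^+ k.
  elim: k n => [|k IH] n; first by rewrite expr0 divr1.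
  apply: le_trans (Dh n) _; rewrite exprSr invfM mulrA ler_wpM2r ?invr_ge0 //.
have c0 : M / 2 ^+ k @[k --> \oo] --> (0 : R).
  rewrite (_ : (fun k => _) = geometric M 2^-1).
    by apply: cvg_geometric; rewrite ger0_norm ?invr_ge0 //; lra.
  by apply/funext => k; rewrite /= exprVn.
rewrite -(cvg_lim _ c0) //; apply: limr_ge; first by apply/cvg_ex; exists 0.
exact: nearW.
Qed.

Section Critical.
Variables (R : realType) (s : R) (q : nat).
Hypotheses (s_ge1 : 1 <= s) (q_gt1 : (1 < q)%N).
Local Notation B := (bessel s).
Local Notation J := (tree_bessel q s).

Variables c kap : R.
Hypotheses (cE : c = (q%:R + 1) / (q%:R - 1)) (kapE : kap = q%:R / (q%:R - 1)).

(** Freezing B in [tree_bessel_stein] and solving for an affine function of n gives kap (n + c) with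
    exactly these constants, so kap (n + c) B(n) is the leading term of s J(n). Up to a factor that
    depends only on t, [rho] is h_t / phi_0. *)
Let rho n := J n / (n%:R + c).
Let err n := s * J n - kap * (n%:R + c) * B n.

Let s_gt0 : 0 < s. Proof. exact: lt_le_trans s_ge1. Qed.
Let B_ge0 k : 0 <= B k. Proof. exact: bessel_ge0 (ltW s_gt0). Qed.
Let B_le0 k : B k <= B 0%N. Proof. exact: le_bessel0 (ltW s_gt0). Qed.
Let B_decr k : B k.+1 <= B k. Proof. exact: bessel_decr (ltW s_gt0). Qed.
Let B_stein k := bessel_stein k s_gt0.
Let J_ge0 k : 0 <= J k. Proof. exact: tree_bessel_ge0 (ltW s_gt0). Qed.
Let J_le k : J k <= B k. Proof. exact: tree_bessel_le (ltW s_gt0). Qed.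
Let J_rec k := tree_bessel_rec q_gt1 s k.
Let q_ge2 : 2 <= q%:R :> R. Proof. by rewrite (ler_nat _ 2). Qed.
Let q1_gt0 : 0 < q%:R - 1 :> R. Proof. by have := q_ge2; lra. Qed.

Lemma critical_shift_ge1 : 1 <= c.
Proof. by rewrite cE ler_pdivlMr //; lra. Qed.
Let c_ge1 := critical_shift_ge1.
Let c_le3 : c <= 3. Proof. by rewrite cE ler_pdivrMr //; have := q_ge2; lra. Qed.
Let kap_le2 : kap <= 2. Proof. by rewrite kapE ler_pdivrMr //; have := q_ge2; lra. Qed.
Let kap_ge0 : 0 <= kap. Proof. by rewrite kapE divr_ge0 // ltW. Qed.

Let nc_gt0 n : 0 < n%:R + c. Proof. by rewrite ltr_wpDl // (lt_le_trans _ c_ge1). Qed.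

Lemma bessel_step_le n : B n - B n.+1 <= n.+1%:R / s * B n.
Proof.
have h := B_stein n; have hd := B_decr n.+1.
have : n.+1%:R / s * B n.+1 <= n.+1%:R / s * B n.
  by rewrite ler_wpM2l // divr_ge0 // ltW.
lra.
Qed.

Lemma bessel_step2_le n : B n - B n.+2 <= n.+1%:R / s * B n.
Proof. by rewrite B_stein ler_wpM2l // divr_ge0 // ltW. Qed.

Lemma bessel_linear n : n%:R * B n <= s * B 0%N.
Proof.
case: n => [|n]; first by rewrite mul0r mulr_ge0 // ltW.
have h := B_stein n; have h0 := B_le0 n; have h2 := B_ge0 n.+2.
have -> : n.+1%:R * B n.+1 = s * (B n - B n.+2) by rewrite h; field; exact: lt0r_neq0.
by rewrite ler_wpM2l ?(ltW s_gt0) //; lra.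
Qed.

Lemma tree_bessel_stein n : s * J n = n.+1%:R * B n.+1 + s * J n.+2 / q%:R.
Proof.
by rewrite J_rec B_stein; field; rewrite (lt0r_neq0 s_gt0) pnatr_eq0 -lt0n ltnW.
Qed.

(** The choice of c and kap cancels every term free of differences of B. The remaining differences
    gain a factor n / s each, and 1/q <= 1/2 makes the recursion contract. *)
Lemma critical_err_rec n :
  `|err n| <= `|err n.+2| / 2 + 6 * n.+1%:R ^+ 2 * B n / s.
Proof.
have qn0 : q%:R != 0 :> R by rewrite pnatr_eq0 -lt0n ltnW.
have q1n0 := lt0r_neq0 q1_gt0.
have E : err n = - (n.+1%:R * (B n - B n.+1)) + q%:R^-1 * err n.+2 -
   (q%:R - 1)^-1 * (n%:R + 2 + c) * (B n - B n.+2).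
  by rewrite /err tree_bessel_stein kapE cE -!natr1; field; rewrite qn0 q1n0.
have u1 : 0 <= n.+1%:R * (B n - B n.+1) <= n.+1%:R * (n.+1%:R / s * B n).
  apply/andP; split; first by rewrite mulr_ge0 // subr_ge0.
  by rewrite ler_wpM2l // bessel_step_le.
have u2 : `|q%:R^-1 * err n.+2| <= `|err n.+2| / 2.
  rewrite normrM mulrC ler_wpM2l // ger0_norm ?invr_ge0 // lef_pV2 ?posrE //.
  by rewrite (lt_le_trans _ q_ge2).
have u3 : 0 <= (q%:R - 1)^-1 * (n%:R + 2 + c) * (B n - B n.+2) <=
    (5 * n.+1%:R) * (n.+1%:R / s * B n).
  have n0 : 0 <= n%:R :> R by [].
  have k0 : 0 <= (q%:R - 1)^-1 * (n%:R + 2 + c).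
    by rewrite mulr_ge0 ?invr_ge0 ?(ltW q1_gt0) //; have := c_ge1; lra.
  have d0 : 0 <= B n - B n.+2 by rewrite subr_ge0; apply: le_trans (B_decr _).
  rewrite mulr_ge0 //=; apply: ler_pM => //; last exact: bessel_step2_le.
  rewrite mulrC ler_pdivrMr //.
  apply: (@le_trans _ _ (5 * (n%:R + 1) * 1)); first by have := c_le3; lra.
  by rewrite natr1 ler_wpM2l //; have := q_ge2; lra.
have -> : 6 * n.+1%:R ^+ 2 * B n / s =
  n.+1%:R * (n.+1%:R / s * B n) + (5 * n.+1%:R) * (n.+1%:R / s * B n) by ring.
move: u1 u2 u3; rewrite E.
set a1 := _ * (B n - B n.+1); set a2 := q%:R^-1 * _; set a3 := _ * (B n - B n.+2).
set b1 := n.+1%:R * _; set b2 := 5 * _ * _; move: (`|err n.+2| / 2) => b3.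
move=> /andP[u1 u1'] u2 /andP[u3 u3'].
have : `|- a1 + a2 - a3| <= a1 + `|a2| + a3.
  apply: le_trans (ler_normB _ _) _; rewrite (ger0_norm u3) lerD2r.
  by apply: le_trans (ler_normD _ _) _; rewrite normrN (ger0_norm u1).
lra.
Qed.

(* U n = 12 (n + 10)^2 B(n) / s is a supersolution of the recursion of
   critical_err_rec. *)
Lemma critical_err_le n : `|err n| <= (12 * 10 ^+ 2) * n.+1%:R ^+ 2 * B n / s.
Proof.
have sV0 : 0 < s^-1 by rewrite invr_gt0.
pose U (n : nat) : R := 12 * (n%:R + 10) ^+ 2 * (B n / s).
have h : `|err n| - U n <= 0.
  apply: (@halving_le0 _ (fun n => `|err n| - U n) (s * B 0%N + 2 * (s + 3) * B 0%N)) => {}n.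
    have h1 := critical_err_rec n.
    have h2 : U n.+2 <= 12 * (n%:R + 12) ^+ 2 * (B n / s).
      rewrite /U; have -> : n.+2%:R + 10 = n%:R + 12 :> R by rewrite -addn2 natrD; ring.
      rewrite ler_wpM2l ?mulr_ge0 ?sqr_ge0 // ler_wpM2r ?(ltW sV0) //.
      exact: le_trans (B_decr _).
    have h3 : 0 <= (84 * n%:R + 330) * (B n / s).
      apply: mulr_ge0; last by rewrite divr_ge0 // ltW.
      have : 0 <= n%:R :> R by []. lra.
    move: h1 h2 h3; rewrite -[n.+1%:R]natr1 -(mulrA _ (B n)); move: (U n.+2) => U2.
    rewrite /U; move: (B n / s) (n%:R : R) `|err n| `|err n.+2| => y z E1 E2; lra.
  apply: le_trans (_ : `|err n| <= _).
    by rewrite gerBl mulr_ge0 ?divr_ge0 ?(ltW s_gt0) // mulr_ge0 ?sqr_ge0.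
  apply: le_trans (ler_normB _ _) _; apply: lerD.
    rewrite ger0_norm ?mulr_ge0 ?(ltW s_gt0) // ler_wpM2l ?(ltW s_gt0) //.
    by apply: le_trans (J_le n) _; exact: B_le0.
  rewrite (ger0_norm (mulr_ge0 (mulr_ge0 kap_ge0 (ltW (nc_gt0 n))) (B_ge0 n))).
  rewrite -[kap * _ * _]mulrA -[2 * _ * _]mulrA; apply: ler_pM; [exact: kap_ge0| |exact: kap_le2|].
    by rewrite mulr_ge0 // (ltW (nc_gt0 n)).
  have := bessel_linear n; have := B_le0 n.
  have : c * B n <= 3 * B n by rewrite ler_wpM2r.
  lra.
rewrite subr_le0 in h; apply: le_trans h _; rewrite /U -[leRHS]mulrA ler_wpM2r ?divr_ge0 ?(ltW s_gt0) //.
have n0 : 0 <= n%:R :> R by [].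
rewrite -[n.+1%:R]natr1; move: (n%:R : R) n0 => z z0.
have := sqr_ge0 z; lra.
Qed.

Lemma critical_ratio_expansion n :
  `|s * rho n - kap * B n| <= (12 * 10 ^+ 2) * n.+1%:R * B n / s.
Proof.
have -> : s * rho n - kap * B n = err n / (n%:R + c).
  by rewrite /rho /err; field; exact: lt0r_neq0.
rewrite normrM normfV [`|_ + c|]ger0_norm ?(ltW (nc_gt0 n)) // ler_pdivrMr //.
apply: le_trans (critical_err_le n) _.
have -> : (12 * 10 ^+ 2) * n.+1%:R ^+ 2 * B n / s = (12 * 10 ^+ 2) * n.+1%:R * B n / s * n.+1%:R by ring.
rewrite ler_wpM2l ?divr_ge0 ?mulr_ge0 ?(ltW s_gt0) // -[n.+1%:R]natr1 lerD2l.
exact: c_ge1.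
Qed.

(** Two consecutive expansions of s rho have errors of order n B(n) / s, and the main term kap B
    varies by no more than that. *)
Lemma critical_ratio_step n :
  `|rho n.+1 - rho n| <= (40 * 10 ^+ 2) * n.+1%:R * B n / s ^+ 2.
Proof.
have h1 := critical_ratio_expansion n; have h2 := critical_ratio_expansion n.+1.
have h3 := bessel_step_le n; have h4 := B_decr n.
have h5 : kap * (B n - B n.+1) <= 2 * (n.+1%:R / s * B n).
  by rewrite ler_pM ?subr_ge0.
have h6 : (12 * 10 ^+ 2) * n.+2%:R * B n.+1 / s <= (24 * 10 ^+ 2) * n.+1%:R * B n / s.
  rewrite ler_wpM2r ?invr_ge0 ?(ltW s_gt0) // ler_pM //.
  rewrite -[n.+2%:R]natr1; have : 1 <= n.+1%:R :> R by rewrite ler1n.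
  lra.
have h7 : 0 <= kap * (B n - B n.+1) by rewrite mulr_ge0 ?subr_ge0.
have h8 : 0 <= n.+1%:R * B n / s by rewrite divr_ge0 ?mulr_ge0 // ltW.
have -> : (40 * 10 ^+ 2) * n.+1%:R * B n / s ^+ 2 = ((40 * 10 ^+ 2) * n.+1%:R * B n / s) / s.
  by field; exact: lt0r_neq0.
rewrite ler_pdivlMr // -[X in _ * X](ger0_norm (ltW s_gt0)) -normrM.
move: h1 h2 h5 h6 h7 h8; rewrite !ler_norml; lra.
Qed.

Lemma critical_ratio_ge n : B n.+1 / (3 * s) <= rho n.
Proof.
rewrite /rho ler_pdivlMr // -(ler_pM2l s_gt0) tree_bessel_stein.
apply: le_trans (_ : n.+1%:R * B n.+1 <= _); last first.
  by rewrite lerDl divr_ge0 // mulr_ge0 // ltW.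
have -> : s * (B n.+1 / (3 * s) * (n%:R + c)) = (n%:R + c) / 3 * B n.+1.
  by field; exact: lt0r_neq0.
rewrite ler_wpM2r // -[n.+1%:R]natr1; have := c_le3; have : 0 <= n%:R :> R by [].
by lra.
Qed.

Lemma bessel0_le_2bessel1 : B 0%N <= 2 * B 1%N.
Proof.
have := B_stein 0; have := B_decr 1.
have : 1 / s * B 1%N <= B 1%N by rewrite ler_piMl // div1r invf_le1.
lra.
Qed.

Lemma critical_ratio0_ge : B 0%N / (6 * s) <= rho 0%N.
Proof.
apply: le_trans (critical_ratio_ge 0); rewrite !ler_pdivrMr ?mulr_gt0 //.
have -> : B 1%N / (3 * s) * (6 * s) = 2 * B 1%N by field; exact: lt0r_neq0.
exact: bessel0_le_2bessel1.
Qed.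

(** Here rho(n) is at most, and rho(0) at least, a multiple of B(0) / s. In terms of the heat kernel
    this becomes [supercritical_pointwise]. *)
Lemma critical_ratio_le n : rho n <= (150 * 10 ^+ 2) * rho 0%N.
Proof.
have h1 : s * rho n <= (25 * 10 ^+ 2) * B 0%N.
  have h := critical_ratio_expansion n.
  have h2 : kap * B n <= 2 * B 0%N by rewrite ler_pM // B_le0.
  have h3 : (12 * 10 ^+ 2) * n.+1%:R * B n / s <= (24 * 10 ^+ 2) * B 0%N.
    rewrite ler_pdivrMr // -[n.+1%:R]natr1; have := bessel_linear n; have := B_le0 n.
    have : B 0%N <= s * B 0%N by rewrite ler_peMl.
    lra.
  move: h; rewrite ler_norml; lra.
rewrite -(ler_pM2l s_gt0); apply: le_trans h1 _.
have := critical_ratio0_ge; rewrite ler_pdivrMr ?mulr_gt0 //.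
have := B_ge0 0; lra.
Qed.

(* One factor n / s is traded for a difference of B by Stein's identity, and
   the sum is then telescoped. *)
Lemma bessel_fourth_moment K :
  \sum_(0 <= n < K.+2) n.+1%:R ^+ 4 * B n ^+ 2 / s ^+ 2 <=
  148 / s * \sum_(0 <= n < K.+2) (n%:R * B n) ^+ 2.
Proof.
have E : \sum_(1 <= n < K.+2) n%:R ^+ 4 * B n ^+ 2 / s ^+ 2 <=
    s^-1 * (B 0%N * B 1%N + 7 * \sum_(1 <= n < K.+2) (n%:R * B n) ^+ 2
            - K.+2%:R ^+ 3 * B K.+2 * B K.+1).
  elim: K => [|K IH].
    rewrite !big_nat1 /=; have h := B_stein 0.
    have -> : 1 ^+ 4 * B 1%N ^+ 2 / s ^+ 2 = s^-1 * B 1%N * (1 / s * B 1%N).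
      by field; exact: lt0r_neq0.
    rewrite -h -mulrA ler_wpM2l ?invr_ge0 ?(ltW s_gt0) //.
    have : B 1%N * B 2%N <= B 1%N * B 1%N by rewrite ler_wpM2l.
    have := B_ge0 2; have := B_ge0 1; lra.
  rewrite big_nat_recr //= [in leRHS]big_nat_recr //=.
  apply: le_trans (lerD IH (lexx _)) _.
  have -> : K.+2%:R ^+ 4 * B K.+2 ^+ 2 / s ^+ 2 =
     s^-1 * (K.+2%:R ^+ 3 * B K.+2 * (K.+2%:R / s * B K.+2)).
    by field; exact: lt0r_neq0.
  rewrite -(B_stein K.+1) -mulrDr ler_wpM2l ?invr_ge0 ?(ltW s_gt0) //.
  have h1 : B K.+2 * B K.+3 <= B K.+2 * B K.+2 by rewrite ler_wpM2l.
  have h2 : (K.+3%:R ^+ 3 - K.+2%:R ^+ 3) * (B K.+2 * B K.+3) <=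
            7 * K.+2%:R ^+ 2 * (B K.+2 * B K.+2) :> R.
    rewrite ler_pM ?mulr_ge0 //; rewrite -[K.+3%:R]natr1.
      have -> : (K.+2%:R + 1) ^+ 3 - K.+2%:R ^+ 3 = 3 * K.+2%:R ^+ 2 + 3 * K.+2%:R + 1 :> R by ring.
      by rewrite !addr_ge0 ?mulr_ge0 ?sqr_ge0.
    have : 1 <= K.+2%:R :> R by rewrite ler1n.
    by move: (K.+2%:R) => z z1; nra.
  lra.
have h1 : B 0%N * B 1%N <= 2 * \sum_(1 <= n < K.+2) (n%:R * B n) ^+ 2.
  rewrite big_nat_recl //= mul1r; have := bessel0_le_2bessel1; have := B_ge0 1; move=> b1 b0.
  have : 0 <= \sum_(1 <= i < K.+1) (i.+1%:R * B i.+1) ^+ 2.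
    by apply: sumr_ge0 => i _; exact: sqr_ge0.
  nra.
have h2 : B 0%N ^+ 2 <= 4 * \sum_(1 <= n < K.+2) (n%:R * B n) ^+ 2.
  rewrite big_nat_recl //= mul1r; have := bessel0_le_2bessel1; have := B_ge0 0; move=> b1 b0.
  have : 0 <= \sum_(1 <= i < K.+1) (i.+1%:R * B i.+1) ^+ 2.
    by apply: sumr_ge0 => i _; exact: sqr_ge0.
  nra.
rewrite big_ltn // [in leRHS]big_ltn // mul0r expr0n add0r.
set Q := \sum_(1 <= n < K.+2) (n%:R * B n) ^+ 2 in E h1 h2 *.
have Q0 : 0 <= Q by apply: sumr_ge0 => i _; exact: sqr_ge0.
have h3 : \sum_(1 <= n < K.+2) n.+1%:R ^+ 4 * B n ^+ 2 / s ^+ 2 <=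
   16 * \sum_(1 <= n < K.+2) n%:R ^+ 4 * B n ^+ 2 / s ^+ 2.
  rewrite mulr_sumr big_nat_cond [leRHS]big_nat_cond; apply: ler_sum => n /andP[/andP[n1 _] _].
  have -> : 16 * (n%:R ^+ 4 * B n ^+ 2 / s ^+ 2) = (2 * n%:R) ^+ 4 * (B n ^+ 2 / s ^+ 2) by ring.
  rewrite -mulrA ler_wpM2r ?divr_ge0 ?sqr_ge0 //.
  have n1R : 1 <= n%:R :> R by rewrite ler1n.
  have nE : n.+1%:R = n%:R + 1 :> R by rewrite natr1.
  by apply: lerXn2r; rewrite ?nnegrE ?nE; lra.
have h4 : 1 ^+ 4 * B 0%N ^+ 2 / s ^+ 2 <= s^-1 * (4 * Q).
  have -> : 1 ^+ 4 * B 0%N ^+ 2 / s ^+ 2 = s^-1 * (s^-1 * B 0%N ^+ 2).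
    by field; exact: lt0r_neq0.
  rewrite ler_wpM2l ?invr_ge0 ?(ltW s_gt0) //.
  by apply: le_trans h2; rewrite ler_piMl ?sqr_ge0 // invf_le1.
have h5 : s^-1 * (B 0%N * B 1%N + 7 * Q - K.+2%:R ^+ 3 * B K.+2 * B K.+1) <= s^-1 * (9 * Q).
  rewrite ler_wpM2l ?invr_ge0 ?(ltW s_gt0) //.
  have : 0 <= K.+2%:R ^+ 3 * B K.+2 * B K.+1 by rewrite !mulr_ge0 ?exprn_ge0.
  lra.
have h6 := le_trans E h5; move: h3 h4 h6; rewrite [148 / s]mulrC.
move: (\sum_(1 <= n < K.+2) n.+1%:R ^+ 4 * B n ^+ 2 / s ^+ 2) => S1.
move: (\sum_(1 <= n < K.+2) n%:R ^+ 4 * B n ^+ 2 / s ^+ 2) => S2.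
move: (1 ^+ 4 * _ / _) (s^-1) => S3 S4; lra.
Qed.

(** The weight (n+1)^2 dominates q^n phi_0(n)^2. The squared step is of order n^2 B^2 / s^4;
    [bessel_fourth_moment] trades two powers of n for one of s, as on the diffusive scale n ~ sqrt
    s, and (n+1) B(n+1) <= s J(n) returns to J. What is left is the gain 1/s. *)
Lemma critical_square_variation K :
  \sum_(0 <= n < K) n.+1%:R ^+ 2 * (rho n.+1 - rho n) ^+ 2 <=
  (40 * 10 ^+ 2) ^+ 2 * 148 / s * \sum_(0 <= n < K.+1) J n ^+ 2.
Proof.
apply: (@le_trans _ _ (\sum_(0 <= n < K.+2) (40 * 10 ^+ 2) ^+ 2 / s ^+ 2 *
     (n.+1%:R ^+ 4 * B n ^+ 2 / s ^+ 2))).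
  apply: le_trans (_ : \sum_(0 <= n < K.+2) n.+1%:R ^+ 2 * (rho n.+1 - rho n) ^+ 2 <= _).
    rewrite [leRHS](big_cat_nat _ (n := K)) ?leqW //= lerDl.
    by apply: sumr_ge0 => n _; rewrite mulr_ge0 ?sqr_ge0.
  apply: ler_sum => n _.
  have h := critical_ratio_step n.
  have -> : (40 * 10 ^+ 2) ^+ 2 / s ^+ 2 * (n.+1%:R ^+ 4 * B n ^+ 2 / s ^+ 2) =
     n.+1%:R ^+ 2 * ((40 * 10 ^+ 2) * n.+1%:R * B n / s ^+ 2) ^+ 2.
    by field; exact: lt0r_neq0.
  rewrite ler_wpM2l ?sqr_ge0 // -[_ ^+ 2]real_normK ?num_real // lerXn2r ?nnegrE //.
  by apply: le_trans h.
rewrite -mulr_sumr.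
apply: le_trans (_ : (40 * 10 ^+ 2) ^+ 2 / s ^+ 2 * (148 / s * \sum_(0 <= n < K.+2) (n%:R * B n) ^+ 2) <= _).
  by rewrite ler_wpM2l ?bessel_fourth_moment // divr_ge0 ?sqr_ge0.
have h : \sum_(0 <= n < K.+2) (n%:R * B n) ^+ 2 <= s ^+ 2 * \sum_(0 <= n < K.+1) J n ^+ 2.
  rewrite big_nat_recl //= mul0r expr0n add0r mulr_sumr; apply: ler_sum => n _.
  rewrite -exprMn lerXn2r ?nnegrE ?mulr_ge0 ?(ltW s_gt0) //.
  by rewrite tree_bessel_stein lerDl divr_ge0 // mulr_ge0 // ltW.
have -> : (40 * 10 ^+ 2) ^+ 2 * 148 / s * \sum_(0 <= n < K.+1) J n ^+ 2 =
   (40 * 10 ^+ 2) ^+ 2 / s ^+ 2 * (148 / s * (s ^+ 2 * \sum_(0 <= n < K.+1) J n ^+ 2)).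
  by field; exact: lt0r_neq0.
rewrite ler_wpM2l ?divr_ge0 ?sqr_ge0 // ler_wpM2l // divr_ge0 // ltW //.
Qed.

End Critical.

(** * The heat kernel *)

Section HeatKernel.
Variables (R : realType) (T : choiceType) (e : rel T) (q : nat).
Hypothesis hT : homogeneous_tree e q.
Local Notation d := (dist e).

Lemma laplacianE (K : fieldType) (g : T -> K) x :
  laplacian q e g x = g x - q.+1%:R^-1 * \sum_(v <- nb e x) g v.
Proof.
rewrite /laplacian; congr (_ - _ * _).
rewrite (_ : [set y | d x y = 1%N] = [set` nb e x]).
  by rewrite [in RHS]fsbig_seq ?nb_uniq.
apply/seteqP; split => y /=.
  by move=> dy; rewrite (mem_nb hT) -(dist1 hT) dy.
by rewrite (mem_nb hT) -(dist1 hT) => /eqP.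
Qed.

Lemma sum_nb_radial0 (V : nmodType) (G : nat -> V) y :
  \sum_(v <- nb e y) G (d v y) = G 1%N *+ q.+1.
Proof.
rewrite (eq_big_seq (fun=> G 1%N)).
  by rewrite big_const_seq count_predT iter_addr_0 (size_nb hT).
by move=> v; rewrite (mem_nb hT) -(dist1 hT) (dist_sym hT) => /eqP ->.
Qed.

Lemma sum_nb_radial (V : nmodType) (G : nat -> V) x y n : d x y = n.+1 ->
  \sum_(v <- nb e x) G (d v y) = G n + G n.+2 *+ q.
Proof.
move=> dx; rewrite (bigID (fun v => d v y == n)) /=; congr (_ + _).
  rewrite -big_filter (eq_big_seq (fun=> G n)).
    by rewrite big_const_seq count_predT iter_addr_0 (size_nb_parents hT).
  by move=> v; rewrite mem_filter => /andP[/eqP ->].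
rewrite -big_filter (eq_big_seq (fun=> G n.+2)).
  rewrite big_const_seq count_predT iter_addr_0 -(size_nb_children hT dx).
  congr (_ *+ _); rewrite !size_filter; apply: eq_in_count => v; rewrite (mem_nb hT) => exv.
  case: (dist_edgeP hT y exv); rewrite dx; [move=> ->|case=> <-].
    by rewrite eqxx; apply/eqP; lia.
  by rewrite eqxx; apply/esym/negbTE/eqP; lia.
move=> v; rewrite mem_filter (mem_nb hT) => /andP[dv exv].
case: (dist_edgeP hT y exv); rewrite dx; [by move=> ->|case=> dvn].
by rewrite dvn eqxx in dv.
Qed.

Lemma laplacian_sum (g : nat -> T -> R) (a : nat -> R) N x :
  laplacian q e (fun y => \sum_(0 <= j < N) a j * g j y) x =
  \sum_(0 <= j < N) a j * laplacian q e (g j) x.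
Proof.
rewrite laplacianE exchange_big /= mulr_sumr -sumrB; apply: eq_bigr => j _.
by rewrite laplacianE -mulr_sumr; ring.
Qed.

(** Along the family a the Laplacian acts as the scalar be minus the shift of j. These commute,
    which gives a binomial formula. *)
Lemma iter_laplacian (be : R) (a : nat -> T -> R) :
  (forall j x, laplacian q e (a j) x = be * a j x - a j.+1 x) ->
  forall n x, iter n (@laplacian q T e R) (a 0%N) x =
    \sum_(0 <= j < n.+1) 'C(n, j)%:R * be ^+ (n - j) * ((-1) ^+ j * a j x).
Proof.
move=> La; elim=> [|n IH] x; first by rewrite big_nat1 /= bin0 !expr0 !mul1r.
rewrite iterS (_ : iter n _ _ = fun y => \sum_(0 <= j < n.+1)
    ('C(n, j)%:R * be ^+ (n - j) * (-1) ^+ j) * a j y); last first.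
  by apply/funext => y; rewrite IH; apply: eq_bigr => j _; rewrite !mulrA.
rewrite laplacian_sum; under eq_bigr do rewrite La mulrBr.
rewrite sumrB [RHS]big_nat_recl // bin0 subn0 expr0 !mul1r.
have -> : \sum_(0 <= j < n.+1) 'C(n.+1, j.+1)%:R * be ^+ (n.+1 - j.+1) * ((-1) ^+ j.+1 * a j.+1 x) =
    \sum_(0 <= j < n) 'C(n, j.+1)%:R * be ^+ (n - j) * ((-1) ^+ j.+1 * a j.+1 x) -
    \sum_(0 <= j < n.+1) 'C(n, j)%:R * be ^+ (n - j) * (-1) ^+ j * a j.+1 x.
  under eq_bigr do rewrite binS natrD subSS !mulrDl.
  rewrite big_split /= big_nat_recr //= bin_small // !mul0r addr0; congr (_ + _).
  by rewrite -sumrN; apply: eq_bigr => j _; rewrite exprS; ring.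
rewrite addrA; congr (_ - _).
rewrite [LHS]big_nat_recl // bin0 subn0 expr0 !mul1r exprS mulr1; congr (_ + _); first ring.
apply: eq_big_nat => j /andP[_ jn].
have -> : (n - j = (n - j.+1).+1)%N by rewrite -subSn.
by rewrite [be ^+ _.+1]exprS; ring.
Qed.

(** Conjugation by r^d turns the Laplacian into 1 - c0 N, where N has weights 1, 0, 1 away from the
    root and 1 + 1/q at the root. Adding 2 to N makes it lazy; hence be = 1 + 2 c0. *)
Let r : R := Num.sqrt q%:R.
Let c0 : R := r / q.+1%:R.
Let be : R := 1 + 2 * c0.

Definition heat_profile (t : R) (n : nat) : R :=
  expR (- (be * t)) * (r ^- n * tree_bessel q (c0 * t) n).

Hypothesis q_gt1 : (1 < q)%N.

Let r_gt0 : 0 < r. Proof. by rewrite sqrtr_gt0 ltr0n ltnW. Qed.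
Let rr : r * r = q%:R. Proof. by rewrite -expr2 sqr_sqrtr. Qed.

Lemma laplacian_tree_walk y j x :
  laplacian q e (fun x => c0 ^+ j * (r ^- d x y * tree_walk R q j (d x y))) x =
  be * (c0 ^+ j * (r ^- d x y * tree_walk R q j (d x y))) -
  c0 ^+ j.+1 * (r ^- d x y * tree_walk R q j.+1 (d x y)).
Proof.
have rn0 : r != 0 by exact: lt0r_neq0.
have qn0 : q%:R + 1 != 0 :> R by rewrite natr1 pnatr_eq0.
pose G n := c0 ^+ j * (r ^- n * tree_walk R q j n).
have qE : q.+1%:R = r * r + 1 :> R by rewrite rr natr1.
have r2n0 : r * r + 1 != 0 by rewrite rr.
rewrite laplacianE; case E : (d x y) => [|n].
  have /eqP -> : x == y by rewrite -(dist_eq0 hT) E.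
  rewrite (sum_nb_radial0 G) /G /be [c0 ^+ j.+1]exprS /= -[(_ * _) *+ q.+1]mulr_natr.
  move: (c0 ^+ j) => P; rewrite /c0 qE -rr; field.
  by rewrite rn0 r2n0.
rewrite (sum_nb_radial G E) /G /be [c0 ^+ j.+1]exprS /= -[(_ * _) *+ q]mulr_natr.
move: (c0 ^+ j) => P; rewrite -rr /c0 qE !exprS; field.
by rewrite rn0 r2n0 expf_neq0.
Qed.

Lemma heat_kernelE t x y : heat_kernel q e t x y = heat_profile t (d x y).
Proof.
pose a j x := c0 ^+ j * (r ^- d x y * tree_walk R q j (d x y)).
have a0 : (fun z => (z == y)%:R) = a 0%N.
  apply/funext => z; rewrite /a expr0 mul1r /= (dist_eq0 hT).
  case: eqP => [->|]; last by rewrite mulr0.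
  by rewrite (dist_refl hT) expr0 invr1 mulr1.
have ga : geo_bounded (fun j => r ^- d x y * tree_walk R q j (d x y)).
  by apply: geo_boundedZ; exact: tree_walk_geo.
have gca : geo_bounded (fun j => a j x) by exact: geo_bounded_scale.
rewrite /heat_kernel /heat_semigroup a0.
rewrite (_ : (fun n => _) = fun n => exp_coeff (- t) n *
    \sum_(0 <= j < n.+1) 'C(n, j)%:R * be ^+ (n - j) * ((-1) ^+ j * a j x)); last first.
  apply/funext => n; congr (_ * _); apply: iter_laplacian => j z.
  exact: laplacian_tree_walk.
(* The powers of be give exp(- be t); the signs (-1)^j cancel the sign of - t, and c0^j rescales the
   time to c0 t. *)
rewrite -[LHS]/(egf _ _) egf_mul_expR; last exact: geo_bounded_scale.
rewrite egf_scale mulrNN mul1r egf_scale egfZ; last exact: tree_walk_geo.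
by rewrite /heat_profile mulrN mulrC.
Qed.

End HeatKernel.

(** * Jensen, finite sums and radial sums *)

Section Jensen.
Variable R : realType.

(** Young's inequality for u and v^(p-1), rearranged, is the tangent inequality of the p-th power at
    v. *)
Lemma powR_tangent (p u v : R) : 1 <= p -> 0 <= u -> 0 < v ->
  v `^ p + p * v `^ (p - 1) * (u - v) <= u `^ p.
Proof.
move=> p1 u0 v0; have p0 : 0 < p by lra.
move: p1; rewrite le_eqVlt => /predU1P[<-|p1].
  by rewrite subrr powRr0 !powRr1 ?(ltW v0) // !mul1r addrC subrK.
have q0 : 0 < p / (p - 1) by rewrite divr_gt0 // subr_gt0.
have pq : p^-1 + (p / (p - 1))^-1 = 1.
  by rewrite invf_div; field; exact: lt0r_neq0.
have := conjugate_powR u0 (powR_ge0 v (p - 1)) p0 q0 pq.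
rewrite -powRrM (_ : (p - 1) * (p / (p - 1)) = p); last first.
  by field; rewrite subr_eq0 gt_eqF.
rewrite -(ler_pM2l p0) mulrDr => h.
have e1 : p * (u `^ p / p) = u `^ p by field; rewrite gt_eqF.
have e2 : p * (v `^ p / (p / (p - 1))) = (p - 1) * v `^ p.
  by field; rewrite !gt_eqF // subr_gt0.
rewrite e1 e2 in h; rewrite mulrBr -[_ * _ * v]mulrA -powR_succr //; lra.
Qed.

(** The tangent at the weighted mean: the linear terms cancel in the sum. The weights may have any
    total, which produces the power p - 1 of it. *)
Lemma jensen_powR (I : eqType) (r : seq I) (w u : I -> R) (p : R) : 1 <= p ->
  (forall i, i \in r -> 0 <= w i) -> (forall i, i \in r -> 0 <= u i) ->
  (\sum_(i <- r) w i * u i) `^ p <=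
  (\sum_(i <- r) w i) `^ (p - 1) * \sum_(i <- r) w i * u i `^ p.
Proof.
move=> p1 w0 u0; have pn0 : p != 0 by rewrite gt_eqF //; lra.
have S0 : 0 <= \sum_(i <- r) w i * u i.
  by rewrite big_seq sumr_ge0 // => i ir; rewrite mulr_ge0 ?w0 ?u0.
have Sp0 : 0 <= \sum_(i <- r) w i * u i `^ p.
  by rewrite big_seq sumr_ge0 // => i ir; rewrite mulr_ge0 ?w0 ?powR_ge0.
move: S0; rewrite le_eqVlt => /predU1P[<-|S0].
  by rewrite powR0 // mulr_ge0 ?powR_ge0.
have W0 : 0 < \sum_(i <- r) w i.
  rewrite lt_def; apply/andP; split; last by rewrite big_seq sumr_ge0.
  apply/eqP => W0; move: S0; rewrite big_seq big1 ?ltxx // => i ir.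
  suff -> : w i = 0 by rewrite mul0r.
  by move/eqP: W0; rewrite big_seq psumr_eq0 // => /allP/(_ i ir); rewrite ir => /eqP.
set W := \sum_(i <- r) w i in W0 *; set S := \sum_(i <- r) w i * u i in S0 *.
have c0 : 0 < S / W by rewrite divr_gt0.
have : W * (S / W) `^ p <= \sum_(i <- r) w i * u i `^ p.
  apply: (@le_trans _ _ (\sum_(i <- r) w i * ((S / W) `^ p + p * (S / W) `^ (p - 1) * (u i - S / W)))).
    under eq_bigr do rewrite mulrDr [w _ * (_ * (_ - _))]mulrCA mulrBr.
    rewrite big_split /= -mulr_suml -mulr_sumr sumrB -mulr_suml -/W -/S.
    by rewrite [W * (S / W)]mulrC divfK ?gt_eqF // subrr mulr0 addr0.
  rewrite big_seq [leRHS]big_seq; apply: ler_sum => i ir.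
  by rewrite ler_wpM2l ?w0 // powR_tangent // u0.
rewrite -(ler_pM2l (_ : 0 < W `^ (p - 1))) ?powR_gt0 // mulrA -powR_succr //.
by rewrite -powRM ?(ltW W0) ?(ltW c0) // [W * _]mulrC divfK ?gt_eqF.
Qed.

Lemma powRD_le (p u v : R) : 1 <= p -> 0 <= u -> 0 <= v ->
  (u + v) `^ p <= 2 `^ (p - 1) * (u `^ p + v `^ p).
Proof.
move=> p1 u0 v0.
have := @jensen_powR bool [:: true; false] (fun=> 1) (fun b => if b then u else v) p p1.
rewrite !big_cons !big_nil /= !mul1r !addr0; apply => //; by case.
Qed.

End Jensen.

Section FiniteSums.
Variables (R : realType) (T : choiceType).
Implicit Types (F G : T -> R) (M : R) (s : seq T).

(* A bound on a possibly infinite sum of nonnegative terms, stated with finite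
   subsums so that it stays in R. *)
Definition sum_le F M := forall s, uniq s -> \sum_(x <- s) F x <= M.

Lemma sum_subseq F s1 s2 : (forall x, 0 <= F x) -> uniq s1 -> uniq s2 ->
  {subset s1 <= s2} -> \sum_(x <- s1) F x <= \sum_(x <- s2) F x.
Proof.
move=> F0 u1 u2 s12; rewrite [leRHS](bigID (mem s1)) /=.
rewrite (_ : \sum_(x <- s2 | x \in s1) F x = \sum_(x <- s1) F x).
  by rewrite lerDl sumr_ge0.
rewrite -big_filter; apply: perm_big; apply: uniq_perm; rewrite ?filter_uniq // => x.
by rewrite mem_filter; case: (boolP (x \in s1)) => // /s12 ->.
Qed.

Lemma sum_leW F M N : M <= N -> sum_le F M -> sum_le F N.
Proof. by move=> MN FM s us; apply: le_trans (FM s us) MN. Qed.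

Lemma sum_le_le F G M : (forall x, F x <= G x) -> sum_le G M -> sum_le F M.
Proof. by move=> FG GM s us; apply: le_trans (GM s us); apply: ler_sum. Qed.

Lemma sum_leD F G M N : sum_le F M -> sum_le G N -> sum_le (fun x => F x + G x) (M + N).
Proof. by move=> FM GN s us; rewrite big_split lerD ?FM ?GN. Qed.

Lemma sum_leZ F c M : 0 <= c -> sum_le F M -> sum_le (fun x => c * F x) (c * M).
Proof. by move=> c0 FM s us; rewrite -mulr_sumr ler_wpM2l // FM. Qed.

Lemma sum_le_ge0 F M : sum_le F M -> 0 <= M.
Proof. by move=> /(_ [::] isT); rewrite big_nil. Qed.

Lemma sum_le_point F M x : sum_le F M -> F x <= M.
Proof. by move=> /(_ [:: x] isT); rewrite big_seq1. Qed.

Lemma sum_le_tail F M (eps : R) : (forall x, 0 <= F x) -> sum_le F M -> 0 < eps ->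
  exists2 s0 : seq T, uniq s0 &
    forall s, uniq s -> (forall x, x \in s -> x \notin s0) -> \sum_(x <- s) F x <= eps.
Proof.
move=> F0 FM e0.
pose E := [set z | exists2 s : seq T, uniq s & z = \sum_(x <- s) F x].
have hE : has_sup E.
  split; first by exists 0, [::]; rewrite ?big_nil.
  by exists M => _ [s us ->]; exact: FM.
have [_ [s0 us0 ->] h] := sup_adherent e0 hE.
exists s0 => // s us ss0.
have : \sum_(x <- s0 ++ s) F x <= sup E.
  apply: sup_upper_bound => //; exists (s0 ++ s) => //.
  rewrite cat_uniq us0 us andbT; apply/hasPn => x xs; exact: ss0.
rewrite big_cat /=; lra.
Qed.

End FiniteSums.

(** * Sums of radial functions and eigenfunctions on the tree *)

Section TreeSums.
Variables (R : realType) (T : choiceType) (e : rel T) (q : nat).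
Hypotheses (hT : homogeneous_tree e q) (q_gt1 : (1 < q)%N).
Local Notation d := (dist e).
Local Notation S := (sphere e).

(** The weight q^n serves for all n including 0, at the cost of the factor 2 that appears in the
    sums over the tree. *)
Lemma sphere_size_bounds y n : (q ^ n <= size (S y n) <= 2 * q ^ n)%N.
Proof.
case: n => [|n]; first by rewrite expn0.
rewrite (size_sphere hT) expnS; have := expn_gt0 q n; nia.
Qed.

Lemma sum_sphere_radial (G : nat -> R) y n :
  \sum_(x <- S y n) G (d x y) = (size (S y n))%:R * G n.
Proof.
rewrite (eq_big_seq (fun=> G n)).
  by rewrite big_const_seq count_predT iter_addr_0 mulr_natl.
by move=> x; rewrite (mem_sphere hT) => /eqP->.
Qed.

Lemma sum_le_balls (F : T -> R) M y : (forall x, 0 <= F x) ->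
  (forall n, \sum_(x <- ball e y n) F x <= M) -> sum_le F M.
Proof.
move=> F0 FM s us; have [n sn] := sub_ball hT y s.
by apply: le_trans (FM n); apply: sum_subseq => //; exact: ball_uniq hT y n.
Qed.

Lemma sum_le_radial (G : nat -> R) y M : (forall n, 0 <= G n) ->
  (forall K, \sum_(0 <= n < K) (q ^ n)%:R * G n <= M) ->
  sum_le (fun x => G (d x y)) (2 * M).
Proof.
move=> G0 GM; apply: (sum_le_balls (y := y)) => [x|K]; first exact: G0.
rewrite big_ball; apply: le_trans (ler_wpM2l _ (GM K)) => //.
rewrite mulr_sumr; apply: ler_sum => n _; rewrite sum_sphere_radial mulrA ler_wpM2r //.
by rewrite -natrM ler_nat; have /andP[] := sphere_size_bounds y n.
Qed.

Lemma sum_ball_radial_ge (G : nat -> R) y K : (forall n, 0 <= G n) ->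
  \sum_(0 <= n < K) (q ^ n)%:R * G n <= \sum_(x <- ball e y K) G (d x y).
Proof.
move=> G0; rewrite big_ball; apply: ler_sum => n _; rewrite sum_sphere_radial.
by rewrite ler_wpM2r // ler_nat; have /andP[] := sphere_size_bounds y n.
Qed.

Lemma sphere_exists y n : exists x, d x y = n.
Proof.
case E : (S y n) => [|x s].
  by have /andP[+ _] := sphere_size_bounds y n; rewrite E /= leqNgt expn_gt0 ltnW.
by exists x; apply/eqP; rewrite -(mem_sphere hT) E mem_head.
Qed.

(* Both sides satisfy the same three-term recursion in n. *)
Lemma sphere_sum_swap (G : nat -> R) x y n :
  \sum_(v <- S y n) G (d v x) = \sum_(v <- S x n) G (d v y).
Proof.
pose G' (G : nat -> R) m := if m is m'.+1 then G m' + G m'.+2 *+ q else G 1%N *+ q.+1.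
have G'E H z w : \sum_(v <- nb e w) H (d v z) = G' H (d w z).
  case E : (d w z) => [|m]; last by rewrite (sum_nb_radial hT H E).
  have /eqP -> : w == z by rewrite -(dist_eq0 hT) E.
  exact: (sum_nb_radial0 hT H).
suff E k : (forall H : nat -> R, \sum_(v <- S y k) H (d v x) = \sum_(v <- S x k) H (d v y)) /\
    (forall H : nat -> R, \sum_(v <- S y k.+1) H (d v x) = \sum_(v <- S x k.+1) H (d v y)).
  by have [] := E n.
elim: k => [|k [IH1 IH2]]; split.
- by move=> H; rewrite !big_seq1 (dist_sym hT).
- by move=> H; rewrite -!(sum_nb hT) !G'E (dist_sym hT).
- exact: IH2.
- move=> H.
  have h z w : \sum_(v <- S z k.+1) G' H (d v w) =
      \sum_(v <- S z k.+2) H (d v w) + (\sum_(v <- S z k) H (d v w)) *+ branching q k.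
    rewrite -(sum_sphere_nb hT z k (fun v => H (d v w))).
    by apply: eq_bigr => v _; rewrite G'E.
  by have := IH2 (G' H); rewrite !h IH1 => /addIr.
Qed.

Definition eigen_at (mu : R) (g : T -> R) w := \sum_(v <- nb e w) g v = mu * g w.

Lemma eigen_dist_pow (al : R) z w : al != 0 -> w != z ->
  eigen_at (al^-1 + q%:R * al) (fun v => al ^+ d v z) w.
Proof.
move=> al0; rewrite -(dist_eq0 hT) /eigen_at; case E : (d w z) => [//|n] _.
rewrite (sum_nb_radial hT (fun n => al ^+ n) E) !exprS -mulr_natr; field.
exact: al0.
Qed.

Lemma mean_value_dist_pow (al : R) z y n : al != 0 -> (n <= d y z)%N ->
  \sum_(v <- S y n) al ^+ d v z = sphere_coef q (al^-1 + q%:R * al) n * al ^+ d y z.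
Proof.
move=> al0 nyz; apply: (mean_value hT (g := fun v => al ^+ d v z)) => w wy.
apply: eigen_dist_pow => //; apply/eqP => wz; move: wy.
by rewrite wz (dist_sym hT); lia.
Qed.

(** Positivity is read off from the mean value formula at a point at distance n from z, where the
    left-hand side is a nonempty sum of positive terms. *)
Lemma sphere_coef_gt0 (al : R) n : 0 < al -> 0 < sphere_coef q (al^-1 + q%:R * al) n.
Proof.
move=> al0; have [y _] : exists y : T, True.
  have [//|nE] := pselect (exists y : T, True).
  exfalso; apply: (tree_infinite hT).
  rewrite (_ : setT = set0); first exact: finite_set0.
  by apply/seteqP; split => // y _; case: nE; exists y.
have [z dz] := sphere_exists y n.
have h := mean_value_dist_pow (z := z) (lt0r_neq0 al0) (_ : n <= d y z)%N.
rewrite -(pmulr_lgt0 _ (exprn_gt0 (d y z) al0)) -h ?(dist_sym hT y) ?dz //.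
case E : (S y n) => [|x s].
  by have /andP[+ _] := sphere_size_bounds y n; rewrite E /= leqNgt expn_gt0 ltnW.
rewrite big_cons ltr_pwDl ?exprn_gt0 // sumr_ge0 // => v _.
by rewrite exprn_ge0 // ltW.
Qed.

End TreeSums.

(** * Schur and Tannery arguments *)

Section Schur.
Variables (R : realType) (T : choiceType) (e : rel T) (q : nat).
Hypotheses (hT : homogeneous_tree e q) (q_gt1 : (1 < q)%N).
Local Notation d := (dist e).
Local Notation S := (sphere e).

(** The distance 2n leaves room for two successive spheres of radius n. *)
Lemma far_vertex (s : seq T) n : s != [::] ->
  exists z, forall x, x \in s -> (2 * n <= d x z)%N.
Proof.
case: s => [//|x0 s] _; have [N sN] := sub_ball hT x0 (x0 :: s).
have [z dz] := sphere_exists hT q_gt1 x0 (N + 2 * n).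
exists z => x /sN; rewrite (mem_ball hT) => xN.
by rewrite (dist_sym hT) in dz; have := dist_triangle hT x0 x z; rewrite dz (dist_sym hT x0); lia.
Qed.

(* Schur test against al ^ d(., z): when z is far away from the finitely many
   points involved, this function is an eigenfunction near them. *)
Lemma schur_sphere (p al al2 M : R) (h : T -> R) n :
  1 <= p -> 0 < al -> 0 < al2 -> al2 = al `^ (p - 1) ->
  al2^-1 + q%:R * al2 = al^-1 + q%:R * al ->
  (forall x, 0 <= h x) -> sum_le (fun x => h x `^ p) M ->
  sum_le (fun x => (\sum_(y <- S x n) h y) `^ p)
         (sphere_coef q (al^-1 + q%:R * al) n `^ p * M).
Proof.
move=> p1 al0 al20 al2E muE h0 hM s us.
set sg := sphere_coef q _ n; have sg0 : 0 < sg by exact: (sphere_coef_gt0 hT q_gt1).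
have M0 := sum_le_ge0 hM.
have [->|sn] := eqVneq s [::]; first by rewrite big_nil mulr_ge0 // powR_ge0.
have [z zs] := far_vertex n sn.
pose E x := al ^+ d x z; pose E2 x := al2 ^+ d x z.
have E0 x : 0 < E x by rewrite exprn_gt0.
have E20 x : 0 < E2 x by rewrite exprn_gt0.
have EE x : E x `^ (p - 1) = E2 x.
  rewrite /E2 /E -(powR_mulrn (d x z) (ltW al0)) -powRrM mulrC powRrM -al2E.
  by rewrite powR_mulrn // ltW.
pose F x y := E2 x * (h y `^ p / E2 y).
have F0 x y : 0 <= F x y.
  by rewrite mulr_ge0 ?divr_ge0 ?powR_ge0 // ltW.
have mean a0 y : 0 < a0 -> a0^-1 + q%:R * a0 = al^-1 + q%:R * al -> (n <= d y z)%N ->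
    \sum_(v <- S y n) a0 ^+ d v z = sg * a0 ^+ d y z.
  by move=> a00 a0E ny; rewrite (mean_value_dist_pow hT q_gt1 (lt0r_neq0 a00) ny) a0E.
have step x : x \in s -> (\sum_(y <- S x n) h y) `^ p <= sg `^ (p - 1) * \sum_(y <- S x n) F x y.
  move=> xs; have -> : \sum_(y <- S x n) h y = \sum_(y <- S x n) E y * (h y / E y).
    by apply: eq_bigr => y _; rewrite mulrC divfK ?gt_eqF.
  apply: le_trans (jensen_powR p1 _ _) _ => [y _|y _|]; first exact: ltW.
    by rewrite divr_ge0 // ltW.
  rewrite mean //; last by have := zs x xs; lia.
  rewrite powRM ?(ltW sg0) ?(ltW (E0 x)) // EE -mulrA ler_wpM2l ?powR_ge0 //.
  rewrite mulr_sumr; apply: ler_sum => y _; rewrite /F ler_wpM2l ?(ltW (E20 x)) //.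
  have -> : (h y / E y) `^ p = h y `^ p / (E2 y * E y).
    have -> : h y `^ p = (h y / E y) `^ p * E y `^ p.
      by rewrite -powRM ?divr_ge0 ?(ltW (E0 y)) // divfK ?lt0r_neq0.
    by rewrite -EE -powR_succr // mulfK // lt0r_neq0 // powR_gt0.
  rewrite le_eqVlt; apply/orP; left; apply/eqP; field.
  by rewrite !gt_eqF.
apply: (@le_trans _ _ (\sum_(x <- s) sg `^ (p - 1) * \sum_(y <- S x n) F x y)).
  by rewrite big_seq [leRHS]big_seq; apply: ler_sum.
rewrite -mulr_sumr.
rewrite [_ `^ p in leRHS]powR_succr // -mulrA ler_wpM2l ?powR_ge0 //.
pose Y := undup (flatten [seq S x n | x <- s]).
have YP x y : x \in s -> y \in S x n -> y \in Y.
  by move=> xs yx; rewrite mem_undup; apply/flattenP; exists (S x n) => //; apply: map_f.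
have Yfar y : y \in Y -> (n <= d y z)%N.
  rewrite mem_undup => /flattenP[_ /mapP[x xs ->]]; rewrite (mem_sphere hT) => /eqP dyx.
  by have := zs x xs; have := dist_triangle hT x y z; rewrite (dist_sym hT x y) dyx; lia.
apply: (@le_trans _ _ (\sum_(y <- Y) \sum_(x <- S y n) F x y)).
  have -> : \sum_(x <- s) \sum_(y <- S x n) F x y =
            \sum_(x <- s) \sum_(y <- Y | d y x == n) F x y.
    apply: eq_big_seq => x xs; rewrite -[RHS]big_filter; apply: perm_big; apply: uniq_perm.
    - exact: (sphere_uniq e).
    - by rewrite filter_uniq // undup_uniq.
    - move=> y; rewrite mem_filter (mem_sphere hT); apply/idP/andP => [dy|[]//].
      by split=> //; apply: YP xs _; rewrite (mem_sphere hT).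
  under eq_bigr do rewrite big_mkcond.
  rewrite exchange_big /=; apply: ler_sum => y _; rewrite -big_mkcond -big_filter.
  apply: sum_subseq => //.
  - by rewrite filter_uniq.
  - exact: (sphere_uniq e).
  - by move=> x; rewrite mem_filter (mem_sphere hT) (dist_sym hT) => /andP[].
have -> : \sum_(y <- Y) \sum_(x <- S y n) F x y = sg * \sum_(y <- Y) h y `^ p.
  rewrite mulr_sumr; apply: eq_big_seq => y yY; rewrite -mulr_suml.
  by rewrite [X in X * _]mean // ?Yfar //; rewrite -/(E2 y); field; rewrite gt_eqF.
by rewrite ler_wpM2l ?(ltW sg0) // hM // undup_uniq.
Qed.

End Schur.

Section Tannery.
Variables (R : realType) (T : choiceType) (e : rel T) (q : nat).
Hypothesis hT : homogeneous_tree e q.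

Lemma near_all_seq (I : eqType) (s : seq I) (P : I -> R -> Prop) :
  (forall i, \forall t \near +oo, P i t) -> \forall t \near +oo, forall i, i \in s -> P i t.
Proof.
move=> hP; elim: s => [|i s IH]; first by apply: nearW => t i.
near=> t => j; rewrite inE => /orP[/eqP->|js].
  by near: t; exact: hP.
by move: j js; near: t.
Unshelve. all: by end_near. Qed.

(** Dominated convergence over y. Jensen's inequality with weights c(y) w(y) reduces to the sums of
    K(t, y, .)^p: the vanishing of each one handles finitely many y, the uniform bound handles the
    others. Infinite sums in y enter as limits along balls, whence [eta]. *)
Lemma tannery_powR (o : T) (c w : T -> R) (A0 p C : R) (L : R -> R)
    (K : R -> T -> T -> R) (H : R -> T -> R) :
  1 <= p -> 0 <= C -> (forall y, 0 <= c y) -> (forall y, 0 < w y) ->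
  (forall t y x, 0 <= K t y x) ->
  sum_le (fun y => c y * w y) A0 ->
  (\forall t \near +oo, 0 < L t) ->
  (\forall t \near +oo, forall y, sum_le (fun x => K t y x `^ p) (w y `^ p * (C * L t))) ->
  (forall y eps, 0 < eps -> \forall t \near +oo, sum_le (fun x => K t y x `^ p) (eps * L t)) ->
  (\forall t \near +oo, forall x, 0 <= H t x /\ forall eta, 0 < eta ->
     exists N, forall n, (N <= n)%N -> H t x <= \sum_(y <- ball e o n) c y * K t y x + eta) ->
  forall eps, 0 < eps -> \forall t \near +oo, sum_le (fun x => H t x `^ p) (eps * L t).
Proof.
move=> p1 C0 c0 w0 K0 cA hL hC h0 hH eps eps0.
have A00 : 0 <= A0 := sum_le_ge0 cA.
pose A1 := A0 + 1; have A10 : 0 < A1 by rewrite /A1; lra.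
pose D := 2 `^ (p - 1) * A1 `^ (p - 1).
have D0 : 0 < D by rewrite mulr_gt0 // powR_gt0.
(* The error on the finite set s0 and the mass outside it each cost at most eps / 4 after
   multiplication by D; the other eps / 2 is for the truncation to balls. *)
pose e1 := eps / 2 / D / (2 * A1); pose e2 := eps / 2 / D / (2 * (C + 1)).
have e10 : 0 < e1 by rewrite !divr_gt0 // mulr_gt0.
have C1 : 0 < C + 1 by lra.
have e20 : 0 < e2 by rewrite !divr_gt0 // mulr_gt0.
have cw0 y : 0 <= c y * w y by rewrite mulr_ge0 // ltW.
have [s0 us0 s0tail] := sum_le_tail cw0 cA e20.
have hs0 : \forall t \near +oo, forall y, y \in s0 ->
    sum_le (fun x => K t y x `^ p) (w y `^ p * e1 * L t).
  by apply: near_all_seq => y; apply: h0; rewrite mulr_gt0 // powR_gt0.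
near=> t; have Lt : 0 < L t by near: t.
have hCt : forall y, sum_le (fun x => K t y x `^ p) (w y `^ p * (C * L t)) by near: t.
have hHt : forall x, 0 <= H t x /\ forall eta, 0 < eta ->
     exists N, forall n, (N <= n)%N -> H t x <= \sum_(y <- ball e o n) c y * K t y x + eta.
  by near: t.
have hst : forall y, y \in s0 -> sum_le (fun x => K t y x `^ p) (w y `^ p * e1 * L t) by near: t.
move=> s us.
pose V n x := \sum_(y <- ball e o n) c y * K t y x.
have V0 n x : 0 <= V n x by apply: sumr_ge0 => y _; rewrite mulr_ge0.
(* At each of the points of s the truncation error costs 2^(p-1) eta^p, in total at most eps / 2 * L
   t; the successor keeps the denominator positive for empty s. *)
pose eta := (eps / 2 * L t / (2 `^ (p - 1) * (size s).+1%:R)) `^ p^-1.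
have q0 : 0 < eps / 2 * L t / (2 `^ (p - 1) * (size s).+1%:R).
  by rewrite divr_gt0 ?mulr_gt0 ?powR_gt0.
have eta0 : 0 < eta by exact: powR_gt0.
have [n hn] : exists n, forall x, x \in s -> H t x <= V n x + eta.
  suff [n hn] : exists N, forall n, (N <= n)%N -> forall x, x \in s -> H t x <= V n x + eta.
    by exists n; exact: hn.
  elim: (s) => [|x s' [N hN]]; first by exists 0%N.
  have [N' hN'] := (hHt x).2 eta eta0.
  exists (N + N')%N => n nN y; rewrite inE => /orP[/eqP->|ys].
    by apply: hN'; exact: leq_trans (leq_addl _ _) nN.
  by apply: hN ys; exact: leq_trans (leq_addr _ _) nN.
have VD : \sum_(x <- s) V n x `^ p <= A1 `^ (p - 1) * (A1 * e1 * L t + e2 * (C * L t)).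
  pose Q y := c y * w y * \sum_(x <- s) (K t y x / w y) `^ p.
  apply: (@le_trans _ _ (A1 `^ (p - 1) * \sum_(y <- ball e o n) Q y)).
    rewrite /Q; under [in leRHS]eq_bigr do rewrite mulr_sumr.
    rewrite exchange_big mulr_sumr /=; apply: ler_sum => x _.
    have -> : V n x = \sum_(y <- ball e o n) (c y * w y) * (K t y x / w y).
      by apply: eq_bigr => y _; field; rewrite gt_eqF.
    apply: le_trans (jensen_powR p1 _ _) _ => [y _|y _|]; first exact: cw0.
      by rewrite divr_ge0 // ltW.
    rewrite ler_wpM2r //.
      by apply: sumr_ge0 => y _; rewrite mulr_ge0 // powR_ge0.
    have h1 := cA _ (ball_uniq hT o n).
    apply: ge0_ler_powR; rewrite ?nnegrE ?subr_ge0 ?(ltW A10) ?sumr_ge0 //.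
    by apply: le_trans h1 _; rewrite /A1; lra.
  rewrite ler_wpM2l ?powR_ge0 // (bigID (mem s0)) /=.
  have QM y M : sum_le (fun x => K t y x `^ p) (w y `^ p * M) -> Q y <= c y * w y * M.
    move=> hM; rewrite ler_wpM2l //.
    have wp : 0 < w y `^ p by rewrite powR_gt0.
    rewrite -(ler_pM2l wp); apply: le_trans (hM s us).
    rewrite mulr_sumr; apply: ler_sum => x _.
    rewrite -powRM ?(ltW (w0 y)) ?divr_ge0 ?(ltW (w0 y)) //.
    by rewrite mulrC divfK ?gt_eqF.
  apply: lerD.
    apply: (@le_trans _ _ (\sum_(y <- ball e o n | y \in s0) c y * w y * (e1 * L t))).
      by apply: ler_sum => y ys; apply: QM; rewrite mulrA; exact: hst.
    rewrite -mulr_suml -mulrA ler_wpM2r ?(mulr_ge0 (ltW e10) (ltW Lt)) //.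
    rewrite -big_filter; apply: le_trans (cA _ _) _; last by rewrite /A1; lra.
    by rewrite filter_uniq // (ball_uniq hT).
  apply: (@le_trans _ _ (\sum_(y <- ball e o n | y \notin s0) c y * w y * (C * L t))).
    by apply: ler_sum => y ys; apply: QM; exact: hCt.
  rewrite -mulr_suml ler_wpM2r ?mulr_ge0 ?(ltW Lt) //.
  rewrite -big_filter; apply: s0tail; first by rewrite filter_uniq // (ball_uniq hT).
  by move=> y; rewrite mem_filter => /andP[].
apply: (@le_trans _ _ (2 `^ (p - 1) * (\sum_(x <- s) V n x `^ p + (size s)%:R * eta `^ p))).
  apply: (@le_trans _ _ (\sum_(x <- s) 2 `^ (p - 1) * (V n x `^ p + eta `^ p))).
    rewrite big_seq [leRHS]big_seq; apply: ler_sum => x xs.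
    apply: le_trans (powRD_le p1 (V0 n x) (ltW eta0)).
    have [Hx0 _] := hHt x.
    apply: ge0_ler_powR; rewrite ?nnegrE ?addr_ge0 ?(ltW eta0) ?hn //; lra.
  rewrite -mulr_sumr big_split /= ler_wpM2l ?powR_ge0 // lerD2l.
  by rewrite big_const_seq count_predT iter_addr_0 mulr_natl.
have etap : eta `^ p = eps / 2 * L t / (2 `^ (p - 1) * (size s).+1%:R).
  rewrite /eta -powRrM mulVf ?powRr1 ?(ltW q0) //.
  by rewrite gt_eqF //; lra.
have h2 : 2 `^ (p - 1) * ((size s)%:R * eta `^ p) <= eps / 2 * L t.
  rewrite etap; have s10 : 0 < (size s).+1%:R :> R by rewrite ltr0Sn.
  have -> : 2 `^ (p - 1) * ((size s)%:R * (eps / 2 * L t / (2 `^ (p - 1) * (size s).+1%:R))) =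
    (size s)%:R / (size s).+1%:R * (eps / 2 * L t).
    by field; rewrite !gt_eqF // powR_gt0.
  rewrite ler_piMl ?mulr_ge0 ?divr_ge0 ?(ltW Lt) ?(ltW eps0) //.
  by rewrite ler_pdivrMr // mul1r ler_nat.
have h3 : 2 `^ (p - 1) * \sum_(x <- s) V n x `^ p <= eps / 2 * L t.
  apply: le_trans (ler_wpM2l (powR_ge0 _ _) VD) _; rewrite mulrA -/D.
  have -> : D * (A1 * e1 * L t + e2 * (C * L t)) = (1 / 2 + C / (2 * (C + 1))) * (eps / 2 * L t).
    by rewrite /e1 /e2; field; rewrite !gt_eqF.
  rewrite ler_piMl ?mulr_ge0 ?divr_ge0 ?(ltW Lt) ?(ltW eps0) //.
  have : C / (2 * (C + 1)) <= 1 / 2 by rewrite ler_pdivrMr ?mulr_gt0 //; lra.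
  lra.
rewrite mulrDr; lra.
Unshelve. all: by end_near. Qed.

End Tannery.

(** * Ratios of heat kernels *)

Section RatioError.
Variables (R : realType) (T : choiceType) (e : rel T) (q : nat).
Hypotheses (hT : homogeneous_tree e q) (q_gt1 : (1 < q)%N).
Local Notation d := (dist e).
Local Notation S := (sphere e).
Variables (o : T) (p a : R) (psi : nat -> R) (h : R -> nat -> R) (L : R -> R).
Hypotheses (p_ge1 : 1 <= p) (a_ge1 : 1 <= a).
Hypotheses (psi_gt0 : forall n, 0 < psi n).
Hypotheses (psi_up : forall n, psi n <= a * psi n.+1) (psi_down : forall n, psi n.+1 <= a * psi n).
Hypothesis h_ge0 : forall t n, 0 <= h t n.
Let rho t n := h t n / psi n.
Hypothesis L_gt0 : \forall t \near +oo, 0 < L t.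
Hypothesis h_le : \forall t \near +oo, forall K, \sum_(0 <= n < K) (q ^ n)%:R * h t n `^ p <= L t.
Hypothesis rho_variation : forall eps, 0 < eps -> \forall t \near +oo, forall K,
  \sum_(0 <= n < K) (q ^ n)%:R * (psi n `^ p * `|rho t n.+1 - rho t n| `^ p) <= eps * L t.

Let p_ge0 : 0 <= p. Proof. exact: le_trans p_ge1. Qed.
Let a_gt0 : 0 < a. Proof. exact: lt_le_trans a_ge1. Qed.

Lemma psi_edge x y z : e y z -> psi (d x y) <= a * psi (d x z).
Proof.
rewrite (tree_sym hT) ![d x _](dist_sym hT) => ezy.
by case: (dist_edgeP hT x ezy) => ->; rewrite ?psi_down ?psi_up.
Qed.

Lemma psi_dist_le x y : psi (d x y) <= a ^+ d y o * psi (d x o).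
Proof.
move En : (d y o) => n; elim: n y En => [|n IH] y dy.
  have /eqP -> : y == o by rewrite -(dist_eq0 hT) dy.
  by rewrite expr0 mul1r.
have [z eyz dz] := dist_parent hT dy.
apply: le_trans (psi_edge x eyz) _; rewrite exprS -mulrA ler_wpM2l ?(ltW a_gt0) //.
exact: IH.
Qed.

Let F t y x := psi (d x y) * `|rho t (d x y) - rho t (d x o)|.

Let F_ge0 t y x : 0 <= F t y x. Proof. by rewrite mulr_ge0 // ltW. Qed.

Lemma ratio_errorE t y x :
  `|h t (d x y) - psi (d x y) / psi (d x o) * h t (d x o)| = F t y x.
Proof.
have pE : psi (d x y) = `|psi (d x y)| by rewrite ger0_norm // ltW.
rewrite /F [in RHS]pE -normrM; congr `|_|.
by rewrite /rho; field; rewrite !gt_eqF.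
Qed.

(** Moving from y to a neighbour changes d(x, .) by one in either direction, so both increments at
    level n occur. *)
Let G t n := psi n `^ p * `|rho t n.+1 - rho t n| `^ p +
  (if n is m.+1 then psi n `^ p * `|rho t n - rho t m| `^ p else 0).

Let G_ge0 t n : 0 <= G t n.
Proof.
by rewrite /G; case: n => [|n]; rewrite addr_ge0 // mulr_ge0 // powR_ge0.
Qed.

Lemma adjacent_ratio_error t x y z : e y z ->
  (psi (d x y) * `|rho t (d x y) - rho t (d x z)|) `^ p <= G t (d x y).
Proof.
rewrite ![d x _](dist_sym hT) => eyz; rewrite powRM ?(ltW (psi_gt0 _)) // /G.
case: (dist_edgeP hT x eyz) => E; rewrite E.
  rewrite distrC lerDl; case: (d y x) => // n; by rewrite mulr_ge0 // powR_ge0.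
by rewrite lerDr mulr_ge0 // powR_ge0.
Qed.

Lemma ratio_error y eps : 0 < eps ->
  \forall t \near +oo, sum_le (fun x => F t y x `^ p) (eps * L t).
Proof.
move En : (d y o) => n; elim: n y eps En => [|n IH] y eps dy eps0.
  have /eqP yo : y == o by rewrite -(dist_eq0 hT) dy.
  near=> t; have Lt : 0 < L t by near: t.
  move=> s us; rewrite big1 ?mulr_ge0 ?(ltW eps0) ?(ltW Lt) // => x _.
  by rewrite /F yo subrr normr0 mulr0 powR0 // gt_eqF // (lt_le_trans _ p_ge1).
have [z eyz dz] := dist_parent hT dy.
have ap : 0 < a `^ p by exact: powR_gt0.
have two : 0 < 2 `^ (p - 1) :> R by exact: powR_gt0.
have q0 : 0 <= q%:R :> R by [].
(* The loss caused by one edge of the geodesic from o to y. *)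
pose k := 2 `^ (p - 1) * (2 * (1 + q%:R * a `^ p) + a `^ p).
have k0 : 0 < k.
  by rewrite mulr_gt0 // ltr_wpDl // mulr_ge0 // addr_ge0 // mulr_ge0 // ltW.
have e0 : 0 < eps / k by rewrite divr_gt0.
have IHz := IH z (eps / k) dz e0; have hV := rho_variation e0.
near=> t; have Lt : 0 < L t by near: t.
have IHt : sum_le (fun x => F t z x `^ p) (eps / k * L t) by near: t.
have hVt : forall K, \sum_(0 <= n < K) (q ^ n)%:R *
    (psi n `^ p * `|rho t n.+1 - rho t n| `^ p) <= eps / k * L t by near: t.
have GV : sum_le (fun x => G t (d x y)) (2 * ((1 + q%:R * a `^ p) * (eps / k * L t))).
  apply: (sum_le_radial hT q_gt1) => // K; under eq_bigr do rewrite mulrDr.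
  rewrite big_split mulrDl mul1r; apply: lerD => //.
  case: K => [|K]; first by rewrite big_geq // mulr_ge0 ?(ltW (mulr_gt0 e0 Lt)) // mulr_ge0 // ltW.
  (* Shifting by one level costs q for the sphere and a^p for psi. *)
  rewrite big_nat_recl //= mulr0 add0r; apply: le_trans (_ : q%:R * a `^ p * \sum_(0 <= n < K) (q ^ n)%:R *
    (psi n `^ p * `|rho t n.+1 - rho t n| `^ p) <= _); last first.
    by rewrite ler_wpM2l // mulr_ge0 // ltW.
  rewrite mulr_sumr; apply: ler_sum => m _; rewrite expnS natrM.
  have -> : q%:R * a `^ p * ((q ^ m)%:R * (psi m `^ p * `|rho t m.+1 - rho t m| `^ p)) =
    q%:R * (q ^ m)%:R * (a `^ p * psi m `^ p * `|rho t m.+1 - rho t m| `^ p) by ring.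
  rewrite ler_wpM2l ?mulr_ge0 // ler_wpM2r ?powR_ge0 // -powRM ?(ltW a_gt0) ?(ltW (psi_gt0 _)) //.
  by apply: ge0_ler_powR => //; rewrite nnegrE ?mulr_ge0 ?(ltW a_gt0) // ltW.
have : sum_le (fun x => 2 `^ (p - 1) * (G t (d x y) + a `^ p * F t z x `^ p))
    (2 `^ (p - 1) * (2 * ((1 + q%:R * a `^ p) * (eps / k * L t)) + a `^ p * (eps / k * L t))).
  apply: sum_leZ; first exact: ltW.
  by apply: sum_leD => //; apply: sum_leZ => //; exact: ltW.
rewrite (_ : 2 `^ (p - 1) * _ = eps * L t); last first.
  rewrite -[in RHS](divfK (lt0r_neq0 k0) eps) /k; ring.
apply: sum_le_le => x.
apply: (@le_trans _ _ ((psi (d x y) * `|rho t (d x y) - rho t (d x z)| + a * F t z x) `^ p)).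
  have A1 : 0 <= psi (d x y) * `|rho t (d x y) - rho t (d x z)| by rewrite mulr_ge0 // ltW.
  have A2 : 0 <= a * F t z x by rewrite mulr_ge0 // ltW.
  apply: ge0_ler_powR; rewrite ?nnegrE ?(addr_ge0 A1 A2) //.
  apply: (@le_trans _ _ (psi (d x y) * (`|rho t (d x y) - rho t (d x z)| +
      `|rho t (d x z) - rho t (d x o)|))).
    rewrite ler_wpM2l ?(ltW (psi_gt0 _)) //.
    by rewrite -[X in `|X|](subrKA (rho t (d x z))) ler_normD.
  by rewrite mulrDr lerD2l mulrA ler_wpM2r // psi_edge.
apply: le_trans (powRD_le p_ge1 _ _) _.
- by rewrite mulr_ge0 ?(ltW (psi_gt0 _)).
- by rewrite mulr_ge0 ?(ltW a_gt0).
rewrite ler_wpM2l ?(ltW two) //; apply: lerD; first exact: adjacent_ratio_error.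
by rewrite powRM ?(ltW a_gt0).
Unshelve. all: by end_near. Qed.

Variable m : T -> T -> R.
Hypotheses (m_ge0 : forall y x, 0 <= m y x) (m_le : forall y x, m y x <= a ^+ d y o).
Hypothesis m_far : forall y x, (d y o <= d x o)%N -> m y x = psi (d x y) / psi (d x o).
(* If m is not the exact ratio near o, bounded neighbourhoods of o must not
   carry a positive proportion of the norm of h t. *)
Hypothesis m_near : (forall y x, m y x = psi (d x y) / psi (d x o)) \/
  (forall n eps, 0 < eps -> \forall t \near +oo, h t n `^ p <= eps * L t).

Let K t y x := `|h t (d x y) - m y x * h t (d x o)|.

Let K_ge0 t y x : 0 <= K t y x. Proof. exact: normr_ge0. Qed.

Lemma mass_error_bound : \forall t \near +oo,
  forall y, sum_le (fun x => K t y x `^ p) ((a ^+ d y o) `^ p * (2 `^ (p - 1) * 4 * L t)).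
Proof.
near=> t; have ht : forall K, \sum_(0 <= n < K) (q ^ n)%:R * h t n `^ p <= L t by near: t.
have Lt : 0 < L t by near: t.
move=> y; set w := a ^+ d y o; have w1 : 1 <= w by rewrite exprn_ege1.
have w0 : 0 <= w := le_trans ler01 w1.
have hx z : sum_le (fun x => h t (d x z) `^ p) (2 * L t).
  by apply: (sum_le_radial hT q_gt1 (G := fun n => h t n `^ p)) => // n; exact: powR_ge0.
have wp : 1 <= w `^ p by rewrite -(powRr0 w) ler_powR.
have : sum_le (fun x => 2 `^ (p - 1) * (h t (d x y) `^ p + w `^ p * h t (d x o) `^ p))
    (2 `^ (p - 1) * (2 * L t + w `^ p * (2 * L t))).
  by apply: sum_leZ; [exact: powR_ge0|apply: sum_leD => //; apply: sum_leZ => //; exact: powR_ge0].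
move=> h1; apply: sum_le_le (sum_leW _ h1); last first.
  rewrite [leRHS]mulrC -!mulrA ler_wpM2l ?powR_ge0 //.
  have := ler_wpM2r (ltW Lt) wp; lra.
move=> x; apply: (@le_trans _ _ ((h t (d x y) + w * h t (d x o)) `^ p)).
  apply: ge0_ler_powR; rewrite ?nnegrE ?addr_ge0 ?mulr_ge0 ?K_ge0 //.
  rewrite /K; apply: le_trans (ler_normB _ _) _; rewrite ger0_norm // lerD2l ger0_norm ?mulr_ge0 //.
  by rewrite ler_wpM2r ?m_le.
apply: le_trans (powRD_le p_ge1 _ _) _; rewrite ?mulr_ge0 //.
by rewrite [(w * _) `^ p]powRM.
Unshelve. all: by end_near. Qed.

Lemma mass_error_vanish y eps : 0 < eps ->
  \forall t \near +oo, sum_le (fun x => K t y x `^ p) (eps * L t).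
Proof.
move=> eps0; case: m_near => [mE|small].
  have hF := ratio_error y eps0; near=> t.
  have : sum_le (fun x => F t y x `^ p) (eps * L t) by near: t.
  by apply: sum_le_le => x; rewrite /K mE ratio_errorE.
set w := a ^+ d y o; have w0 : 0 <= w by rewrite exprn_ge0 // ltW.
have two : 0 < 2 `^ (p - 1) :> R by exact: powR_gt0.
pose N := d y o.
pose k := 2 * ((2 * w) `^ p * \sum_(0 <= n < N) (q ^ n)%:R) + 1 : R.
have S0 : 0 <= \sum_(0 <= n < N) (q ^ n)%:R :> R by exact: sumr_ge0.
have k0 : 0 < k by rewrite ltr_wpDl // mulr_ge0 // mulr_ge0 // powR_ge0.
pose e1 := eps / 2 `^ (p - 1) / 2; have e10 : 0 < e1 by rewrite !divr_gt0.
have hF := ratio_error y e10.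
have e2 : 0 < e1 / k by rewrite divr_gt0.
have hS : \forall t \near +oo, forall n, n \in iota 0 N -> h t n `^ p <= e1 / k * L t.
  by apply: near_all_seq => n; exact: small.
near=> t; have Lt : 0 < L t by near: t.
have hFt : sum_le (fun x => F t y x `^ p) (e1 * L t) by near: t.
have hSt : forall n, n \in iota 0 N -> h t n `^ p <= e1 / k * L t by near: t.
(* The kernel m and the exact ratio can differ only where d(x, o) < N, and both are at most w
   there. *)
pose H n := if (n < N)%N then (2 * w * h t n) `^ p else 0.
have H0 n : 0 <= H n by rewrite /H; case: ifP => // _; exact: powR_ge0.
have HL : sum_le (fun x => H (d x o)) (2 * ((2 * w) `^ p * (\sum_(0 <= n < N) (q ^ n)%:R) * (e1 / k * L t))).
  apply: (sum_le_radial hT q_gt1) => // K'.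
  apply: (@le_trans _ _ (\sum_(0 <= n < N) (q ^ n)%:R * H n)).
    have [KN|NK] := leqP K' N.
      by rewrite [leRHS](big_cat_nat _ (n := K')) //= lerDl sumr_ge0 // => n _; rewrite mulr_ge0.
    rewrite [leLHS](big_cat_nat _ (n := N)) ?(ltnW NK) //= gerDl big_nat_cond sumr_le0 //.
    by move=> n /andP[/andP[Nn _] _]; rewrite /H ltnNge Nn mulr0.
  rewrite mulr_sumr mulr_suml big_nat_cond [leRHS]big_nat_cond; apply: ler_sum => n /andP[/andP[_ nN] _].
  rewrite /H nN powRM ?mulr_ge0 // mulrCA -mulrA ler_wpM2l ?powR_ge0 // ler_wpM2l //.
  by apply: hSt; rewrite mem_iota.
have : sum_le (fun x => 2 `^ (p - 1) * (F t y x `^ p + H (d x o)))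
   (2 `^ (p - 1) * (e1 * L t + 2 * ((2 * w) `^ p * (\sum_(0 <= n < N) (q ^ n)%:R) * (e1 / k * L t)))).
  by apply: sum_leZ; [exact: ltW|exact: sum_leD].
move=> h1; apply: sum_le_le (sum_leW _ h1); last first.
  have -> : eps * L t = 2 `^ (p - 1) * (e1 * L t + e1 * L t).
    by rewrite /e1; field; rewrite gt_eqF.
  rewrite ler_wpM2l ?(ltW two) // lerD2l.
  have -> : e1 * L t = k * (e1 / k * L t) by field; rewrite gt_eqF.
  have := mulr_gt0 e2 Lt; rewrite /k; lra.
move=> x; have [xy|xy] := leqP (d y o) (d x o).
  rewrite /K m_far // ratio_errorE /H ltnNge xy addr0.
  by rewrite ler_peMl ?powR_ge0 // -[X in X <= _](powRr0 2) ler_powR ?subr_ge0 // ler1n.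
apply: (@le_trans _ _ ((F t y x + 2 * w * h t (d x o)) `^ p)); last first.
  apply: le_trans (powRD_le p_ge1 _ _) _ => //; first by rewrite !mulr_ge0.
  by rewrite ler_wpM2l ?(ltW two) // lerD2l /H xy.
apply: ge0_ler_powR; rewrite ?nnegrE ?addr_ge0 ?mulr_ge0 ?K_ge0 ?(ltW (psi_gt0 _)) //.
rewrite -ratio_errorE /K; set r := psi (d x y) / psi (d x o).
have r0 : 0 <= r by rewrite divr_ge0 // ltW.
have rw : r <= w by rewrite ler_pdivrMr // psi_dist_le.
have -> : h t (d x y) - m y x * h t (d x o) =
   (h t (d x y) - r * h t (d x o)) + (r - m y x) * h t (d x o) by ring.
apply: le_trans (ler_normD _ _) _; rewrite lerD2l normrM [`|h _ _|]ger0_norm // ler_wpM2r //.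
apply: le_trans (ler_normB _ _) _; rewrite !ger0_norm //.
by have := m_le y x; rewrite -/w; lra.
Unshelve. all: by end_near. Qed.

(** Jensen's inequality for the uniform average over the sphere. Only the sum of m over the sphere
    enters the conclusion, which leaves freedom in the choice of m. *)
Lemma sphere_mass_error_vanish n sg eps :
  (forall x, \sum_(v <- S o n) m v x = sg) -> 0 < eps ->
  \forall t \near +oo, sum_le (fun x => `|(\sum_(v <- S o n) h t (d x v) - sg * h t (d x o))
      / (size (S o n))%:R| `^ p) (eps * L t).
Proof.
move=> msg eps0.
have hK : \forall t \near +oo, forall v, v \in S o n -> sum_le (fun x => K t v x `^ p) (eps * L t).
  by apply: near_all_seq => v; exact: mass_error_vanish.
near=> t; have hKt : forall v, v \in S o n -> sum_le (fun x => K t v x `^ p) (eps * L t) by near: t.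
have s0 : (0 < size (S o n))%N.
  by have /andP[+ _] := sphere_size_bounds hT q_gt1 o n; apply: leq_trans; rewrite expn_gt0 ltnW.
have sR : 0 < (size (S o n))%:R :> R by rewrite ltr0n.
set c := (size (S o n))%:R^-1 : R; have c0 : 0 <= c by rewrite invr_ge0 ltW.
have sumc : \sum_(v <- S o n) c = 1.
  by rewrite big_const_seq count_predT iter_addr_0 -mulr_natr mulVf // gt_eqF.
move=> s us.
apply: (@le_trans _ _ (\sum_(x <- s) \sum_(v <- S o n) c * K t v x `^ p)).
  apply: ler_sum => x _.
  apply: (@le_trans _ _ ((\sum_(v <- S o n) c * K t v x) `^ p)).
    apply: ge0_ler_powR; rewrite ?nnegrE //.
      by apply: sumr_ge0 => v _; rewrite mulr_ge0.
    rewrite -(msg x) mulr_suml -sumrB mulrC normrM ger0_norm // -mulr_sumr ler_wpM2l //.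
    exact: ler_norm_sum.
  by apply: le_trans (jensen_powR p_ge1 _ _) _ => //; rewrite sumc powR1 mul1r.
rewrite exchange_big /= -[leRHS]mul1r -sumc mulr_suml big_seq [leRHS]big_seq.
apply: ler_sum => v vS; rewrite -mulr_sumr ler_wpM2l //; exact: hKt.
Unshelve. all: by end_near. Qed.

End RatioError.

(** * Heat profile asymptotics *)

Section PolyGeometric.
Variable R : realType.

Lemma geometric_sum_le (th : R) K : 0 <= th -> th < 1 ->
  \sum_(0 <= n < K) th ^+ n <= (1 - th)^-1.
Proof.
move=> th0 th1; have d0 : 0 < 1 - th by rewrite subr_gt0.
rewrite -(ler_pM2l d0) mulfV ?gt_eqF //.
have -> : (1 - th) * \sum_(0 <= n < K) th ^+ n = 1 - th ^+ K.
  elim: K => [|K IH]; first by rewrite big_geq // mulr0 expr0 subrr.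
  by rewrite big_nat_recr //= mulrDr IH exprS; ring.
by rewrite gerBl exprn_ge0.
Qed.

Lemma poly_geometric_sum_le (p th : R) : 0 < p -> 0 < th -> th < 1 ->
  exists2 C, 0 <= C & forall K, \sum_(0 <= n < K) (n.+1%:R ^+ 2) `^ p * th ^+ n <= C.
Proof.
move=> p0 th0 th1.
(* With this y the factor y^(2pn) is th^(-n/2): the polynomial may use up half of the decay. *)
pose y := th `^ (- (4 * p)^-1); have p40 : 0 < 4 * p by rewrite mulr_gt0.
have y1 : 1 < y.
  have : th `^ (4 * p)^-1 < 1 `^ (4 * p)^-1.
    by apply: gt0_ltr_powR; rewrite ?nnegrE ?invr_gt0 // ltW.
  by rewrite powR1 /y powRN invf_gt1 ?powR_gt0.
have y0 : 0 < y := lt_trans ltr01 y1.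
(* Bernoulli's inequality bounds 1 + n eta by y^n, and eta <= 1 gives (n + 1) eta <= 1 + n eta. *)
pose eta := Num.min (y - 1) 1; have eta0 : 0 < eta by rewrite lt_min ltr01 subr_gt0 y1.
have ny n : n.+1%:R <= eta^-1 * y ^+ n.
  rewrite ler_pdivlMl //; apply: (@le_trans _ _ (1 + n%:R * eta)).
    rewrite -natr1 mulrDr mulr1 addrC lerD //; first by rewrite ge_min lexx orbT.
    by rewrite mulrC.
  elim: n => [|n IH]; first by rewrite mul0r addr0 expr0.
  have : (1 + n%:R * eta) * (1 + eta) <= y ^+ n * y.
    apply: ler_pM => //; rewrite ?addr_ge0 ?mulr_ge0 ?(ltW eta0) //.
    have : eta <= y - 1 by rewrite ge_min lexx.
    lra.
  rewrite -exprSr; apply: le_trans; rewrite -natr1.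
  have : 0 <= n%:R * eta * eta by rewrite mulr_ge0 ?mulr_ge0 ?(ltW eta0).
  lra.
pose th' := th `^ 2^-1.
have th'0 : 0 <= th' by exact: powR_ge0.
have th'1 : th' < 1.
  have : th `^ 2^-1 < 1 `^ 2^-1.
    by apply: gt0_ltr_powR; rewrite ?nnegrE ?invr_gt0 // ltW.
  by rewrite powR1.
exists ((eta^-1 ^+ 2) `^ p * (1 - th')^-1).
  by rewrite mulr_ge0 ?powR_ge0 // invr_ge0 subr_ge0 ltW.
move=> K; apply: (@le_trans _ _ (\sum_(0 <= n < K) (eta^-1 ^+ 2) `^ p * th' ^+ n)); last first.
  by rewrite -mulr_sumr ler_wpM2l ?powR_ge0 // geometric_sum_le.
apply: ler_sum => n _.
have -> : th' ^+ n = ((y ^+ n) ^+ 2) `^ p * th ^+ n.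
  have -> : (y ^+ n) ^+ 2 = y `^ (n%:R * 2).
    by rewrite powRrM -[X in _ `^ X]/(2%:R) powR_mulrn ?powR_ge0 // powR_mulrn // ltW.
  rewrite -[th ^+ n]powR_mulrn ?(ltW th0) // -[th' ^+ n]powR_mulrn // /th' /y -!powRrM.
  rewrite -powRD; last by apply/implyP => _; rewrite gt_eqF.
  by congr (_ `^ _); field; rewrite gt_eqF.
rewrite mulrA ler_wpM2r ?exprn_ge0 ?(ltW th0) // -powRM ?sqr_ge0 // -exprMn.
apply: ge0_ler_powR; rewrite ?nnegrE ?sqr_ge0 ?(ltW p0) // lerXn2r ?nnegrE //.
by rewrite mulr_ge0 ?invr_ge0 ?exprn_ge0 // ltW.
Qed.

Lemma near_scaled (c M : R) : 0 < c -> \forall t \near +oo, M <= c * t.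
Proof.
move=> c0; near=> t; rewrite -ler_pdivrMl //; near: t.
Unshelve. all: by end_near. Qed.

Lemma powR_dominated (k D eps : R) (c : R) : 0 < k -> 0 <= D -> 0 < eps -> 0 < c ->
  \forall t \near +oo, D * (c * t) `^ (- k) <= eps.
Proof.
move=> k0 D0 eps0 c0; have D1 : 0 < D + 1 by lra.
have h := near_scaled (((D + 1) / eps) `^ k^-1) c0.
near=> t; have ht : ((D + 1) / eps) `^ k^-1 <= c * t by near: t.
have u0 : 0 < ((D + 1) / eps) `^ k^-1 by rewrite powR_gt0 // divr_gt0.
have s0 : 0 < c * t := lt_le_trans u0 ht.
have : ((D + 1) / eps) `^ k^-1 `^ k <= (c * t) `^ k.
  by apply: ge0_ler_powR; rewrite ?nnegrE ?(ltW k0) ?(ltW u0) ?(ltW s0).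
rewrite -powRrM mulVf ?gt_eqF // powRr1 ?divr_ge0 ?(ltW D1) ?(ltW eps0) //.
rewrite ler_pdivrMr // powRN => h2.
rewrite ler_pdivrMr ?powR_gt0 // mulrC; apply: le_trans h2; lra.
Unshelve. all: by end_near. Qed.

End PolyGeometric.

Section Profiles.
Variables (R : realType) (q : nat).
Hypothesis q_gt1 : (1 < q)%N.

Let r : R := Num.sqrt q%:R.
Let c0 : R := r / q.+1%:R.
Let be : R := 1 + 2 * c0.
Let cc : R := (q%:R + 1) / (q%:R - 1).
Let E t : R := expR (- (be * t)).
Local Notation h := (heat_profile (R := R) q).
Local Notation B := (bessel (R := R)).
Local Notation J := (tree_bessel (R := R) q).

Let q_gt0 : 0 < q%:R :> R. Proof. by rewrite ltr0n ltnW. Qed.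
Let r_gt0 : 0 < r. Proof. by rewrite sqrtr_gt0. Qed.
Let rr : r * r = q%:R. Proof. by rewrite -expr2 sqr_sqrtr. Qed.
Let r_ge1 : 1 <= r.
Proof. by rewrite -sqrtr1 ler_wsqrtr // ler1n ltnW. Qed.
Let qrE n : (q ^ n)%:R = r ^+ n * r ^+ n :> R. Proof. by rewrite natrX -exprMn rr. Qed.
Let c0_gt0 : 0 < c0. Proof. by rewrite divr_gt0. Qed.
Let E_gt0 t : 0 < E t. Proof. exact: expR_gt0. Qed.
Let cc_ge1 : 1 <= cc. Proof. exact: (critical_shift_ge1 q_gt1 (erefl cc)). Qed.
Let cc_gt0 : 0 < cc. Proof. exact: lt_le_trans cc_ge1. Qed.

(** The p-th power of the l^p norm of h_t up to a factor 2, with q^n in place of the sphere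
    sizes. *)
Definition energy (p t : R) : R := limn (series (fun n => (q ^ n)%:R * h t n `^ p)).

Lemma heat_profile_ge0 t n : 0 <= t -> 0 <= h t n.
Proof.
move=> t0; rewrite mulr_ge0 ?expR_ge0 // mulr_ge0 ?invr_ge0 ?exprn_ge0 ?(ltW r_gt0) //.
by apply: tree_bessel_ge0; rewrite // mulr_ge0 // ltW.
Qed.

Lemma heat_profile0_gt0 t : 0 <= t -> 0 < h t 0.
Proof.
move=> t0; rewrite mulr_gt0 ?expR_gt0 // expr0 invr1 mul1r.
by rewrite (lt_le_trans ltr01) // tree_bessel0_ge1 // mulr_ge0 // ltW.
Qed.

Lemma energy_summand_bounded p t : 1 <= p -> 0 <= t ->
  exists M, forall K, \sum_(0 <= n < K) (q ^ n)%:R * h t n `^ p <= M.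
Proof.
move=> p1 t0; have s0 : 0 <= c0 * t by rewrite mulr_ge0 // ltW.
(* The rate 2q beats the growth q^n of the spheres and leaves 2^(-n). *)
have q2 : 1 <= 2 * q%:R :> R by rewrite -natrM ler1n; lia.
have [C C0 BC] := bessel_decay s0 q2.
exists ((E t * C) `^ p * (1 - 2^-1)^-1) => K.
apply: (@le_trans _ _ (\sum_(0 <= n < K) (E t * C) `^ p * 2^-1 ^+ n)); last first.
  by rewrite -mulr_sumr ler_wpM2l ?powR_ge0 // geometric_sum_le ?invr_ge0 //; lra.
apply: ler_sum => n _.
have z0 : 0 < (2 * q%:R) ^- n :> R by rewrite invr_gt0 exprn_gt0 // mulr_gt0.
have hC : h t n <= E t * C * (2 * q%:R) ^- n.
  rewrite /heat_profile -/(E t) -[E t * C * _]mulrA ler_wpM2l ?expR_ge0 //.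
  apply: le_trans (BC n); apply: le_trans (tree_bessel_le q_gt1 n s0).
  rewrite ler_piMl ?tree_bessel_ge0 // invf_le1 ?exprn_gt0 //; exact: exprn_ege1.
have EC0 : 0 <= E t * C by rewrite mulr_ge0 // expR_ge0.
apply: (@le_trans _ _ ((q ^ n)%:R * ((E t * C) `^ p * (2 * q%:R) ^- n))).
  rewrite ler_wpM2l //; apply: (@le_trans _ _ ((E t * C * (2 * q%:R) ^- n) `^ p)).
    apply: ge0_ler_powR; rewrite ?nnegrE ?heat_profile_ge0 ?mulr_ge0 ?(ltW z0) ?(ltW (E_gt0 t)) //.
    exact: le_trans p1.
  rewrite powRM ?(ltW z0) // ler_wpM2l ?powR_ge0 //.
  apply: ge1r_powR => //; rewrite z0 invf_le1 ?exprn_ege1 //.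
  by rewrite exprn_gt0 // mulr_gt0.
rewrite mulrCA ler_wpM2l ?powR_ge0 // natrX le_eqVlt; apply/orP; left; apply/eqP.
by rewrite exprMn exprVn; field; rewrite !expf_neq0 // gt_eqF.
Qed.

Lemma energy_ge_partial p t K : 1 <= p -> 0 <= t ->
  \sum_(0 <= n < K) (q ^ n)%:R * h t n `^ p <= energy p t.
Proof.
move=> p1 t0; have [M hM] := energy_summand_bounded p1 t0.
have pos n : 0 <= (q ^ n)%:R * h t n `^ p by rewrite mulr_ge0 // powR_ge0.
apply: (@nondecreasing_cvgn_le _ (series (fun n => (q ^ n)%:R * h t n `^ p))).
  by apply: nondecreasing_series => n _ _; exact: pos.
apply: nondecreasing_is_cvgn.
  by apply: nondecreasing_series => n _ _; exact: pos.
by exists M => _ [n _ <-]; exact: hM.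
Qed.

Lemma energy_le p t M : 1 <= p -> 0 <= t ->
  (forall K, \sum_(0 <= n < K) (q ^ n)%:R * h t n `^ p <= M) -> energy p t <= M.
Proof.
move=> p1 t0 hM; have pos n : 0 <= (q ^ n)%:R * h t n `^ p by rewrite mulr_ge0 // powR_ge0.
apply: limr_le; last exact: nearW.
apply: nondecreasing_is_cvgn.
  by apply: nondecreasing_series => n _ _; exact: pos.
by exists M => _ [n _ <-]; exact: hM.
Qed.

Lemma energy_gt0 p t : 1 <= p -> 0 <= t -> 0 < energy p t.
Proof.
move=> p1 t0; apply: lt_le_trans (energy_ge_partial 1 p1 t0).
by rewrite big_nat1 expn0 mul1r powR_gt0 // heat_profile0_gt0.
Qed.

Lemma powR_inv (s k : R) : 0 < s -> s^-1 `^ k = s `^ (- k).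
Proof. by move=> s0; rewrite -powR_inv1 ?(ltW s0) // -powRrM mulN1r. Qed.

(* A is the mass of the tilted profile x ^ k * bessel s k, with s = c0 * t. The lower
   bound on the norm only uses that most of A sits on an interval of length O(s);
   the variation is smaller by the factor s ^ (- (1 - p / 2)), which tends to 0 for
   p < 2. *)
Lemma tilted_asymptotics (p x : R) : 1 <= p -> 1 < x ->
  let g t n := x ^+ n * J (c0 * t) n in exists C k D : R, [/\ 0 <= C, 0 < k, 0 <= D &
  \forall t \near +oo, exists2 A : R, 0 < A & [/\
    forall K, \sum_(0 <= n < K) `|g t n - g t n.+1| `^ p <= C * (A `^ p * (c0 * t) `^ (- (p / 2))),
    exists K, k * (A `^ p * (c0 * t) `^ (- (p - 1))) <= \sum_(0 <= n < K) g t n `^ p &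
    forall n, g t n <= x ^+ n * (D * (A / (c0 * t)))]].
Proof.
move=> p_ge1 x_gt1 g; have x_gt0 : 0 < x := lt_trans ltr01 x_gt1.
pose v := x - x^-1; pose c := x + x^-1; pose b := x ^- 2.
have b_lt1 : b < 1 by rewrite /b invf_lt1 ?exprn_gt0 // exprn_egt1.
have b_gt0 : 0 < b by rewrite invr_gt0 exprn_gt0.
have v_gt0 : 0 < v by rewrite subr_gt0 (lt_trans _ x_gt1) // invf_lt1.
have c_gt0 : 0 < c by rewrite addr_gt0 ?invr_gt0.
have bq : b / q%:R < 1.
  by apply: le_lt_trans b_lt1; rewrite ler_pdivrMr // ler_peMr ?(ltW b_gt0) // ler1n ltnW.
pose C1 := (c + 1) / 2 / (x * (1 - b)).
have C1_gt0 : 0 < C1.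
  rewrite /C1; apply: divr_gt0; first by apply: divr_gt0 => //; apply: addr_gt0.
  by rewrite mulr_gt0 // subr_gt0.
pose C2 := (1 + b) / (1 - b / q%:R).
have C2_gt0 : 0 < C2 by rewrite divr_gt0 ?subr_gt0 // addr_gt0.
pose k1 := (1 - b) / 4; have k1_gt0 : 0 < k1 by rewrite divr_gt0 ?subr_gt0.
pose C3 := 2 * v + 1; have C3_gt0 : 0 < C3 by rewrite addr_gt0 ?mulr_gt0.
exists (C2 * C1 `^ p), (k1 * (k1 / C3) `^ (p - 1)), (c / v ^+ 2); split.
- by rewrite mulr_ge0 ?powR_ge0 // ltW.
- by rewrite mulr_gt0 // powR_gt0 // divr_gt0.
- by rewrite divr_ge0 ?sqr_ge0 // ltW.
have hs1 := @near_scaled R c0 1 c0_gt0.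
have hs2 := @near_scaled R c0 (c / v ^+ 2 / ((1 - b) / 2)) c0_gt0.
near=> t.
have s1 : 1 <= c0 * t by near: t.
have s2 : c / v ^+ 2 / ((1 - b) / 2) <= c0 * t by near: t.
move: s1 s2; set s := c0 * t => s1 s2.
have s_gt0 : 0 < s := lt_le_trans ltr01 s1.
have s_ge0 := ltW s_gt0.
pose A := limn (series (fun k => x ^+ k * B s k)).
have A_gt0 : 0 < A by exact: (tilt_mass_gt0 s_gt0 x_gt1).
exists A => //; split.
- move=> K; have := tilted_powR_variation s_gt0 x_gt1 q_gt1 K p_ge1.
  rewrite -/b -/c -/A -/C1 -/C2 => h1; apply: le_trans h1 _.
  have -> : (C1 * (A / Num.sqrt s)) `^ p = C1 `^ p * (A `^ p * s `^ (- (p / 2))).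
    have q1 : 0 <= A / Num.sqrt s by rewrite divr_ge0 ?sqrtr_ge0 // ltW.
    have q2 : 0 <= (Num.sqrt s)^-1 by rewrite invr_ge0 sqrtr_ge0.
    rewrite (powRM p (ltW C1_gt0) q1) (powRM p (ltW A_gt0) q2).
    rewrite powR_inv ?sqrtr_gt0 // -powR12_sqrt // -powRrM.
    by rewrite (_ : 2^-1 * - p = - (p / 2)) //; ring.
  by rewrite [leLHS]mulrA.
- have vs0 : 0 <= 2 * v * s by rewrite !mulr_ge0 // ltW.
  pose K0 := (Num.truncn (2 * v * s)).+1.
  have K0ge : 2 * v * s <= K0%:R by rewrite ltW // truncnS_gt.
  have K0le : K0%:R <= C3 * s.
    have tl : (Num.truncn (2 * v * s))%:R <= 2 * v * s by rewrite truncn_le.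
    have -> : K0%:R = (Num.truncn (2 * v * s))%:R + 1 :> R by rewrite natr1.
    rewrite /C3; lra.
  have sb : c / v ^+ 2 / s <= (1 - b) / 2.
    have d0 : 0 < (1 - b) / 2 by rewrite divr_gt0 ?subr_gt0.
    by move: s2; rewrite ler_pdivrMr // [in X in _ -> X]ler_pdivrMr // [s * _]mulrC.
  exists K0.
  have := tilted_powR_mass s_gt0 x_gt1 q_gt1 p_ge1 (isT : (0 < K0)%N) K0ge sb.
  rewrite -/b -/A -/k1; apply: le_trans.
  have -> : k1 * (k1 / C3) `^ (p - 1) * (A `^ p * s `^ (- (p - 1))) =
     (k1 * (A / (C3 * s))) `^ (p - 1) * (k1 * A).
    have -> : k1 * (A / (C3 * s)) = (k1 / C3) * A * s^-1 by field; rewrite !gt_eqF.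
    have kC : 0 <= k1 / C3 := divr_ge0 (ltW k1_gt0) (ltW C3_gt0).
    have sV : 0 <= s^-1 by rewrite invr_ge0.
    rewrite (powRM _ (mulr_ge0 kC (ltW A_gt0)) sV) (powRM _ kC (ltW A_gt0)).
    by rewrite powR_inv // [A `^ p]powR_succr //; ring.
  rewrite ler_wpM2r ?(mulr_ge0 (ltW k1_gt0) (ltW A_gt0)) //.
  have K00 : 0 < K0%:R :> R by rewrite ltr0Sn.
  have n1 := mulr_ge0 (ltW k1_gt0) (divr_ge0 (ltW A_gt0) (ltW (mulr_gt0 C3_gt0 s_gt0))).
  have n2 := mulr_ge0 (ltW k1_gt0) (divr_ge0 (ltW A_gt0) (ltW K00)).
  apply: ge0_ler_powR; rewrite ?nnegrE ?subr_ge0 //.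
  by rewrite ler_wpM2l ?(ltW k1_gt0) // ler_wpM2l ?(ltW A_gt0) // lef_pV2 ?posrE ?mulr_gt0.
- move=> n; exact: (tilted_head s_gt0 x_gt1 q_gt1).
Unshelve. all: by end_near. Qed.

Section Subcritical.
Variable p : R.
Hypotheses (p_ge1 : 1 <= p) (p_lt2 : p < 2).

Definition subcritical_rate : R := q%:R `^ (- p^-1).
Let al := subcritical_rate.
(** The tilt q^(1/p - 1/2), that is q^(delta_p), which exceeds 1 because p < 2. *)
Let x := (al * r)^-1.
Let g t n := x ^+ n * J (c0 * t) n.

Let p_gt0 : 0 < p. Proof. exact: lt_le_trans p_ge1. Qed.

Lemma subcritical_rate_gt0 : 0 < al. Proof. exact: powR_gt0. Qed.
Let al_gt0 := subcritical_rate_gt0.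

Lemma subcritical_rate_powR : al `^ p = q%:R^-1.
Proof. by rewrite /al /subcritical_rate -powRrM mulNr mulVf ?gt_eqF // powR_inv1 // ltW. Qed.

Lemma subcritical_rate_le1 : al <= 1.
Proof.
rewrite /al /subcritical_rate powRN invf_le1 ?powR_gt0 //.
have q1 : 1 <= q%:R :> R by rewrite ler1n ltnW.
have pV : 0 <= p^-1 by rewrite invr_ge0 ltW.
by have := ler_powR q1 pV; rewrite powRr0.
Qed.

Let x_gt1 : 1 < x.
Proof.
rewrite /x invf_gt1 ?mulr_gt0 // /al /subcritical_rate /r -powR12_sqrt ?(ltW q_gt0) //.
rewrite -powRD; last by apply/implyP => _; rewrite gt_eqF.
have : q%:R `^ (- (p^-1 - 2^-1)) < 1 :> R.
  rewrite powRN invf_lt1 ?powR_gt0 //.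
  have k0 : 0 < p^-1 - 2^-1 by rewrite subr_gt0 ltf_pV2 ?posrE.
  have : 1 `^ (p^-1 - 2^-1) < q%:R `^ (p^-1 - 2^-1) :> R.
    by apply: gt0_ltr_powR; rewrite ?nnegrE ?ltr1n ?(ltW q_gt0).
  by rewrite powR1.
by rewrite opprB addrC.
Qed.
Let x_gt0 : 0 < x. Proof. exact: lt_trans x_gt1. Qed.

Lemma heat_profile_tilt t n : h t n = E t * al ^+ n * g t n.
Proof.
rewrite /heat_profile -/(E t) /g /x exprVn exprMn; field.
by rewrite !expf_neq0 // gt_eqF.
Qed.

Lemma subcritical_weight n : (q ^ n)%:R * (al ^+ n) `^ p = 1.
Proof.
rewrite -powR_mulrn ?(ltW al_gt0) // -powRrM [n%:R * p]mulrC powRrM subcritical_rate_powR.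
rewrite powR_mulrn ?invr_ge0 ?(ltW q_gt0) // natrX exprVn mulfV //.
by rewrite expf_neq0 // gt_eqF.
Qed.

Let g_ge0 t n : 0 <= t -> 0 <= g t n.
Proof.
move=> t0; rewrite mulr_ge0 ?exprn_ge0 ?(ltW x_gt0) // tree_bessel_ge0 //.
by rewrite mulr_ge0 // ltW.
Qed.

(** As al^p = 1/q cancels the growth of the spheres, the l^p norm on the tree becomes an l^p norm of
    g on the half-line. *)
Lemma subcritical_energy_term t n : 0 <= t ->
  (q ^ n)%:R * h t n `^ p = E t `^ p * g t n `^ p.
Proof.
move=> t0; rewrite heat_profile_tilt.
have a0 : 0 <= al ^+ n by rewrite exprn_ge0 // ltW.
rewrite (powRM _ (mulr_ge0 (ltW (E_gt0 t)) a0) (g_ge0 n t0)) (powRM _ (ltW (E_gt0 t)) a0).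
transitivity ((q ^ n)%:R * (al ^+ n) `^ p * (E t `^ p * g t n `^ p)); first by ring.
by rewrite subcritical_weight mul1r.
Qed.

(** X is the lower bound for the energy, of order s^(-(p-1)) relative to A^p. The variation has
    order s^(-p/2) and a fixed level s^(-p), so the gains are s^(-(1-p/2)) and s^(-1). *)
Lemma subcritical_asymptotics : exists C D : R, [/\ 0 <= C, 0 <= D &
  \forall t \near +oo, exists X : R, [/\ 0 <= X, X <= energy p t,
    forall K, \sum_(0 <= n < K) (q ^ n)%:R * ((al ^+ n) `^ p *
      `|h t n.+1 / al ^+ n.+1 - h t n / al ^+ n| `^ p) <= C * (c0 * t) `^ (- (1 - p / 2)) * X &
    forall n, h t n `^ p <= (x ^+ n) `^ p * D * (c0 * t) `^ (- 1) * X]].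
Proof.
have [C [k [D [C0 k0 D0 hA]]]] := tilted_asymptotics p_ge1 x_gt1.
have h1 := near_scaled 1 c0_gt0.
exists (C / k), (D `^ p / k); split; rewrite ?divr_ge0 ?powR_ge0 // ?ltW //.
near=> t; have s1 : 1 <= c0 * t by near: t.
have [A A0 [hD [K0 hK0] hg]] : exists2 A : R, 0 < A & [/\
    forall K, \sum_(0 <= n < K) `|g t n - g t n.+1| `^ p <= C * (A `^ p * (c0 * t) `^ (- (p / 2))),
    exists K, k * (A `^ p * (c0 * t) `^ (- (p - 1))) <= \sum_(0 <= n < K) g t n `^ p &
    forall n, g t n <= x ^+ n * (D * (A / (c0 * t)))] by near: t.
have s0 : 0 < c0 * t := lt_le_trans ltr01 s1.
have t0 : 0 <= t by rewrite -(pmulr_rge0 _ c0_gt0) ltW.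
have Ep : 0 < E t `^ p by rewrite powR_gt0.
have sE u v : (c0 * t) `^ (u + v) = (c0 * t) `^ u * (c0 * t) `^ v.
  by rewrite powRD //; apply/implyP => _; rewrite gt_eqF.
exists (E t `^ p * (k * (A `^ p * (c0 * t) `^ (- (p - 1))))); split.
- by rewrite !mulr_ge0 ?powR_ge0 // ltW.
- apply: le_trans (energy_ge_partial K0 p_ge1 t0).
  under eq_bigr do rewrite subcritical_energy_term //.
  by rewrite -mulr_sumr ler_wpM2l // ltW.
- move=> K; have rhoE n : h t n / al ^+ n = E t * g t n.
    by rewrite heat_profile_tilt; field; rewrite expf_neq0 // gt_eqF.
  apply: (@le_trans _ _ (E t `^ p * (C * (A `^ p * (c0 * t) `^ (- (p / 2)))))).
    apply: le_trans (ler_wpM2l (ltW Ep) (hD K)); rewrite mulr_sumr; apply: ler_sum => n _.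
    rewrite mulrA subcritical_weight mul1r !rhoE -mulrBr normrM (gtr0_norm (E_gt0 t)).
    by rewrite (powRM _ (ltW (E_gt0 t))) // distrC.
  have -> : (c0 * t) `^ (- (p / 2)) = (c0 * t) `^ (- (1 - p / 2)) * (c0 * t) `^ (- (p - 1)).
    by rewrite -sE; congr (_ `^ _); lra.
  by rewrite le_eqVlt; apply/orP; left; apply/eqP; field; rewrite gt_eqF.
move=> n; have xn : 0 <= x ^+ n by rewrite exprn_ge0 // ltW.
have sV : 0 <= (c0 * t)^-1 by rewrite invr_ge0 ltW.
have As : 0 <= A / (c0 * t) := mulr_ge0 (ltW A0) sV.
have DA := mulr_ge0 D0 As; have xDA := mulr_ge0 xn DA.
apply: (@le_trans _ _ ((E t * (x ^+ n * (D * (A / (c0 * t))))) `^ p)).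
  have u0 := mulr_ge0 (ltW (E_gt0 t)) xDA.
  apply: ge0_ler_powR; rewrite ?nnegrE ?heat_profile_ge0 ?(ltW p_gt0) //.
  rewrite heat_profile_tilt -mulrA ler_wpM2l ?(ltW (E_gt0 t)) //.
  apply: le_trans (hg n); rewrite ler_piMl ?g_ge0 // exprn_ile1 ?(ltW al_gt0) //.
  exact: subcritical_rate_le1.
rewrite (powRM _ (ltW (E_gt0 t)) xDA) (powRM _ xn DA) (powRM _ D0 As) (powRM _ (ltW A0) sV).
have -> : (c0 * t)^-1 `^ p = (c0 * t) `^ (- 1) * (c0 * t) `^ (- (p - 1)).
  by rewrite powR_inv // -sE; congr (_ `^ _); lra.
by rewrite le_eqVlt; apply/orP; left; apply/eqP; field; rewrite gt_eqF.
Unshelve. all: by end_near. Qed.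

Lemma subcritical_variation eps : 0 < eps -> \forall t \near +oo, forall K,
  \sum_(0 <= n < K) (q ^ n)%:R *
     ((al ^+ n) `^ p * `|h t n.+1 / al ^+ n.+1 - h t n / al ^+ n| `^ p) <= eps * energy p t.
Proof.
move=> eps0; have [C [D [C0 _]]] := subcritical_asymptotics.
have kk : 0 < 1 - p / 2 by rewrite subr_gt0 ltr_pdivrMr // mul1r.
apply: filterS2 (powR_dominated kk C0 eps0 c0_gt0) => t hd [X [X0 XE hX _]] K.
by apply: le_trans (hX K) _; apply: ler_pM => //; rewrite mulr_ge0 ?powR_ge0.
Qed.

Lemma subcritical_pointwise n eps : 0 < eps ->
  \forall t \near +oo, h t n `^ p <= eps * energy p t.
Proof.
move=> eps0; have [C [D [_ D0]]] := subcritical_asymptotics.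
have D1 : 0 <= (x ^+ n) `^ p * D by rewrite mulr_ge0 ?powR_ge0.
apply: filterS2 (powR_dominated ltr01 D1 eps0 c0_gt0) => t hd [X [X0 XE _ hX]].
by apply: le_trans (hX n) _; apply: ler_pM => //; apply: mulr_ge0; rewrite ?powR_ge0.
Qed.

End Subcritical.

(** The spherical function phi_0 of the distance: 1 / cc = (q - 1) / (q + 1) and r^(-n) =
    q^(-n/2). *)
Definition ground_profile (n : nat) : R := (1 + n%:R / cc) * r ^- n.

Lemma ground_profile_gt0 n : 0 < ground_profile n.
Proof. by rewrite mulr_gt0 ?invr_gt0 ?exprn_gt0 // ltr_wpDr // divr_ge0 // ltW. Qed.

Let cc_ratio t n : h t n / ground_profile n = E t * cc * (J (c0 * t) n / (n%:R + cc)).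
Proof.
rewrite /heat_profile /ground_profile -/(E t); field.
have n0 : n%:R + cc != 0 by rewrite gt_eqF // ltr_wpDl.
by rewrite n0 (gt_eqF cc_gt0) andbT expf_neq0 // (gt_eqF r_gt0).
Qed.

Let ground_le n : ground_profile n <= n.+1%:R * r ^- n.
Proof.
rewrite ler_wpM2r ?invr_ge0 ?exprn_ge0 ?(ltW r_gt0) // -[n.+1%:R]natr1 addrC lerD2r.
by rewrite ler_pdivrMr // ler_peMr.
Qed.

(** Since q^n phi_0(n)^2 <= (n+1)^2, [critical_square_variation] applies, and its factor 1/s is
    eventually below eps; M collects the constants. *)
Lemma critical_variation eps : 0 < eps -> \forall t \near +oo, forall K,
  \sum_(0 <= n < K) (q ^ n)%:R * (ground_profile n `^ 2 *
     `|h t n.+1 / ground_profile n.+1 - h t n / ground_profile n| `^ 2) <= eps * energy 2 t.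
Proof.
move=> eps0; pose M := (40 * 10 ^+ 2) ^+ 2 * 148 * cc ^+ 2 / eps : R.
have hs1 := near_scaled 1 c0_gt0; have hs2 := near_scaled M c0_gt0.
near=> t.
have s1 : 1 <= c0 * t by near: t.
have s2 : M <= c0 * t by near: t.
move=> K; have s0 : 0 < c0 * t := lt_le_trans ltr01 s1.
have t0 : 0 <= t by rewrite -(pmulr_rge0 _ c0_gt0) ltW.
have s_ge0 := ltW s0; have E0 := E_gt0 t.
have en : E t ^+ 2 * \sum_(0 <= n < K.+1) J (c0 * t) n ^+ 2 <= energy 2 t.
  have p12 : 1 <= 2 :> R by rewrite ler1n.
  apply: le_trans (energy_ge_partial K.+1 p12 t0); rewrite mulr_sumr; apply: ler_sum => n _.
  rewrite powR_mulrn ?heat_profile_ge0 // /heat_profile -/(E t) qrE -/r -/c0.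
  have rn0 : r ^+ n != 0 by rewrite expf_neq0 // gt_eqF.
  rewrite le_eqVlt; apply/orP; left; apply/eqP.
  by move: (r ^+ n) rn0 => u u0; field.
have hv := critical_square_variation s1 q_gt1 (erefl cc) (erefl _) K.
apply: (@le_trans _ _ (E t ^+ 2 * cc ^+ 2 * ((40 * 10 ^+ 2) ^+ 2 * 148 / (c0 * t) *
    \sum_(0 <= n < K.+1) J (c0 * t) n ^+ 2))).
  apply: le_trans (ler_wpM2l _ hv); last by rewrite mulr_ge0 ?sqr_ge0.
  rewrite mulr_sumr; apply: ler_sum => n _.
  rewrite !cc_ratio -mulrBr [`|_| `^ 2]powR_mulrn // real_normK ?num_real //.
  rewrite [_ `^ 2]powR_mulrn ?(ltW (ground_profile_gt0 n)) // [(E t * cc * _) ^+ 2]exprMn.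
  set dJ := (_ - _) ^+ 2; rewrite [leRHS]mulrCA mulrA [(E t * cc) ^+ 2]exprMn.
  have X0 : 0 <= E t ^+ 2 * cc ^+ 2 * dJ by apply: mulr_ge0; [apply: mulr_ge0|]; exact: sqr_ge0.
  rewrite (ler_wpM2r X0) //.
  apply: (@le_trans _ _ ((q ^ n)%:R * (n.+1%:R * r ^- n) ^+ 2)).
    have gp0 := ltW (ground_profile_gt0 n).
    by rewrite ler_wpM2l // lerXn2r ?nnegrE ?gp0 ?ground_le // (le_trans gp0) ?ground_le.
  have rn0 : r ^+ n != 0 by rewrite expf_neq0 // gt_eqF.
  rewrite qrE le_eqVlt; apply/orP; left; apply/eqP.
  by move: (r ^+ n) rn0 => u u0; field.
apply: le_trans (_ : eps * (E t ^+ 2 * \sum_(0 <= n < K.+1) J (c0 * t) n ^+ 2) <= _); last first.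
  by rewrite ler_wpM2l // ltW.
have S0 : 0 <= E t ^+ 2 * \sum_(0 <= n < K.+1) J (c0 * t) n ^+ 2.
  by rewrite mulr_ge0 ?sqr_ge0 // sumr_ge0 // => n _; exact: sqr_ge0.
have hM : (40 * 10 ^+ 2) ^+ 2 * 148 * cc ^+ 2 / (c0 * t) <= eps.
  by move: s2; rewrite /M ler_pdivrMr // => s2; rewrite ler_pdivrMr // [eps * _]mulrC.
have := ler_wpM2r S0 hM; apply: le_trans.
rewrite le_eqVlt; apply/orP; left; apply/eqP; ring.
Unshelve. all: by end_near. Qed.

Section Supercritical.
Variable p : R.
Hypothesis p_gt2 : 2 < p.

Let p_ge1 : 1 <= p. Proof. by apply: le_trans (ltW p_gt2); rewrite ler1n. Qed.
Let p_gt0 : 0 < p. Proof. exact: lt_le_trans p_ge1. Qed.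
(** This is q^(1 - p/2), the rate of q^n phi_0(n)^p up to a polynomial factor; it is below 1 because
    p > 2. *)
Let th := r `^ (2 - p).

Let th_gt0 : 0 < th. Proof. exact: powR_gt0. Qed.
Let th_lt1 : th < 1.
Proof.
have r1 : 1 < r by rewrite -sqrtr1 ltr_sqrt // ltr1n.
rewrite /th -(opprB p 2) powRN invf_lt1 ?powR_gt0 //.
have : 1 `^ (p - 2) < r `^ (p - 2).
  by apply: gt0_ltr_powR; rewrite ?nnegrE ?(ltW r_gt0) // subr_gt0.
by rewrite powR1.
Qed.

Lemma ground_weight n : (q ^ n)%:R * ground_profile n `^ p <= n.+1%:R `^ p * th ^+ n.
Proof.
have rn : 0 < r ^+ n by rewrite exprn_gt0.
apply: (@le_trans _ _ ((q ^ n)%:R * (n.+1%:R * r ^- n) `^ p)).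
  have gp0 := ltW (ground_profile_gt0 n).
  rewrite ler_wpM2l //; apply: ge0_ler_powR; rewrite ?nnegrE ?(ltW p_gt0) ?gp0 ?ground_le //.
  by rewrite (le_trans gp0) ?ground_le.
have rV : 0 <= r ^- n by rewrite invr_ge0 ltW.
rewrite (powRM _ (ler0n _ _) rV) mulrCA ler_wpM2l ?powR_ge0 //.
rewrite powR_inv // qrE -[th ^+ n]powR_mulrn ?(ltW th_gt0) // /th -powRrM.
rewrite -[r ^+ n]powR_mulrn ?(ltW r_gt0) // -powRrM.
rewrite -powRD; last by apply/implyP => _; rewrite gt_eqF.
rewrite -powRD; last by apply/implyP => _; rewrite gt_eqF.
by rewrite le_eqVlt; apply/orP; left; apply/eqP; congr (_ `^ _); ring.
Qed.

Lemma ground_sum_bounded : exists2 C, 0 <= C &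
  forall K, \sum_(0 <= n < K) (q ^ n)%:R * ground_profile n `^ p <= C.
Proof.
have [C C0 hC] := poly_geometric_sum_le p_gt0 th_gt0 th_lt1.
exists C => // K; apply: le_trans (hC K); apply: ler_sum => n _.
apply: le_trans (ground_weight n) _; rewrite ler_wpM2r ?exprn_ge0 ?(ltW th_gt0) //.
apply: ge0_ler_powR; rewrite ?nnegrE ?sqr_ge0 ?(ltW p_gt0) //.
by rewrite expr2 ler_peMr // ler1n.
Qed.

(** With phi_0 in l^p, pointwise bounds suffice: an increment of h_t / phi_0 is at most Y Z (n+1),
    where Y <= h_t(o) and Z = N / s tends to 0. The constant N is the product of those in
    [critical_ratio_step] and [critical_ratio0_ge]. *)
Lemma supercritical_variation eps : 0 < eps -> \forall t \near +oo, forall K,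
  \sum_(0 <= n < K) (q ^ n)%:R * (ground_profile n `^ p *
     `|h t n.+1 / ground_profile n.+1 - h t n / ground_profile n| `^ p) <= eps * energy p t.
Proof.
move=> eps0; have [C C0 hC] := poly_geometric_sum_le p_gt0 th_gt0 th_lt1.
have [N N0 NE] : exists2 N : R, 0 <= N & N = 240 * 10 ^+ 2.
  exists (240 * 10 ^+ 2); last by [].
  by apply: mulr_ge0; [exact: ler0n|apply: exprn_ge0; exact: ler0n].
pose D := N `^ p * C.
have D0 : 0 <= D := mulr_ge0 (powR_ge0 _ _) C0.
have hdom := powR_dominated p_gt0 D0 eps0 c0_gt0.
have hs1 := near_scaled 1 c0_gt0.
near=> t.
have s1 : 1 <= c0 * t by near: t.
have hd : D * (c0 * t) `^ (- p) <= eps by near: t.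
move=> K; have s0 : 0 < c0 * t := lt_le_trans ltr01 s1.
have t0 : 0 <= t by rewrite -(pmulr_rge0 _ c0_gt0) ltW.
have s_ge0 := ltW s0; have E0 := E_gt0 t.
have hv := critical_ratio_step s1 q_gt1 (erefl cc) (erefl _).
have h0 := critical_ratio0_ge s1 q_gt1 (erefl cc).
have B0 : 0 <= B (c0 * t) 0 := bessel_ge0 0 s_ge0.
pose Y := E t * cc * (B (c0 * t) 0 / (6 * (c0 * t))).
have Ecc : 0 < E t * cc by rewrite mulr_gt0.
have Y0 : 0 <= Y by rewrite /Y; apply: mulr_ge0; [exact: ltW|]; apply: divr_ge0 => //; apply: mulr_ge0.
have en : Y `^ p <= energy p t.
  apply: le_trans (energy_ge_partial 1 p_ge1 t0); rewrite big_nat1 expn0 mul1r.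
  apply: ge0_ler_powR; rewrite ?nnegrE ?heat_profile_ge0 ?(ltW p_gt0) //.
  have -> : h t 0 = E t * cc * (J (c0 * t) 0 / (0%:R + cc)).
    by rewrite -cc_ratio /ground_profile mul0r addr0 expr0 invr1 !mulr1 divr1.
  by rewrite /Y (ler_wpM2l (ltW Ecc)).
pose Z := N / (c0 * t).
have Z0 : 0 <= Z by rewrite /Z divr_ge0.
apply: (@le_trans _ _ (\sum_(0 <= n < K) (Y * Z) `^ p * ((n.+1%:R ^+ 2) `^ p * th ^+ n))).
  apply: ler_sum => n _; rewrite !cc_ratio -mulrBr normrM (gtr0_norm Ecc).
  set dJ := `| _ |.
  have hX : E t * cc * dJ <= Y * Z * n.+1%:R.
    have key (a1 b1 s2 m1 : R) : s2 != 0 -> a1 * (b1 / (6 * s2)) * (240 * 10 ^+ 2 / s2) * m1 =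
        a1 * (40 * 10 ^+ 2 * m1 * b1 / s2 ^+ 2) by move=> s2n0; field.
    rewrite /Y /Z NE key ?(lt0r_neq0 s0) //.
    apply: le_trans (ler_wpM2l (ltW Ecc) (hv n)) (ler_wpM2l (ltW Ecc) _).
    have k0 : 0 <= 40 * 10 ^+ 2 * n.+1%:R :> R by apply: mulr_ge0 => //; apply: mulr_ge0; rewrite ?exprn_ge0.
    by apply: ler_wpM2r; [rewrite invr_ge0 sqr_ge0|exact: ler_wpM2l k0 _ _ (le_bessel0 n s_ge0)].
  have YZ0 : 0 <= Y * Z by rewrite mulr_ge0.
  rewrite mulrA; apply: le_trans (_ : n.+1%:R `^ p * th ^+ n * ((Y * Z) `^ p * n.+1%:R `^ p) <= _).
    apply: ler_pM; rewrite ?mulr_ge0 ?powR_ge0 ?ground_weight // -powRM //.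
    have n1 : 0 <= E t * cc * dJ := mulr_ge0 (ltW Ecc) (normr_ge0 _).
    by apply: ge0_ler_powR; rewrite ?nnegrE ?n1 ?(mulr_ge0 YZ0) ?(ltW p_gt0).
  rewrite (powRM p (ler0n R n.+1) (ler0n R n.+1)).
  by rewrite le_eqVlt; apply/orP; left; apply/eqP; ring.
rewrite -mulr_sumr (powRM p Y0 Z0).
apply: (@le_trans _ _ (Y `^ p * Z `^ p * C)).
  by rewrite ler_wpM2l ?hC // mulr_ge0 ?powR_ge0.
have Zp : Z `^ p * C <= eps.
  by apply: le_trans hd; rewrite /D /Z powRM ?invr_ge0 // powR_inv // mulrAC.
apply: (@le_trans _ _ (Y `^ p * eps)); first by rewrite -mulrA ler_wpM2l ?powR_ge0.
by rewrite mulrC ler_wpM2l // ltW.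
Unshelve. all: by end_near. Qed.

Lemma supercritical_pointwise : exists2 C, 0 <= C &
  \forall t \near +oo, forall n, h t n <= C * h t 0 * ground_profile n.
Proof.
exists (150 * 10 ^+ 2) => //; have hs1 := near_scaled 1 c0_gt0.
near=> t; have s1 : 1 <= c0 * t by near: t.
move=> n; have s0 : 0 < c0 * t := lt_le_trans ltr01 s1.
have s_ge0 := ltW s0; have E0 := E_gt0 t.
have hv := critical_ratio_le s1 q_gt1 (erefl cc) (erefl _) n.
have gp0 := ground_profile_gt0 n.
rewrite -ler_pdivrMr // cc_ratio.
have -> : h t 0 = E t * cc * (J (c0 * t) 0 / (0%:R + cc)).
  by rewrite -cc_ratio /ground_profile mul0r addr0 expr0 invr1 !mulr1 divr1.
rewrite [leRHS]mulrCA; apply: ler_wpM2l hv.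
by rewrite mulr_ge0 // ltW.
Unshelve. all: by end_near. Qed.

(** For p > 2 the l^p norm has the order of h_t(o), like the sup norm. This opens the way to p =
    +oo. *)
Lemma supercritical_energy : exists2 C, 0 <= C &
  \forall t \near +oo, energy p t <= C * h t 0 `^ p.
Proof.
have [C C0 hC] := supercritical_pointwise; have [M M0 hM] := ground_sum_bounded.
exists (C `^ p * M); first by rewrite mulr_ge0 // powR_ge0.
have hs1 := near_scaled 1 c0_gt0.
near=> t; have s1 : 1 <= c0 * t by near: t.
have hCt : forall n, h t n <= C * h t 0 * ground_profile n by near: t.
have s0 : 0 < c0 * t := lt_le_trans ltr01 s1.
have t0 : 0 <= t by rewrite -(pmulr_rge0 _ c0_gt0) ltW.
apply: energy_le => // K.
apply: (@le_trans _ _ (\sum_(0 <= n < K) (C `^ p * h t 0 `^ p) * ((q ^ n)%:R * ground_profile n `^ p))).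
  apply: ler_sum => n _; rewrite [leRHS]mulrCA ler_wpM2l //.
  have gp0 := ltW (ground_profile_gt0 n).
  have hh0 := heat_profile_ge0 0 t0.
  rewrite -(powRM _ C0 hh0) -(powRM _ (mulr_ge0 C0 hh0) gp0).
  by apply: ge0_ler_powR; rewrite ?nnegrE ?heat_profile_ge0 ?(mulr_ge0 (mulr_ge0 C0 hh0) gp0) ?(ltW p_gt0).
rewrite -mulr_sumr [leRHS]mulrAC ler_wpM2l ?hM //.
by rewrite mulr_ge0 // powR_ge0.
Unshelve. all: by end_near. Qed.

End Supercritical.

End Profiles.

(** * Spherical functions *)

Section Spherical.
Variables (R : realType) (T : choiceType) (e : rel T) (q : nat).
Hypotheses (hT : homogeneous_tree e q) (q_gt1 : (1 < q)%N).
Local Notation d := (dist e).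
Local Notation S := (sphere e).
Variable o : T.

(** The radial function with adjacency eigenvalue mu and value 1 at o, as a function of the
    level. *)
Definition sphere_mean (mu : R) n : R := sphere_coef q mu n / (size (S o n))%:R.

Lemma sphere_size_gt0 n : (0 < size (S o n))%N.
Proof.
have /andP[+ _] := sphere_size_bounds hT q_gt1 o n; apply: leq_trans.
by rewrite expn_gt0 ltnW.
Qed.

Lemma sphere_coef_rmorph (K1 K2 : pzRingType) (f : {rmorphism K1 -> K2}) (mu : K1) n :
  sphere_coef q (f mu) n = f (sphere_coef q mu n).
Proof.
suff E k : sphere_coef q (f mu) k = f (sphere_coef q mu k) /\
    sphere_coef q (f mu) k.+1 = f (sphere_coef q mu k.+1) by have [] := E n.
elim: k => [|k [IH1 IH2]]; first by rewrite rmorph1.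
split=> //; rewrite -[LHS]/(f mu * sphere_coef q (f mu) k.+1 -
  (branching q k)%:R * sphere_coef q (f mu) k) IH1 IH2.
rewrite -[sphere_coef q mu k.+2]/(mu * sphere_coef q mu k.+1 -
  (branching q k)%:R * sphere_coef q mu k).
by rewrite rmorphB !rmorphM rmorph_nat.
Qed.

Lemma sphere_coef_natR (mu : R) n : sphere_coef q mu%:C n = (sphere_coef q mu n)%:C.
Proof. exact: (sphere_coef_rmorph (real_complex R)). Qed.

Lemma eigen_of_laplacian (K : fieldType) (gam : K) (phi : T -> K) x :
  q.+1%:R != 0 :> K ->
  laplacian q e phi x = (1 - gam) * phi x ->
  \sum_(v <- nb e x) phi v = q.+1%:R * gam * phi x.
Proof.
move=> qn0; rewrite (laplacianE hT) mulrBl mul1r => /addrI /oppr_inj h.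
by rewrite -mulrA -h mulrA mulfV // mul1r.
Qed.

Lemma sphere_mean1 mu : sphere_mean mu 1 *+ q.+1 = mu.
Proof.
by rewrite /sphere_mean (size_sphere hT) expn0 muln1 -[LHS]mulr_natr divfK ?pnatr_eq0.
Qed.

Lemma sphere_mean_rec mu n :
  sphere_mean mu n + sphere_mean mu n.+2 *+ q = mu * sphere_mean mu n.+1.
Proof.
have qn0 : q%:R != 0 :> R by rewrite pnatr_eq0 -lt0n ltnW.
have sn0 k : (size (S o k))%:R != 0 :> R by rewrite pnatr_eq0 -lt0n sphere_size_gt0.
have e1 : (size (S o n.+2))%:R = q%:R * (size (S o n.+1))%:R :> R.
  by rewrite -natrM !(size_sphere hT) expnS mulnCA.
have e2 : (size (S o n.+1))%:R = (branching q n)%:R * (size (S o n))%:R :> R.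
  rewrite -natrM; congr (_%:R); rewrite (size_sphere hT); case: n {e1} => [|n] /=.
    by rewrite expn0.
  by rewrite (size_sphere hT) expnS mulnCA.
rewrite /sphere_mean -[sphere_coef q mu n.+2]/(mu * sphere_coef q mu n.+1 -
  (branching q n)%:R * sphere_coef q mu n) -[(_ / _) *+ q]mulr_natr e1.
have bn0 : (branching q n)%:R != 0 :> R.
  by apply/eqP => b0; move: (sn0 n.+1); rewrite e2 b0 mul0r eqxx.
rewrite e2; field; by rewrite qn0 bn0 sn0.
Qed.

(** Uniqueness: the mean value formula at o forces the value on each sphere. *)
Lemma spherical_profile (lam : R[i]) (g : R) (phi : T -> R[i]) x :
  gamma q lam = g%:C -> is_spherical q e o lam phi ->
  phi x = (sphere_mean (q.+1%:R * g) (d x o))%:C.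
Proof.
move=> gE [rad p1 lap]; set n := d x o.
have qn0 : q.+1%:R != 0 :> R[i] by rewrite pnatr_eq0.
have muE : q.+1%:R * g%:C = (q.+1%:R * g)%:C by rewrite rmorphM rmorph_nat.
have h : \sum_(v <- S o n) phi v = sphere_coef q (q.+1%:R * g%:C) n * phi o.
  by apply: (mean_value hT) => w _; apply: eigen_of_laplacian => //; rewrite lap gE.
move: h; rewrite p1 mulr1 (eq_big_seq (fun=> phi x)); last first.
  by move=> v; rewrite (mem_sphere hT) => /eqP dv; apply: rad.
rewrite big_const_seq count_predT iter_addr_0 muE sphere_coef_natR => h.
have sn0 : (size (S o n))%:R != 0 :> R[i] by rewrite pnatr_eq0 -lt0n sphere_size_gt0.
have sC : (size (S o n))%:R = ((size (S o n))%:R : R)%:C by rewrite rmorph_nat.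
apply: (mulIf sn0); rewrite [LHS]mulr_natr h /sphere_mean sC -[RHS]rmorphM divfK //.
by rewrite pnatr_eq0 -lt0n sphere_size_gt0.
Qed.

Lemma is_spherical_profile (lam : R[i]) (g : R) :
  gamma q lam = g%:C ->
  is_spherical q e o lam (fun x => (sphere_mean (q.+1%:R * g) (d x o))%:C).
Proof.
move=> gE; split.
- by move=> x y ->.
- by rewrite (dist_refl hT) /sphere_mean /= divr1.
- move=> x; rewrite (laplacianE hT) gE.
  have qn0 : q.+1%:R != 0 :> R[i] by rewrite pnatr_eq0.
  have muE : q.+1%:R * g%:C = (q.+1%:R * g)%:C by rewrite rmorphM rmorph_nat.
  suff -> : \sum_(v <- nb e x) (sphere_mean (q.+1%:R * g) (d v o))%:C =
     q.+1%:R * g%:C * (sphere_mean (q.+1%:R * g) (d x o))%:C.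
    by rewrite -[_ * g%:C * _]mulrA mulKf // mulrBl mul1r.
  rewrite muE; case E : (d x o) => [|n].
    have /eqP -> : x == o by rewrite -(dist_eq0 hT) E.
    rewrite (sum_nb_radial0 hT (fun n => (sphere_mean (q.+1%:R * g) n)%:C)).
    by rewrite -rmorphMn sphere_mean1 /sphere_mean /= divr1 mulr1.
  rewrite (sum_nb_radial hT (fun n => (sphere_mean (q.+1%:R * g) n)%:C) E).
  by rewrite -rmorphMn -rmorphD sphere_mean_rec rmorphM.
Qed.

(** Existence excludes the default value of [spherical], and uniqueness identifies the chosen
    function. *)
Lemma spherical_eq (lam : R[i]) (g : R) x : gamma q lam = g%:C ->
  spherical q e o lam x = (sphere_mean (q.+1%:R * g) (d x o))%:C.
Proof.
move=> gE; apply: (spherical_profile _ gE); rewrite /spherical.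
by apply: (xgetPex (fun=> 0)); eexists; exact: is_spherical_profile gE.
Qed.

Lemma gamma_imaginary (s : R) : gamma q (0 +i* s) =
  ((q%:R `^ s + q%:R `^ (- s)) / (q%:R `^ 2^-1 + q%:R `^ (- 2^-1)))%:C.
Proof.
rewrite /gamma /qexpi /= !mul0r oppr0 !mul0r cos0 sin0 !mulr1 !mulr0 opprK.
rewrite rmorphM fmorphV; congr (_ / _).
by rewrite rmorphD addrC.
Qed.

End Spherical.

(** * Infinite sums and norms *)

Section InfiniteSums.
Variables (R : realType) (T : choiceType).
Implicit Types (g h : T -> R) (F : T -> R[i]).
Local Notation normc := (@Normc.normc R).

Lemma normc_real (x : R) : normc x%:C = `|x|.
Proof. by rewrite /= expr0n addr0 sqrtr_sqr. Qed.

Lemma normc_ge0 (z : R[i]) : 0 <= normc z.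
Proof. by case: z => x y; exact: sqrtr_ge0. Qed.

Lemma normc_Re (z : R[i]) : `|complex.Re z| <= normc z.
Proof.
by case: z => x y /=; rewrite -sqrtr_sqr ler_wsqrtr // lerDl sqr_ge0.
Qed.

Lemma normc_Im (z : R[i]) : `|complex.Im z| <= normc z.
Proof.
by case: z => x y /=; rewrite -sqrtr_sqr ler_wsqrtr // lerDr sqr_ge0.
Qed.

Lemma normc_leD (x y : R) : normc (x +i* y) <= `|x| + `|y|.
Proof.
have xy : 0 <= `|x| + `|y| by rewrite addr_ge0.
rewrite /= -[leRHS](ger0_norm xy) -(sqrtr_sqr (_ + _)) ler_wsqrtr //.
rewrite sqrrD !real_normK ?num_real // lerD2r lerDl.
by rewrite mulrn_wge0 // mulr_ge0.
Qed.

Lemma normc_sum (I : Type) (s : seq I) (F : I -> R[i]) :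
  normc (\sum_(i <- s) F i) <= \sum_(i <- s) normc (F i).
Proof.
elim: s => [|i s IH]; first by rewrite !big_nil Normc.normc0.
by rewrite !big_cons; apply: le_trans (le_normcD _ _) _; rewrite lerD2l.
Qed.

Lemma esum_ge_seq h s : uniq s ->
  ((\sum_(x <- s) h x)%:E <= \esum_(x in [set: T]) (h x)%:E)%E.
Proof.
move=> us; apply: ereal_sup_ubound; exists [set` s].
  by split => //; exact: finite_seq.
by rewrite -fsbig_seq // sumEFin.
Qed.

Lemma esum_le_fin h M : sum_le h M -> (\esum_(x in [set: T]) (h x)%:E <= M%:E)%E.
Proof.
move=> hM; apply: ge_ereal_sup => _ [A [finA _] <-].
rewrite fsbig_finite //= sumEFin lee_fin; apply: hM; exact: finmap.fset_uniq.
Qed.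

Lemma summable_sum_le h : (forall x, 0 <= h x) ->
  summable [set: T] (fun x => (h x)%:E) -> exists M, sum_le h M.
Proof.
rewrite summableE => h0 fn.
have E x : (`|(h x)%:E| = (h x)%:E)%E by rewrite /= ger0_norm.
exists (fine (\esum_(x in [set: T]) `|(h x)%:E|)%E) => s us.
rewrite -lee_fin fineK //; apply: le_trans (esum_ge_seq h us) _.
by rewrite (eq_esum (b := fun x => (`|(h x)%:E|)%E)) // => x _; rewrite E.
Qed.

Lemma esum_approx h M : (forall x, 0 <= h x) -> sum_le h M ->
  exists E : R, [/\ \esum_(x in [set: T]) (h x)%:E = E%:E, sum_le h E &
   forall eta, 0 < eta -> exists2 s, uniq s & E - eta <= \sum_(x <- s) h x].
Proof.
move=> h0 hM; set X := (\esum_(x in _) _)%E.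
have X0 : (0 <= X)%E by apply: esum_ge0 => x _; rewrite lee_fin.
have XM : (X <= M%:E)%E := esum_le_fin hM.
have XE : X = (fine X)%:E.
  rewrite fineK // fin_numElt (lt_le_trans _ X0) ?ltNyr //=.
  by apply: le_lt_trans XM _; exact: ltry.
exists (fine X); split => //.
  by move=> s us; rewrite -lee_fin -XE; exact: esum_ge_seq.
move=> eta eta0; apply: contrapT => nex.
suff : (X <= (fine X - eta)%:E)%E by rewrite XE lee_fin /=; lra.
apply: esum_le_fin => s us; rewrite leNgt; apply/negP => lt; apply: nex.
by exists s; [|exact: ltW].
Qed.

End InfiniteSums.

Section BallSums.
Variables (R : realType) (T : choiceType) (e : rel T) (q : nat).
Hypothesis hT : homogeneous_tree e q.
Variable o : T.
Implicit Types (g h : T -> R) (F : T -> R[i]).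
Local Notation normc := (@Normc.normc R).
Local Notation ball := (ball e o).

Lemma esum_ball h M : (forall x, 0 <= h x) -> sum_le h M ->
  forall eta, 0 < eta -> exists N, forall n, (N <= n)%N ->
  `|fine (\esum_(x in [set: T]) (h x)%:E)%E - \sum_(x <- ball n) h x| <= eta.
Proof.
move=> h0 /(esum_approx h0) [E [-> hE happ]] eta eta0 /=.
have [s us sE] := happ _ eta0; have [N sN] := sub_ball hT o s.
exists N => n Nn; have bE := hE _ (ball_uniq hT o n).
have : \sum_(x <- s) h x <= \sum_(x <- ball n) h x.
  apply: sum_subseq => //; first exact: ball_uniq hT o n.
  by move=> x /sN; rewrite !(mem_ball hT); lia.
by move=> sb; rewrite ger0_norm; lra.
Qed.

Lemma rsum_ball g M : sum_le (fun x => `|g x|) M ->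
  forall eta, 0 < eta -> exists N, forall n, (N <= n)%N ->
  `|rsum g - \sum_(x <- ball n) g x| <= eta.
Proof.
move=> gM eta eta0; have eta2 : 0 < eta / 2 by rewrite divr_gt0.
pose gp x := Num.max (g x) 0; pose gn x := Num.max (- g x) 0.
have gp0 x : 0 <= gp x by rewrite /gp le_max lexx orbT.
have gn0 x : 0 <= gn x by rewrite /gn le_max lexx orbT.
have gpM : sum_le gp M.
  by apply: sum_le_le gM => x; rewrite /gp ge_max ler_norm normr_ge0.
have gnM : sum_le gn M.
  by apply: sum_le_le gM => x; rewrite /gn ge_max -normrN ler_norm normr_ge0.
have [N1 h1] := esum_ball gp0 gpM eta2; have [N2 h2] := esum_ball gn0 gnM eta2.
exists (maxn N1 N2) => n; rewrite geq_max => /andP[/h1 {}h1 /h2 {}h2].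
have -> : rsum g = fine (\esum_(x in [set: T]) (gp x)%:E)%E -
    fine (\esum_(x in [set: T]) (gn x)%:E)%E.
  by rewrite /rsum; congr (fine _ - fine _); apply: eq_esum => x _;
    rewrite ?funeposE ?funenegE /= /gp /gn ?EFin_max ?EFinN.
have -> : \sum_(x <- ball n) g x = \sum_(x <- ball n) gp x - \sum_(x <- ball n) gn x.
  rewrite -sumrB; apply: eq_bigr => x _; rewrite /gp /gn.
  by case: (lerP 0 (g x)) => gx; rewrite ?maxEle; case: ifP; lra.
move: h1 h2; set a := fine _; set b := \sum_(_ <- _) _; set c := fine _ ; set d := \sum_(_ <- _) _.
move=> h1 h2; have -> : a - c - (b - d) = (a - b) - (c - d) by lra.
apply: le_trans (ler_normB _ _) _; lra.
Qed.

Lemma csum_ball F M : sum_le (fun x => normc (F x)) M ->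
  forall eta, 0 < eta -> exists N, forall n, (N <= n)%N ->
  normc (csum F - \sum_(x <- ball n) F x) <= eta.
Proof.
move=> FM eta eta0; have eta2 : 0 < eta / 2 by rewrite divr_gt0.
have [N1 h1] := rsum_ball (sum_le_le (fun x => normc_Re (F x)) FM) eta2.
have [N2 h2] := rsum_ball (sum_le_le (fun x => normc_Im (F x)) FM) eta2.
exists (maxn N1 N2) => n; rewrite geq_max => /andP[/h1 {}h1 /h2 {}h2].
have ReS s : complex.Re (\sum_(x <- s) F x) = \sum_(x <- s) complex.Re (F x).
  exact: raddf_sum.
have ImS s : complex.Im (\sum_(x <- s) F x) = \sum_(x <- s) complex.Im (F x).
  exact: raddf_sum.
rewrite -ReS in h1; rewrite -ImS in h2; move: h1 h2; rewrite /csum.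
case: (\sum_(_ <- _) _) => u v h1 h2; apply: le_trans (normc_leD _ _) _ => /=.
by move: h1 h2 => /=; lra.
Qed.

(** Passing to one finite sum over a large ball lets the terms of the two series be combined before
    absolute values are taken. *)
Lemma csum_sub_le F1 F2 M1 M2 (c : R[i]) eta :
  sum_le (fun x => normc (F1 x)) M1 -> sum_le (fun x => normc (F2 x)) M2 -> 0 < eta ->
  exists N, forall n, (N <= n)%N ->
  normc (csum F1 - csum F2 * c) <= normc (\sum_(x <- ball n) (F1 x - F2 x * c)) + eta.
Proof.
move=> h1 h2 eta0; have eta2 : 0 < eta / 2 by rewrite divr_gt0.
have c1 : 0 < normc c + 1 by rewrite ltr_wpDl // normc_ge0.
have [N1 {}h1] := csum_ball h1 eta2.
have [N2 {}h2] := csum_ball h2 (divr_gt0 eta2 c1).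
exists (maxn N1 N2) => n; rewrite geq_max => /andP[/h1 {}h1 /h2 {}h2].
rewrite sumrB -mulr_suml; move: h1 h2.
set S1 := \sum_(_ <- _) F1 _; set S2 := \sum_(_ <- _) F2 _ => h1 h2.
have -> : csum F1 - csum F2 * c = (S1 - S2 * c) + ((csum F1 - S1) - (csum F2 - S2) * c).
  by ring.
apply: le_trans (le_normcD _ _) _; rewrite lerD2l.
apply: le_trans (le_normcD _ _) _; rewrite normcN Normc.normcM.
have : normc (csum F2 - S2) * normc c <= eta / 2.
  move: h2; rewrite ler_pdivlMr // => h2; apply: le_trans h2.
  by rewrite ler_wpM2l ?normc_ge0 // lerDl.
lra.
Qed.

End BallSums.

(** * Comparison of norms in the extended reals *)

Section LpRatio.
Variables (R : realType) (T : choiceType).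
Local Notation normc := (@Normc.normc R).

Lemma ratio_cvg0 (A B : R -> \bar R) (b : R -> R) :
  (\forall t \near +oo, 0 < b t /\ ((b t)%:E <= B t < +oo)%E) ->
  (forall t, 0 <= A t)%E ->
  (forall eps, 0 < eps -> \forall t \near +oo, (A t <= (eps * b t)%:E)%E) ->
  (A t / B t)%E @[t --> +oo%R] --> 0%E.
Proof.
move=> hb A0 hA.
have key eps : 0 < eps -> \forall t \near +oo, (0 <= A t / B t <= eps%:E)%E.
  move=> eps0; have hAe := hA _ eps0; near=> t.
  have [b0 /andP[bB Boo]] : 0 < b t /\ ((b t)%:E <= B t < +oo)%E by near: t.
  have : (A t <= (eps * b t)%:E)%E by near: t.
  have := A0 t; move: bB Boo; case: (B t) => [v| |] //; case: (A t) => [u| |] //=.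
  rewrite !lee_fin => bv _ u0 ub.
  have v0 : 0 < v := lt_le_trans b0 bv.
  rewrite inver gt_eqF // -EFinM !lee_fin divr_ge0 ?(ltW v0) //=.
  by rewrite ler_pdivrMr // (le_trans ub) // ler_wpM2l // ltW.
apply/fine_cvgP; split.
  have := key 1 ltr01; apply: filterS => t /andP[h1 h2].
  by rewrite ge0_fin_numE //; apply: le_lt_trans h2 (ltry _).
apply/cvgrPdist_le => eps eps0; have := key _ eps0; apply: filterS => t /andP[h1 h2].
rewrite sub0r normrN /= ger0_norm ?fine_ge0 // -lee_fin fineK //.
by rewrite ge0_fin_numE //; apply: le_lt_trans h2 (ltry _).
Unshelve. all: by end_near. Qed.

Lemma lpnorm_le (r M : R) (F : T -> R[i]) : 0 < r ->
  sum_le (fun x => normc (F x) `^ r) M -> (lpnorm r%:E F <= (M `^ r^-1)%:E)%E.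
Proof.
move=> r0 /esum_le_fin h; rewrite /lpnorm -poweR_EFin.
have s0 : (0 <= \esum_(x in [set: T]) (normc (F x) `^ r)%:E)%E.
  by apply: esum_ge0 => x _; rewrite lee_fin powR_ge0.
apply: gt0_ler_poweR => //; rewrite ?invr_ge0 ?(ltW r0) // in_itv /= ?andbT ?leey //=.
  by rewrite s0.
by rewrite (le_trans s0 h).
Qed.

Lemma lpnorm_ge (r M : R) (F : T -> R[i]) : 0 < r -> 0 <= M ->
  (M%:E <= \esum_(x in [set: T]) (normc (F x) `^ r)%:E)%E ->
  ((M `^ r^-1)%:E <= lpnorm r%:E F)%E.
Proof.
move=> r0 M0 h; rewrite /lpnorm -poweR_EFin.
have s0 : (0 <= \esum_(x in [set: T]) (normc (F x) `^ r)%:E)%E.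
  by apply: esum_ge0 => x _; rewrite lee_fin powR_ge0.
apply: gt0_ler_poweR => //; rewrite ?invr_ge0 ?(ltW r0) // in_itv /= ?andbT ?leey //=.
  by rewrite lee_fin M0.
by rewrite s0.
Qed.

Lemma lpnorm_ge0 (p : \bar R) (F : T -> R[i]) (o : T) : (0 <= lpnorm p F)%E.
Proof.
case: p => [r| |] //=; first exact: poweR_ge0.
apply: le_trans (_ : (normc (F o))%:E <= _)%E; first by rewrite lee_fin normc_ge0.
by apply: ereal_sup_ubound; exists o.
Qed.

End LpRatio.

(** * Averages over the boundary *)

Section Confluence.
Variables (T : choiceType) (e : rel T) (q : nat).
Hypothesis hT : homogeneous_tree e q.
Local Notation d := (dist e).
Variable o : T.
Implicit Types (w : nat -> T) (x y : T).

Lemma ray_level w n : is_ray e o w -> d (w n) o = n.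
Proof. by case=> w0 /(_ 0%N n); rewrite w0 (dist_sym hT). Qed.

Lemma last_on_range w s : w 0%N = o ->
  exists s1 s2, [/\ s = s1 ++ s2, range w (last o s1) & forall z, z \in s2 -> ~ range w z].
Proof.
move=> w0; elim/last_ind: s => [|s z [s1 [s2 [-> h1 h2]]]].
  by exists [::], [::]; split => //; exists 0%N.
have [wz|wz] := pselect (range w z).
  by exists (rcons (s1 ++ s2) z), [::]; rewrite cats0 last_rcons.
exists s1, (rcons s2 z); rewrite rcons_cat; split => // v.
by rewrite mem_rcons inE => /orP[/eqP->|/h2].
Qed.

(** The confluence point is described by its level m on the ray; z is the vertex at which the
    geodesic to y leaves the ray. *)
Lemma confluentP w y : is_ray e o w -> exists m, [/\ confluent e o y w = w m,
  (m <= d y o)%N, d (w m) y = (d y o - m)%N &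
  (m < d y o)%N -> exists2 z, e (w m) z /\ z <> w m.+1 & d z y = (d y o - m).-1].
Proof.
move=> wr; have [w0 wd] := wr.
have [s gs ss] := geodesic_dist hT o y.
have [s1 [s2 [sE r1 r2]]] := last_on_range s w0.
have : [set c | exists s1 s2 : seq T,
    [/\ geodesic e o (s1 ++ s2) y, last o s1 = c, range w c
      & forall z, z \in s2 -> ~ range w z]] (confluent e o y w).
  by apply: (xgetPex o); exists (last o s1), s1, s2; rewrite -sE.
set c := confluent e o y w; case=> {s gs ss sE r1 r2} {}s1 [{}s2 [gs lc [m _ wm] ns]].
exists m; have ss := geodesic_size hT gs; case: gs; rewrite cat_path last_cat lc.
move=> /andP[p1 p2] l2 _; rewrite size_cat in ss.
have dc := ray_level m wr; rewrite wm in dc.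
have h1 := dist_path hT p1; have h2 := dist_path hT p2.
rewrite lc (dist_sym hT) dc in h1; rewrite l2 in h2.
have h3 := dist_triangle hT o c y; rewrite (dist_sym hT o c) dc -ss in h3.
rewrite wm (dist_sym hT y); split => //; [lia|lia|].
case: s2 p2 l2 ss h2 h3 ns => [|z s2] /=; first by lia.
move=> /andP[cz p2] l2 ss h2 h3 ns _; exists z.
  by split => // zw; apply: (ns z); [rewrite mem_head|exists m.+1].
have := dist_path hT p2; rewrite l2; have := dist_edge hT y cz; lia.
Qed.

Lemma ray_edge w n : is_ray e o w -> e (w n) (w n.+1).
Proof. by case=> _ /(_ n 1%N); rewrite addn1 => /eqP; rewrite (dist1 hT). Qed.

(** A step of the ray towards y would end at the unique neighbour closer to y. Right after the
    confluence point this is z, which is off the ray; later it is the previous vertex of the ray,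
    and rays do not turn back. *)
Lemma ray_departs w y m : is_ray e o w -> (m <= d y o)%N -> d (w m) y = (d y o - m)%N ->
  ((m < d y o)%N -> exists2 z, e (w m) z /\ z <> w m.+1 & d z y = (d y o - m).-1) ->
  forall k, d (w (m + k)%N) y = (d y o - m + k)%N.
Proof.
move=> wr; have [w0 wd] := wr.
rewrite leq_eqVlt => /orP[/eqP <- |my].
  rewrite subnn => /eqP; rewrite (dist_eq0 hT) => /eqP <- _ k.
  by rewrite (dist_sym hT) wd.
move=> dm /(_ my) [z [ez zw] dz].
suff E k : d (w (m + k)%N) y = (d y o - m + k)%N /\
    d (w (m + k.+1)%N) y = (d y o - m + k.+1)%N by move=> k; have [] := E k.
elim: k => [|k [IH1 IH2]].
  rewrite addn0 addn1 dm addn0; split=> //.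
  have ew := ray_edge m wr; have [|dw] := dist_edgeP hT y ew; first by rewrite dm; lia.
  exfalso; apply: zw; rewrite dm in dw.
  apply: (dist_parent_uniq hT (x := w m) (n := (d y o - m).-1) _ ez ew dz); last lia.
  by rewrite dm; lia.
split=> //; rewrite [in LHS]addnS.
have ew := ray_edge (m + k.+1) wr; have [|dw] := dist_edgeP hT y ew; first by rewrite IH2; lia.
exfalso; rewrite IH2 in dw.
have ew' := ray_edge (m + k) wr; rewrite (tree_sym hT) -addnS in ew'.
have E : w (m + k)%N = w (m + k.+1).+1.
  by apply: (dist_parent_uniq hT (n := (d y o - m + k)%N) (etrans IH2 (addnS _ _)) _ _ IH1) => //; lia.
by have := wd (m + k)%N 2; rewrite addn2 -addnS -E (dist_refl hT).
Qed.

Lemma height_le w y : is_ray e o w -> height e o w y <= (d y o)%:Z.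
Proof.
move=> wr; rewrite /height; have [m [-> my _ _]] := confluentP y wr.
by rewrite (ray_level m wr) lerBlDr; lia.
Qed.

(* The geodesic from o to y leaves w before reaching level |y| <= |x|, so that
   the confluence point of y and w does not depend on the end of w. *)
Lemma height_far w x y : boundary_arc e o x w -> (d y o <= d x o)%N ->
  height e o w y = (d x o)%:Z - (d x y)%:Z.
Proof.
move=> [wr [n _ wn]] yx; have [m [cE my dm dz]] := confluentP y wr.
rewrite /height cE (ray_level m wr).
have nx : n = d x o by rewrite -wn (ray_level n wr).
have := ray_departs wr my dm dz (n - m)%N.
rewrite subnKC ?wn; last lia.
by move=> ->; rewrite -nx; lia.
Qed.

End Confluence.

Section Average.
Variables (R : realType) (T : choiceType) (e : rel T) (q : nat).
Hypothesis hT : homogeneous_tree e q.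
Local Notation d := (dist e).
Variable o : T.
Variable nu : probability (boundary e o) R.
Hypothesis hnu : harmonic_measure nu.
Local Notation arc x := (boundary_arc e o x : set (boundary e o)).

Lemma arc_measurable x : measurable (arc x).
Proof. by apply: sub_sigma_algebra; exists x. Qed.

Lemma arc_fin_num x : nu (arc x) \is a fin_num.
Proof. by apply: fin_num_measure; exact: arc_measurable. Qed.

Lemma arc_null_cover (s : seq T) : (forall x, x \in s -> nu (arc x) = 0%E) ->
  measurable (\big[setU/set0]_(x <- s) arc x) /\ nu (\big[setU/set0]_(x <- s) arc x) = 0%E.
Proof.
elim: s => [|x s IH] hs; first by rewrite big_nil measure0; split => //; exact: measurable0.
have [|ms s0] := IH; first by move=> y ys; apply: hs; rewrite inE ys orbT.
have mx := arc_measurable x; rewrite big_cons; split; first exact: measurableU.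
by apply: etrans (measureU0 mx ms s0) _; apply: hs; exact: mem_head.
Qed.

(** The arcs of one sphere are finitely many, have equal measure and cover the boundary: if one were
    null, all of Omega would be. *)
Lemma arc_gt0 x : 0 < fine (nu (arc x)).
Proof.
rewrite lt_def fine_ge0 // andbT; apply/eqP => nx.
have [nu1 rad] := hnu.
have nx0 : nu (arc x) = 0%E by rewrite -(fineK (arc_fin_num x)) nx.
have [|ms s0] := @arc_null_cover (sphere e o (d x o)).
  by move=> y; rewrite (mem_sphere hT) => /eqP dy; rewrite (rad y x dy).
suff : (nu (arc o) <= 0)%E by rewrite nu1 lee_fin ler10.
rewrite -s0; apply: le_measure; [apply: mem_set; exact: arc_measurable|exact: mem_set|].
move=> w [wr _]; rewrite -bigcup_seq; exists (w (d x o)).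
  by rewrite /= (mem_sphere hT) (ray_level hT _ wr).
by split => //; exists (d x o).
Qed.

Lemma average_const (F : boundary e o -> R) k x : (forall w, arc x w -> F w = k) ->
  average nu (arc x) F = k.
Proof.
move=> Fk; have E : Rintegral nu (arc x) F = Rintegral nu (arc x) (fun=> k).
  by apply: eq_Rintegral => w /set_mem/Fk.
rewrite /average E.
rewrite Rintegral_cst; last exact: arc_measurable.
by rewrite mulrC mulfK // gt_eqF // arc_gt0.
Qed.

(* The integral of a nonnegative function is a supremum over simple functions,
   hence monotone without any measurability. *)
Lemma average_bounds (F : boundary e o -> R) k x :
  (forall w, arc x w -> 0 <= F w <= k) -> 0 <= average nu (arc x) F <= k.
Proof.
move=> Fk; have c0 := arc_gt0 x.
have I0 : (0 <= \int[nu]_(w in arc x) (F w)%:E)%E.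
  by apply: integral_ge0 => w /Fk/andP[]; rewrite lee_fin.
have Ik : (\int[nu]_(w in arc x) (F w)%:E <= (k * fine (nu (arc x)))%:E)%E.
  have k0 w : arc x w -> 0 <= k by move=> /Fk/andP[]; exact: le_trans.
  rewrite EFinM fineK ?arc_fin_num // -integral_cst; last exact: arc_measurable.
  rewrite ge0_integralE; last by move=> w /k0; rewrite lee_fin.
  rewrite ge0_integralE; last by move=> w /Fk/andP[]; rewrite lee_fin.
  apply: ge_ereal_sup => _ [h /= hF <-]; apply: ereal_sup_ubound; exists h => //= w.
  apply: le_trans (hF w) _.
  rewrite !patchE; by case: ifPn => // /set_mem/Fk/andP[_]; rewrite lee_fin.
rewrite /average mulr_ge0 ?invr_ge0 ?(ltW c0) ?fine_ge0 //=.
rewrite mulrC ler_pdivrMr // -lee_fin fineK // ge0_fin_numE //.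
by apply: le_lt_trans Ik _; exact: ltry.
Qed.

End Average.

(** * From kernels to solutions *)

Section Estimates.
Variables (R : realType) (T : choiceType) (e : rel T) (q : nat).
Hypotheses (hT : homogeneous_tree e q) (q_gt1 : (1 < q)%N).
Local Notation d := (dist e).
Local Notation S := (sphere e).
Local Notation normc := (@Normc.normc R).
Variables (o : T) (p : R) (h : R -> nat -> R) (L : R -> R).
Hypotheses (p_ge1 : 1 <= p) (h_ge0 : forall t n, 0 <= h t n).
Hypothesis L_gt0 : \forall t \near +oo, 0 < L t.
Hypothesis h_le : \forall t \near +oo, forall K, \sum_(0 <= n < K) (q ^ n)%:R * h t n `^ p <= L t.
Hypothesis heatE : \forall t \near +oo, forall x y, heat_kernel q e t x y = h t (d x y).
Variable f : T -> R[i].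

Let p_gt0 : 0 < p. Proof. exact: lt_le_trans p_ge1. Qed.

Lemma powR_le_root (u v : R) : 0 <= u -> u `^ p <= v -> u <= v `^ p^-1.
Proof.
move=> u0 uv; have v0 : 0 <= v := le_trans (powR_ge0 _ _) uv.
rewrite -[leLHS](powRr1 u0) -[in leLHS](mulfV (lt0r_neq0 p_gt0)) powRrM.
by apply: ge0_ler_powR; rewrite ?nnegrE ?powR_ge0 // invr_ge0 ltW.
Qed.

Lemma profile_bounded t n :
  (forall K, \sum_(0 <= n < K) (q ^ n)%:R * h t n `^ p <= L t) -> h t n <= L t `^ p^-1.
Proof.
move=> /(_ n.+1); rewrite big_nat_recr //= => hn; apply: powR_le_root => //.
apply: le_trans hn; rewrite -[leLHS]add0r lerD //.
  by rewrite sumr_ge0 // => i _; rewrite mulr_ge0 // powR_ge0.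
by rewrite ler_peMl ?powR_ge0 // ler1n expn_gt0 ltnW.
Qed.

(** The factor s(x) fits both forms of the mass function: s = 1 for boundary averages, s = 1 / phi_0
    for the convolution, whose denominator stands outside the sum. *)
Lemma weighted_estimate (m : T -> T -> R) (s w : T -> R) (A0 C : R) (M : T -> R[i]) eps :
  0 <= C -> (forall x, 0 < s x) -> (forall y x, 0 <= m y x) ->
  (forall y x, m y x <= w y) -> (forall y, 1 <= w y) ->
  sum_le (fun y => normc (f y) * w y) A0 ->
  (\forall t \near +oo, forall y, sum_le (fun x =>
     `|h t (d x y) - m y x * h t (d x o)| `^ p) (w y `^ p * (C * L t))) ->
  (forall y eta, 0 < eta -> \forall t \near +oo, sum_le (fun x =>
     `|h t (d x y) - m y x * h t (d x o)| `^ p) (eta * L t)) ->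
  (forall x, M x = csum (fun y => f y * (m y x / s x)%:C) * (s x)%:C) -> 0 < eps ->
  \forall t \near +oo, sum_le (fun x =>
    normc (heat_solution q e f t x - M x * (heat_kernel q e t x o)%:C) `^ p) (eps * L t).
Proof.
move=> C0 s0 m0 mw w1 fw KB KV ME.
have w0 y : 0 < w y := lt_le_trans ltr01 (w1 y).
apply: (tannery_powR hT (o := o) (c := fun y => normc (f y)) (w := w)
  (K := fun t y x => `|h t (d x y) - m y x * h t (d x o)|) p_ge1 C0 _ _ _ fw) => //.
  by move=> y; exact: normc_ge0.
near=> t; have hE : forall x y, heat_kernel q e t x y = h t (d x y) by near: t.
have ht : forall K, \sum_(0 <= n < K) (q ^ n)%:R * h t n `^ p <= L t by near: t.
move=> x; split => [|eta eta0]; first exact: normc_ge0.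
have hB n := profile_bounded n ht; set B := _ `^ _ in hB.
have B0 : 0 <= B := powR_ge0 _ _.
pose F1 y := f y * (h t (d x y))%:C; pose F2 y := f y * (m y x / s x)%:C.
have F1B : sum_le (fun y => normc (F1 y)) (B * A0).
  apply: sum_le_le (sum_leZ B0 fw) => y; rewrite /F1 Normc.normcM normc_real mulrCA.
  rewrite ler_wpM2l ?normc_ge0 // ger0_norm // mulrC.
  by apply: le_trans (hB _) _; rewrite ler_peMl.
have F2B : sum_le (fun y => normc (F2 y)) ((s x)^-1 * A0).
  have sV : 0 <= (s x)^-1 by rewrite invr_ge0 ltW.
  apply: sum_le_le (sum_leZ sV fw) => y; rewrite /F2 Normc.normcM normc_real mulrCA.
  rewrite ler_wpM2l ?normc_ge0 // ger0_norm; last by rewrite mulr_ge0.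
  by rewrite mulrC ler_wpM2l.
have [N hN] := csum_sub_le hT o (s x * h t (d x o))%:C F1B F2B eta0.
exists N => n /hN; rewrite {1}/heat_solution ME hE -mulrA -rmorphM.
rewrite (_ : (fun y => f y * _) = F1); last by apply/funext => y; rewrite /F1 hE.
move/le_trans; apply; rewrite lerD2r; apply: le_trans (normc_sum _ _) _.
apply: ler_sum => y _; rewrite le_eqVlt; apply/orP; left; apply/eqP.
rewrite -normc_real -Normc.normcM; congr normc.
rewrite /F1 /F2 -mulrA -rmorphM -mulrBr -rmorphB mulrA divfK // gt_eqF //.
Unshelve. all: by end_near. Qed.

(** As f is constant on spheres, the kernel at y is replaced by its average over the sphere of y.
    The weight then becomes phi(|y|), as summability of f phi requires. *)
Lemma radial_estimate (phi : nat -> R) (A0 C : R) eps :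
  radial e o f -> 0 <= C -> (forall n, 0 < phi n) ->
  sum_le (fun y => normc (f y) * phi (d y o)) A0 ->
  (\forall t \near +oo, forall n, sum_le (fun x => (\sum_(v <- S o n) h t (d x v)) `^ p)
     (((size (S o n))%:R * phi n) `^ p * (C * L t))) ->
  (forall n eta, 0 < eta -> \forall t \near +oo, sum_le (fun x =>
     `|(\sum_(v <- S o n) h t (d x v) - (size (S o n))%:R * phi n * h t (d x o))
        / (size (S o n))%:R| `^ p) (eta * L t)) -> 0 < eps ->
  \forall t \near +oo, sum_le (fun x => normc (heat_solution q e f t x -
    csum (fun y => f y * (phi (d y o))%:C) * (heat_kernel q e t x o)%:C) `^ p) (eps * L t).
Proof.
move=> frad C0 phi0 fphi hU hV.
pose sz n : R := (size (S o n))%:R.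
have sz0 n : 0 < sz n by rewrite ltr0n (sphere_size_gt0 hT q_gt1 o n).
pose A t n x := \sum_(v <- S o n) h t (d x v).
have A0' t n x : 0 <= A t n x by rewrite sumr_ge0.
pose K t y x := `|(A t (d y o) x - sz (d y o) * phi (d y o) * h t (d x o)) / sz (d y o)|.
have CC0 : 0 <= 2 `^ (p - 1) * (C + 2) by rewrite mulr_ge0 ?powR_ge0 // addr_ge0.
apply: (tannery_powR hT (o := o) (c := fun y => normc (f y)) (w := fun y => phi (d y o))
  (K := K) p_ge1 CC0 _ _ _ fphi L_gt0) => //.
- by move=> *; exact: normc_ge0.
- by move=> *; exact: normr_ge0.
- near=> t; have Lt : 0 < L t by near: t.
  have ht : forall K, \sum_(0 <= n < K) (q ^ n)%:R * h t n `^ p <= L t by near: t.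
  have hUt : forall n, sum_le (fun x => (\sum_(v <- S o n) h t (d x v)) `^ p)
     (((size (S o n))%:R * phi n) `^ p * (C * L t)) by near: t.
  move=> y; set n := d y o.
  have pn := ltW (phi0 n); have zn := ltW (sz0 n).
  have zV : 0 <= (sz n)^-1 by rewrite invr_ge0.
  have h1 : sum_le (fun x => (A t n x / sz n) `^ p) (phi n `^ p * (C * L t)).
    have := sum_leZ (powR_ge0 (sz n)^-1 p) (hUt n).
    rewrite -/(sz n) [_ * (_ * (C * _))]mulrA -powRM //; last by rewrite mulr_ge0.
    rewrite mulKf ?gt_eqF //; apply: sum_le_le => x.
    by rewrite -(powRM _ zV (A0' t n x)) mulrC.
  have h2 : sum_le (fun x => (phi n * h t (d x o)) `^ p) (phi n `^ p * (2 * L t)).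
    have hp k : 0 <= h t k `^ p := powR_ge0 _ _.
    apply: sum_le_le (sum_leZ (powR_ge0 (phi n) p) (sum_le_radial hT q_gt1 o hp ht)).
    by move=> x; rewrite powRM.
  have := sum_leZ (powR_ge0 2 (p - 1)) (sum_leD h1 h2).
  rewrite (_ : _ * (_ + _) = phi n `^ p * (2 `^ (p - 1) * (C + 2) * L t)); last by ring.
  apply: sum_le_le => x.
  have u0 : 0 <= A t n x / sz n := mulr_ge0 (A0' t n x) zV.
  have v0 : 0 <= phi n * h t (d x o) := mulr_ge0 pn (h_ge0 _ _).
  apply: le_trans (powRD_le p_ge1 u0 v0).
  apply: ge0_ler_powR; rewrite ?nnegrE ?(ltW p_gt0) // ?normr_ge0 //.
    exact: addr_ge0.
  have zn0 := lt0r_neq0 (sz0 n).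
  rewrite /K -/n (_ : _ / _ = A t n x / sz n - phi n * h t (d x o)); last by field.
  by apply: le_trans (ler_normB _ _) _; rewrite !ger0_norm.
- by move=> y eta eta0; have := hV (d y o) eta eta0.
near=> t; have hE : forall x y, heat_kernel q e t x y = h t (d x y) by near: t.
have Lt : 0 < L t by near: t.
have hUt : forall n, sum_le (fun x => (\sum_(v <- S o n) h t (d x v)) `^ p)
     (((size (S o n))%:R * phi n) `^ p * (C * L t)) by near: t.
move=> x; split => [|eta eta0]; first exact: normc_ge0.
pose B := (C * L t) `^ p^-1; have B0 : 0 <= B := powR_ge0 _ _.
have AB n : A t n x <= sz n * phi n * B.
  have := sum_le_point x (hUt n) => /(powR_le_root (A0' t n x)).
  have z0 : 0 <= sz n * phi n by rewrite mulr_ge0 // ltW.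
  rewrite powRM ?powR_ge0 //; last by rewrite mulr_ge0 // ltW.
  by rewrite -powRrM mulfV ?gt_eqF // powRr1.
have fS n v : v \in S o n -> f v = radial_profile e o f n.
  rewrite (mem_sphere hT) => /eqP dv; rewrite /radial_profile.
  case: xgetP => [z -> [u /= du <-]|]; first by apply: frad; rewrite dv du.
  by move=> /(_ (f v)) []; exists v.
pose F1 y := f y * (h t (d x y))%:C; pose F2 y := f y * (phi (d y o))%:C.
have F1B : sum_le (fun y => normc (F1 y)) (B * A0).
  apply: (sum_le_balls hT (y := o)) => [y|n]; first exact: normc_ge0.
  have := sum_leZ B0 fphi (ball_uniq hT o n); apply: le_trans.
  rewrite !big_ball; apply: ler_sum => k _.
  rewrite (eq_big_seq (fun v => normc (radial_profile e o f k) * h t (d x v))); last first.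
    by move=> v /fS fv; rewrite /F1 Normc.normcM normc_real ger0_norm // fv.
  rewrite [leRHS](eq_big_seq (fun v => normc (radial_profile e o f k) * (phi k * B))); last first.
    move=> v vS; rewrite (fS _ _ vS); move: vS; rewrite (mem_sphere hT) => /eqP ->.
    by rewrite mulrC mulrA.
  rewrite -!mulr_sumr ler_wpM2l ?normc_ge0 // big_const_seq count_predT iter_addr_0.
  by rewrite -mulr_natl mulrA [phi k * _]mulrC; exact: AB.
have F2B : sum_le (fun y => normc (F2 y)) A0.
  apply: sum_le_le fphi => y; rewrite /F2 Normc.normcM normc_real ger0_norm //.
  exact: ltW.
have [N hN] := csum_sub_le hT o (h t (d x o))%:C F1B F2B eta0.
exists N => n /hN; rewrite {1}/heat_solution hE.
rewrite (_ : (fun y => f y * (heat_kernel _ _ _ _ _)%:C) = F1); last first.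
  by apply/funext => y; rewrite /F1 hE.
move/le_trans; apply; rewrite lerD2r !big_ball.
apply: le_trans (normc_sum _ _) _; apply: ler_sum => k _.
rewrite (eq_big_seq (fun v => radial_profile e o f k *
    (h t (d x v) - phi k * h t (d x o))%:C)); last first.
  move=> v vS; rewrite /F1 /F2 (fS _ _ vS); move: vS; rewrite (mem_sphere hT) => /eqP ->.
  by rewrite -mulrA -rmorphM -mulrBr -rmorphB.
rewrite [leRHS](eq_big_seq (fun v => normc (radial_profile e o f k) *
    `|(A t k x - sz k * phi k * h t (d x o)) / sz k|)); last first.
  by move=> v vS; rewrite (fS _ _ vS) /K; move: vS; rewrite (mem_sphere hT) => /eqP ->.
have sumC (c : R) : \sum_(v <- S o k) c = sz k * c.
  by rewrite big_const_seq count_predT iter_addr_0 mulr_natl.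
rewrite -!mulr_sumr Normc.normcM ler_wpM2l ?normc_ge0 //.
rewrite -(rmorph_sum (real_complex R)) normc_real sumC sumrB sumC -/(A t k x).
rewrite normrM (ger0_norm (_ : 0 <= (sz k)^-1)); last by rewrite invr_ge0 ltW.
by rewrite [sz k * (_ / _)]mulrC divfK ?gt_eqF // mulrA.
Unshelve. all: by end_near. Qed.

End Estimates.

(** * The spherical function phi_0 *)

Section Ground.
Variables (R : realType) (T : choiceType) (e : rel T) (q : nat).
Hypotheses (hT : homogeneous_tree e q) (q_gt1 : (1 < q)%N).
Local Notation d := (dist e).
Local Notation S := (sphere e).
Local Notation r := (Num.sqrt q%:R : R).
Local Notation ground := (ground_profile R q).

Let q_gt0 : 0 < q%:R :> R. Proof. by rewrite ltr0n ltnW. Qed.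
Let q1_gt0 : 0 < q%:R - 1 :> R. Proof. by rewrite subr_gt0 ltr1n. Qed.
Let r_gt0 : 0 < r. Proof. by rewrite sqrtr_gt0. Qed.
Let rr : r * r = q%:R. Proof. by rewrite -expr2 sqr_sqrtr // ltW. Qed.
Let r_neq0 : r != 0. Proof. exact: lt0r_neq0. Qed.

Lemma groundE n : ground n = (1 + n%:R * (q%:R - 1) / (q%:R + 1)) * r ^- n.
Proof. by rewrite /ground_profile invf_div mulrA. Qed.

Lemma ground0 : ground 0 = 1.
Proof. by rewrite groundE !mul0r addr0 mul1r expr0 invr1. Qed.

Lemma ground_step n : ground n + ground n.+2 *+ q = 2 * r * ground n.+1.
Proof.
rewrite !groundE -[(_ * r ^- n.+2) *+ q]mulr_natr -[n.+2%:R]natr1 -[n.+1%:R]natr1.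
have q1 : q%:R + 1 != 0 :> R by rewrite gt_eqF // ltr_wpDl // ltW.
move: r_neq0 rr; set u := Num.sqrt _ => u0 uu; rewrite -uu in q1 *; rewrite !exprS.
by field; rewrite expf_neq0 // u0 q1.
Qed.

(** Unlike in [eigen_dist_pow], the equation also holds at z, so the mean value formula is valid at
    every radius. *)
Lemma ground_eigen z w : \sum_(v <- nb e w) ground (d v z) = 2 * r * ground (d w z).
Proof.
case E : (d w z) => [|n]; last by rewrite (sum_nb_radial hT ground E) ground_step.
have /eqP -> : w == z by rewrite -(dist_eq0 hT) E.
rewrite (sum_nb_radial0 hT ground) ground0 mulr1 groundE expr1 -[LHS]mulr_natr -[q.+1%:R]natr1.
have q1 : q%:R + 1 != 0 :> R by rewrite gt_eqF // ltr_wpDl // ltW.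
move: r_neq0 rr; set u := Num.sqrt _ => u0 uu; rewrite -uu in q1 *.
by field; rewrite u0 q1.
Qed.

Lemma ground_mean_value y z n :
  \sum_(v <- S y n) ground (d v z) = sphere_coef q (2 * r) n * ground (d y z).
Proof. by apply: (mean_value hT (g := fun v => ground (d v z))) => w _; exact: ground_eigen. Qed.

Lemma sphere_mean_ground o n : sphere_mean e q o (2 * r) n = ground n.
Proof.
have := ground_mean_value o o n; rewrite (sum_sphere_radial hT ground) (dist_refl hT).
rewrite ground0 mulr1 /sphere_mean => <-.
by rewrite mulrC mulKf // pnatr_eq0 -lt0n (sphere_size_gt0 hT q_gt1 o n).
Qed.

Lemma ground_up n : ground n <= r * ground n.+1.
Proof.
rewrite !groundE mulrCA -[r ^- n.+1]exprVn exprS mulVKf // exprVn.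
rewrite ler_wpM2r ?invr_ge0 ?exprn_ge0 ?(ltW r_gt0) // lerD2l.
by rewrite -!mulrA ler_wpM2r ?ler_nat // divr_ge0 ?(ltW q1_gt0) // addr_ge0 // ltW.
Qed.

Lemma ground_down n : ground n.+1 <= r * ground n.
Proof.
rewrite !groundE -[r ^- n.+1]exprVn exprS !exprVn !mulrA ler_wpM2r ?invr_ge0 ?exprn_ge0 ?(ltW r_gt0) //.
rewrite ler_pdivrMr // [leRHS]mulrAC rr -![_ * _ / (q%:R + 1)]mulrA.
set c := (q%:R - 1) / (q%:R + 1); have c0 : 0 <= c.
  by rewrite divr_ge0 ?(ltW q1_gt0) // addr_ge0 // ltW.
have c1 : c <= 1 by rewrite ler_pdivrMr ?mul1r ?ltr_wpDl ?(ltW q_gt0) //; lra.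
have nc : 0 <= n%:R * c by rewrite mulr_ge0.
have q2 : 2 <= q%:R :> R by rewrite ler_nat.
rewrite -natr1 mulrDl mul1r; nra.
Qed.

End Ground.

(** * Estimates in each range of exponents *)

Section Main.
Variables (R : realType) (T : choiceType) (e : rel T) (q : nat).
Hypotheses (hT : homogeneous_tree e q) (q_gt1 : (1 < q)%N).
Local Notation d := (dist e).
Local Notation S := (sphere e).
Local Notation normc := (@Normc.normc R).
Variable o : T.

Section Generic.
Variables (p a : R) (psi : nat -> R) (m : T -> T -> R).
Hypotheses (p_ge1 : 1 <= p) (a_ge1 : 1 <= a).
Hypotheses (psi_gt0 : forall n, 0 < psi n).
Hypotheses (psi_up : forall n, psi n <= a * psi n.+1) (psi_down : forall n, psi n.+1 <= a * psi n).
Hypothesis variation : forall eps, 0 < eps -> \forall t \near +oo, forall K,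
  \sum_(0 <= n < K) (q ^ n)%:R * (psi n `^ p *
    `|heat_profile q t n.+1 / psi n.+1 - heat_profile q t n / psi n| `^ p) <=
  eps * energy q p t.
Hypotheses (m_ge0 : forall y x, 0 <= m y x) (m_le : forall y x, m y x <= a ^+ d y o).
Hypothesis m_far : forall y x, (d y o <= d x o)%N -> m y x = psi (d x y) / psi (d x o).
Hypothesis m_near : (forall y x, m y x = psi (d x y) / psi (d x o)) \/
  (forall n eps, 0 < eps -> \forall t \near +oo, heat_profile q t n `^ p <= eps * energy q p t).

(* Truncating the time makes the heat profile nonnegative for all t. *)
Let h t n : R := heat_profile q (Num.max t 0) n.

Let hE : \forall t \near +oo, h t = heat_profile q t.
Proof.
near=> t; rewrite /h max_l //; near: t; exact: nbhs_pinfty_ge.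
Unshelve. all: by end_near. Qed.

Let h_ge0 t n : 0 <= h t n.
Proof. by apply: heat_profile_ge0 => //; rewrite le_max lexx orbT. Qed.

Let L_gt0 : \forall t \near +oo, 0 < energy q p t.
Proof.
near=> t; apply: energy_gt0 => //; near: t; exact: nbhs_pinfty_ge.
Unshelve. all: by end_near. Qed.

Let h_le : \forall t \near +oo, forall K,
  \sum_(0 <= n < K) (q ^ n)%:R * h t n `^ p <= energy q p t.
Proof.
near=> t; rewrite (_ : h t = heat_profile q t); last by near: t.
by move=> K; apply: energy_ge_partial => //; near: t; exact: nbhs_pinfty_ge.
Unshelve. all: by end_near. Qed.

Let heatE : \forall t \near +oo, forall x y, heat_kernel q e t x y = h t (d x y).
Proof.
near=> t; move=> x y; rewrite (heat_kernelE hT q_gt1) (_ : h t = heat_profile q t) //.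
by near: t.
Unshelve. all: by end_near. Qed.

Let h_variation eps : 0 < eps -> \forall t \near +oo, forall K,
  \sum_(0 <= n < K) (q ^ n)%:R * (psi n `^ p * `|h t n.+1 / psi n.+1 - h t n / psi n| `^ p) <=
  eps * energy q p t.
Proof.
move=> eps0; have hv := variation eps0; near=> t.
by rewrite (_ : h t = heat_profile q t); near: t.
Unshelve. all: by end_near. Qed.

Let h_near : (forall y x, m y x = psi (d x y) / psi (d x o)) \/
  (forall n eps, 0 < eps -> \forall t \near +oo, h t n `^ p <= eps * energy q p t).
Proof.
case: m_near => [|small]; [by left|right => n eps eps0].
have hs := small n eps eps0; near=> t.
by rewrite (_ : h t = heat_profile q t); near: t.
Unshelve. all: by end_near. Qed.

Variable f : T -> R[i].

Lemma weighted_asymptotics (s : T -> R) (A0 : R) (M : T -> R[i]) eps :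
  (forall x, 0 < s x) -> sum_le (fun y => normc (f y) * a ^+ d y o) A0 ->
  (forall x, M x = csum (fun y => f y * (m y x / s x)%:C) * (s x)%:C) -> 0 < eps ->
  \forall t \near +oo, sum_le (fun x =>
    normc (heat_solution q e f t x - M x * (heat_kernel q e t x o)%:C) `^ p)
    (eps * energy q p t).
Proof.
move=> s0 fw ME; have C0 : 0 <= 2 `^ (p - 1) * 4 :> R.
  by apply: mulr_ge0; first exact: powR_ge0.
apply: (weighted_estimate hT q_gt1 (h := h) p_ge1 h_ge0 L_gt0 h_le heatE
  (m := m) (s := s) (w := fun y => a ^+ d y o) C0 s0 m_ge0 m_le _ fw _ _ ME).
- by move=> y; exact: exprn_ege1.
- exact: (mass_error_bound hT q_gt1 p_ge1 a_ge1 h_ge0 L_gt0 h_le m_ge0 m_le).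
- move=> y eta eta0; exact: (mass_error_vanish hT q_gt1 p_ge1 a_ge1 psi_gt0 psi_up psi_down
    h_ge0 L_gt0 h_variation m_ge0 m_le m_far h_near y eta0).
Qed.

Lemma radial_asymptotics (phi : nat -> R) (A0 C : R) eps :
  radial e o f -> 0 <= C -> (forall n, 0 < phi n) ->
  (forall n x, \sum_(v <- S o n) m v x = (size (S o n))%:R * phi n) ->
  sum_le (fun y => normc (f y) * phi (d y o)) A0 ->
  (\forall t \near +oo, forall n,
     sum_le (fun x => (\sum_(v <- S o n) heat_profile q t (d x v)) `^ p)
       (((size (S o n))%:R * phi n) `^ p * (C * energy q p t))) -> 0 < eps ->
  \forall t \near +oo, sum_le (fun x => normc (heat_solution q e f t x -
    csum (fun y => f y * (phi (d y o))%:C) * (heat_kernel q e t x o)%:C) `^ p)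
    (eps * energy q p t).
Proof.
move=> frad C0 phi0 msum fphi hU.
apply: (radial_estimate hT q_gt1 (h := h) p_ge1 h_ge0 L_gt0 h_le heatE frad C0 phi0 fphi).
  by near=> t; rewrite (_ : h t = heat_profile q t); near: t.
move=> n eta eta0; exact: (sphere_mass_error_vanish hT q_gt1 p_ge1 a_ge1 psi_gt0 psi_up psi_down
    h_ge0 L_gt0 h_variation m_ge0 m_le m_far h_near (msum n) eta0).
Unshelve. all: by end_near. Qed.

End Generic.

(** By [sphere_sum_swap] the sum over the sphere around o equals one over the sphere around x, to
    which Schur's test applies. The test needs al and al^(p-1) to share one eigenvalue. *)
Lemma schur_heat (p al : R) : 1 <= p -> 0 < al ->
  (al `^ (p - 1))^-1 + q%:R * al `^ (p - 1) = al^-1 + q%:R * al ->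
  \forall t \near +oo, forall n,
     sum_le (fun x => (\sum_(v <- S o n) heat_profile q t (d x v)) `^ p)
       ((sphere_coef q (al^-1 + q%:R * al) n) `^ p * (2 * energy q p t)).
Proof.
move=> p1 al0 alE; near=> t; have t0 : 0 <= t by near: t; exact: nbhs_pinfty_ge.
move=> n; have hp0 k : 0 <= heat_profile q t k := heat_profile_ge0 q_gt1 k t0.
have hp1 k : 0 <= heat_profile q t k `^ p := powR_ge0 _ _.
have := sum_le_radial hT q_gt1 o hp1 (fun K => energy_ge_partial q_gt1 K p1 t0).
move=> /(schur_sphere hT q_gt1 n p1 al0 (powR_gt0 (p - 1) al0) erefl alE (fun x => hp0 _)).
apply: sum_le_le => x; rewrite -(sphere_sum_swap hT) (eq_bigr (fun v => heat_profile q t (d v x))) //.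
by move=> v _; rewrite (dist_sym hT).
Unshelve. all: by end_near. Qed.

Lemma sphere_coefE (mu : R) n : sphere_coef q mu n = (size (S o n))%:R * sphere_mean e q o mu n.
Proof.
by rewrite /sphere_mean mulrC divfK // pnatr_eq0 -lt0n (sphere_size_gt0 hT q_gt1 o n).
Qed.

Section Subcritical.
Variable p : R.
Hypotheses (p_ge1 : 1 <= p) (p_lt2 : p < 2).
Local Notation al := (subcritical_rate q p : R).
Local Notation a := (q%:R `^ p^-1 : R).
Local Notation mu := (al^-1 + q%:R * al).
Local Notation phi := (sphere_mean e q o mu).
Variable f : T -> R[i].

Let q_gt0 : 0 < q%:R :> R. Proof. by rewrite ltr0n ltnW. Qed.
Let al_gt0 : 0 < al. Proof. exact: subcritical_rate_gt0. Qed.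
Let aE : a = al^-1. Proof. by rewrite /subcritical_rate powRN invrK. Qed.

Let a_ge1 : 1 <= a.
Proof. by rewrite aE invf_ge1 // subcritical_rate_le1. Qed.

Let psi_gt0 n : 0 < al ^+ n. Proof. exact: exprn_gt0. Qed.

Let psi_up n : al ^+ n <= a * al ^+ n.+1.
Proof. by rewrite aE exprS mulKf // gt_eqF. Qed.

Let psi_down n : al ^+ n.+1 <= a * al ^+ n.
Proof.
rewrite exprS ler_wpM2r ?(ltW (psi_gt0 n)) // (le_trans _ a_ge1) //.
exact: subcritical_rate_le1.
Qed.

Let psi_ratio_le y x : al ^+ d x y / al ^+ d x o <= a ^+ d y o.
Proof.
by rewrite ler_pdivrMr //; exact: (psi_dist_le hT o a_ge1 psi_up psi_down).
Qed.

Lemma subcritical_weighted (m : T -> T -> R) A0 (M : T -> R[i]) eps :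
  (forall y x, 0 <= m y x <= a ^+ d y o) ->
  (forall y x, (d y o <= d x o)%N -> m y x = al ^+ d x y / al ^+ d x o) ->
  sum_le (fun y => normc (f y) * a ^+ d y o) A0 ->
  (forall x, M x = csum (fun y => f y * (m y x)%:C)) -> 0 < eps ->
  \forall t \near +oo, sum_le (fun x =>
    normc (heat_solution q e f t x - M x * (heat_kernel q e t x o)%:C) `^ p)
    (eps * energy q p t).
Proof.
move=> mb mf fw ME.
apply: (weighted_asymptotics p_ge1 a_ge1 psi_gt0 psi_up psi_down
  (subcritical_variation q_gt1 p_ge1 p_lt2) (m := m) _ _ mf _ (s := fun=> 1) _ fw) => //.
- by move=> y x; have /andP[] := mb y x.
- by move=> y x; have /andP[] := mb y x.
- by right; exact: subcritical_pointwise.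
- by move=> x; rewrite mulr1 ME; congr csum; apply/funext => y; rewrite divr1.
Qed.

Let phi_gt0 n : 0 < phi n.
Proof.
by rewrite divr_gt0 ?(sphere_coef_gt0 hT) // ltr0n (sphere_size_gt0 hT q_gt1 o n).
Qed.

Let far_mean x n : (n <= d x o)%N ->
  \sum_(v <- S o n) al ^+ d x v / al ^+ d x o = sphere_coef q mu n.
Proof.
move=> nx; rewrite -mulr_suml (eq_bigr (fun v => al ^+ d v x)); last first.
  by move=> v _; rewrite (dist_sym hT).
rewrite (mean_value_dist_pow hT q_gt1 (lt0r_neq0 al_gt0)) ?(dist_sym hT o) //.
by rewrite mulfK // gt_eqF.
Qed.

(** Seen from a point at distance n from o, phi(n) is an average over the sphere of ratios bounded
    by a^n. *)
Let phi_le n : phi n <= a ^+ n.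
Proof.
have [z dz] := sphere_exists hT q_gt1 o n.
have sz : 0 < (size (S o n))%:R :> R by rewrite ltr0n (sphere_size_gt0 hT q_gt1 o n).
rewrite ler_pdivrMr // -(far_mean (x := z)) ?dz // -dz.
rewrite (le_trans (ler_sum _ (fun v _ => psi_ratio_le v z))) //.
rewrite (eq_big_seq (fun=> a ^+ d z o)); last first.
  by move=> v; rewrite (mem_sphere hT) => /eqP ->.
by rewrite big_const_seq count_predT iter_addr_0 mulr_natr.
Qed.

Lemma subcritical_radial A0 eps : radial e o f ->
  sum_le (fun y => normc (f y) * phi (d y o)) A0 -> 0 < eps ->
  \forall t \near +oo, sum_le (fun x => normc (heat_solution q e f t x -
    csum (fun y => f y * (phi (d y o))%:C) * (heat_kernel q e t x o)%:C) `^ p)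
    (eps * energy q p t).
Proof.
move=> frad fphi.
(* Where x is too close to o for the mean value formula, m is the constant that makes the sum over
   each sphere independent of x. *)
pose m y x := if (d y o <= d x o)%N then al ^+ d x y / al ^+ d x o else phi (d y o).
have m0 y x : 0 <= m y x.
  rewrite /m; case: ifP => _; last exact: ltW.
  exact: divr_ge0 (ltW (psi_gt0 _)) (ltW (psi_gt0 _)).
have m1 y x : m y x <= a ^+ d y o by rewrite /m; case: ifP.
have mf y x : (d y o <= d x o)%N -> m y x = al ^+ d x y / al ^+ d x o by rewrite /m => ->.
apply: (radial_asymptotics p_ge1 a_ge1 psi_gt0 psi_up psi_down
  (subcritical_variation q_gt1 p_ge1 p_lt2) m0 m1 mf _ frad (ler0n _ 2) phi_gt0 _ fphi).
- by right; exact: subcritical_pointwise.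
- move=> n x; rewrite -sphere_coefE; case: (leqP n (d x o)) => nx.
    rewrite -(far_mean nx); apply: eq_big_seq => v; rewrite (mem_sphere hT) => /eqP dv.
    by rewrite mf // dv.
  rewrite sphere_coefE (eq_big_seq (fun=> phi n)); last first.
    by move=> v; rewrite (mem_sphere hT) /m => /eqP ->; rewrite leqNgt nx.
  by rewrite big_const_seq count_predT iter_addr_0 [RHS]mulr_natl.
have := schur_heat p_ge1 al_gt0.
(* This is the other root z of 1/z + q z = mu. *)
have -> : al `^ (p - 1) = (q%:R * al)^-1.
  have := powR_succr p al_gt0; rewrite subcritical_rate_powR // => qE.
  by apply: (mulIf (lt0r_neq0 al_gt0)); rewrite -qE; field; rewrite !gt_eqF.
rewrite invrK (_ : q%:R * (q%:R * al)^-1 = al^-1); last by field; rewrite !gt_eqF.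
move=> /(_ (addrC _ _)) hU; near=> t; move=> n; rewrite -sphere_coefE; move: n; near: t.
exact: hU.
Unshelve. all: by end_near. Qed.

End Subcritical.

End Main.

Section GroundEstimates.
Variables (R : realType) (T : choiceType) (e : rel T) (q : nat).
Hypotheses (hT : homogeneous_tree e q) (q_gt1 : (1 < q)%N).
Local Notation d := (dist e).
Local Notation S := (sphere e).
Local Notation normc := (@Normc.normc R).
Local Notation r := (Num.sqrt q%:R : R).
Local Notation ground := (ground_profile R q).
Variables (o : T) (p : R).
Hypothesis p_ge2 : 2 <= p.
Variable f : T -> R[i].

Let p_ge1 : 1 <= p. Proof. by apply: le_trans p_ge2; rewrite ler1n. Qed.
Let p_gt0 : 0 < p. Proof. exact: lt_le_trans p_ge1. Qed.
Let q_gt0 : 0 < q%:R :> R. Proof. by rewrite ltr0n ltnW. Qed.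
Let r_gt0 : 0 < r. Proof. by rewrite sqrtr_gt0. Qed.
Let rr : r * r = q%:R. Proof. by rewrite -expr2 sqr_sqrtr // ltW. Qed.
Let r_ge1 : 1 <= r. Proof. by rewrite -{1}sqrtr1 ler_wsqrtr // ler1n ltnW. Qed.
Let g_gt0 n : 0 < ground n. Proof. exact: ground_profile_gt0. Qed.

Lemma ground_variation eps : 0 < eps -> \forall t \near +oo, forall K,
  \sum_(0 <= n < K) (q ^ n)%:R * (ground n `^ p *
    `|heat_profile q t n.+1 / ground n.+1 - heat_profile q t n / ground n| `^ p) <=
  eps * energy q p t.
Proof.
move: p_ge2; rewrite le_eqVlt => /predU1P[<-|p2]; first exact: critical_variation.
exact: supercritical_variation.
Qed.

Let ratio_ge0 y x : 0 <= ground (d x y) / ground (d x o).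
Proof. exact: divr_ge0 (ltW (g_gt0 _)) (ltW (g_gt0 _)). Qed.

Let ratio_le y x : ground (d x y) / ground (d x o) <= r ^+ d y o.
Proof.
by rewrite ler_pdivrMr //; exact: (psi_dist_le hT o r_ge1 (ground_up R q_gt1) (ground_down R q_gt1)).
Qed.

Lemma ground_weighted A0 (M : T -> R[i]) eps :
  sum_le (fun y => normc (f y) * r ^+ d y o) A0 ->
  (forall x, M x = csum (fun y => f y * (ground (d x y))%:C) / (ground (d x o))%:C) -> 0 < eps ->
  \forall t \near +oo, sum_le (fun x =>
    normc (heat_solution q e f t x - M x * (heat_kernel q e t x o)%:C) `^ p)
    (eps * energy q p t).
Proof.
move=> fw ME; have s0 x : 0 < (ground (d x o))^-1 by rewrite invr_gt0.
apply: (weighted_asymptotics hT q_gt1 p_ge1 r_ge1 g_gt0 (ground_up R q_gt1) (ground_down R q_gt1)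
  ground_variation (m := fun y x => ground (d x y) / ground (d x o)) _ _ _ _ s0 fw) => //.
- by left.
- move=> x; rewrite ME -fmorphV; congr (csum _ * _); apply/funext => y.
  by rewrite mulfK // gt_eqF.
Qed.

Let mean_ground n x : \sum_(v <- S o n) ground (d x v) =
  (size (S o n))%:R * ground n * ground (d x o).
Proof.
rewrite (eq_bigr (fun v => ground (d v x))); last by move=> v _; rewrite (dist_sym hT).
rewrite (ground_mean_value R hT q_gt1) (dist_sym hT o); congr (_ * _).
by rewrite (sphere_coefE hT q_gt1 o) (sphere_mean_ground R hT q_gt1).
Qed.

(** For p = 2 the function phi_0 is not in l^p, and Schur's test is taken at the double root al = 1
    / sqrt q, equal to al^(p-1). *)
Lemma ground_heat_bound : exists2 C, 0 <= C & \forall t \near +oo, forall n,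
  sum_le (fun x => (\sum_(v <- S o n) heat_profile q t (d x v)) `^ p)
    (((size (S o n))%:R * ground n) `^ p * (C * energy q p t)).
Proof.
move: p_ge2; rewrite le_eqVlt => /predU1P[p2|p2].
  exists 2 => //; rewrite -p2.
  have rV : 0 < r^-1 by rewrite invr_gt0.
  have rE : r^-1 `^ (2 - 1) = r^-1.
    by rewrite (_ : 2 - 1 = 1 :> R) ?powRr1 ?(ltW rV) //; lra.
  have muE : r^-1^-1 + q%:R * r^-1 = 2 * r.
    by rewrite invrK -{2}rr mulfK ?gt_eqF // mulr_natl mulr2n.
  have := @schur_heat R T e q hT q_gt1 o 2 r^-1 (ler1n _ 2) rV.
  rewrite rE muE => /(_ erefl); apply: filterS => t ht n.
  by rewrite -(sphere_mean_ground R hT q_gt1 o) -(sphere_coefE hT q_gt1).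
have [C C0 hC] := supercritical_pointwise R q_gt1.
have [G G0 hG] := ground_sum_bounded q_gt1 p2.
exists (C `^ p * (2 * G)); first by rewrite !mulr_ge0 ?powR_ge0.
near=> t; have t0 : 0 <= t by near: t; exact: nbhs_pinfty_ge.
have ht : forall n, heat_profile q t n <= C * heat_profile q t 0 * ground n by near: t.
have h0 n : 0 <= heat_profile q t n := heat_profile_ge0 q_gt1 n t0.
have hL : heat_profile q t 0 `^ p <= energy q p t.
  by have := energy_ge_partial q_gt1 1 p_ge1 t0; rewrite big_nat1 expn0 mul1r.
move=> n; set w := _ * ground n.
have w0 : 0 <= w by rewrite mulr_ge0 // ltW.
have gp k : 0 <= ground k `^ p := powR_ge0 _ _.
have := sum_le_radial hT q_gt1 o gp hG.
move=> /(sum_leZ (powR_ge0 (w * (C * heat_profile q t 0)) p)) hs.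
have c0 : 0 <= C * heat_profile q t 0 by rewrite mulr_ge0.
apply: sum_leW (sum_le_le _ hs) => [|x].
  rewrite (powRM _ w0 c0) (powRM _ C0 (h0 0%N)) -!mulrA; apply: ler_wpM2l; first exact: powR_ge0.
  apply: ler_wpM2l; first exact: powR_ge0.
  by rewrite [leRHS]mulrA [leLHS]mulrC; apply: ler_wpM2l; first exact: mulr_ge0.
have S0 : 0 <= \sum_(v <- S o n) heat_profile q t (d x v) by rewrite sumr_ge0.
have wc : 0 <= w * (C * heat_profile q t 0) := mulr_ge0 w0 c0.
have gx := ltW (g_gt0 (d x o)).
rewrite -(powRM _ wc gx); apply: ge0_ler_powR; rewrite ?nnegrE ?(ltW p_gt0) //.
  exact: mulr_ge0.
apply: le_trans (ler_sum _ (fun v _ => ht (d x v))) _.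
by rewrite -mulr_sumr mean_ground -/w mulrCA mulrA.
Unshelve. all: by end_near. Qed.

Lemma ground_radial A0 eps : radial e o f ->
  sum_le (fun y => normc (f y) * ground (d y o)) A0 -> 0 < eps ->
  \forall t \near +oo, sum_le (fun x => normc (heat_solution q e f t x -
    csum (fun y => f y * (ground (d y o))%:C) * (heat_kernel q e t x o)%:C) `^ p)
    (eps * energy q p t).
Proof.
move=> frad fphi; have [C C0 hU] := ground_heat_bound.
apply: (radial_asymptotics hT q_gt1 p_ge1 r_ge1 g_gt0 (ground_up R q_gt1) (ground_down R q_gt1)
  ground_variation ratio_ge0 ratio_le _ _ frad C0 g_gt0 _ fphi hU) => //.
  by left.
by move=> n x; rewrite -mulr_suml mean_ground mulfK // gt_eqF.
Qed.

End GroundEstimates.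

(** * Mass functions *)

Section MassEstimate.
Variables (R : realType) (T : choiceType) (e : rel T) (q : nat).
Hypotheses (hT : homogeneous_tree e q) (q_gt1 : (1 < q)%N).
Local Notation d := (dist e).
Local Notation normc := (@Normc.normc R).
Local Notation ground := (ground_profile R q).
Variable o : T.
Variables (nu : probability (boundary e o) R).
Hypothesis hnu : harmonic_measure nu.

Let q_gt0 : 0 < q%:R :> R. Proof. by rewrite ltr0n ltnW. Qed.

Lemma powR_natdiv (n : nat) (s : R) : q%:R `^ (n%:R / s) = (q%:R `^ s^-1) ^+ n.
Proof. by rewrite -powR_mulrn ?powR_ge0 // -powRrM mulrC. Qed.

(** The factor q + 1 turns gamma(i s) into the adjacency eigenvalue, and q + 1 = q^(1/2) (q^(1/2) +
    q^(-1/2)) clears the denominator. *)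
Lemma gamma_mean (s : R) : q.+1%:R * ((q%:R `^ s + q%:R `^ (- s)) /
  (q%:R `^ 2^-1 + q%:R `^ (- 2^-1))) = q%:R `^ (s + 2^-1) + q%:R `^ (2^-1 - s).
Proof.
have qq (u v : R) : q%:R `^ (u + v) = q%:R `^ u * q%:R `^ v.
  by rewrite powRD //; apply/implyP => _; rewrite gt_eqF.
rewrite qq [2^-1 - s]addrC qq -mulrDl (powRN _ 2^-1).
have uu : q%:R `^ 2^-1 * q%:R `^ 2^-1 = q%:R :> R.
  by rewrite -qq (_ : 2^-1 + 2^-1 = 1 :> R) ?powRr1 ?ltW //; lra.
have u0 : 0 < q%:R `^ 2^-1 :> R := powR_gt0 _ q_gt0.
rewrite -natr1; move: (_ `^ s + _) u0 uu; set u := q%:R `^ 2^-1 => w u0 <-.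
have uu1 : u * u + 1 != 0 by rewrite gt_eqF // ltr_wpDl // mulr_ge0 // ltW.
by field; rewrite uu1 gt_eqF.
Qed.

Lemma spherical_imaginary (s : R) x : spherical q e o (0 +i* s) x =
  (sphere_mean e q o (q%:R `^ (s + 2^-1) + q%:R `^ (2^-1 - s)) (d x o))%:C.
Proof. by rewrite (spherical_eq hT q_gt1 o x (gamma_imaginary q s)) gamma_mean. Qed.

Lemma spherical0 x : spherical q e o (0 : R[i]) x = (ground (d x o))%:C.
Proof.
rewrite -[0 : R[i]]/(0 +i* 0) spherical_imaginary subr0 add0r powR12_sqrt ?(ltW q_gt0) //.
have -> : Num.sqrt q%:R + Num.sqrt q%:R = 2 * Num.sqrt q%:R :> R by ring.
by rewrite (sphere_mean_ground R hT q_gt1).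
Qed.

Lemma convolution_spherical0 (f : T -> R[i]) x : convolution e o f (spherical q e o 0) x =
  csum (fun y => f y * (ground (d x y))%:C).
Proof.
congr csum; apply/funext => y; congr (_ * _); rewrite /radial_profile.
case: xgetP => [z -> [u /= du <-]|]; first by rewrite spherical0 du.
have [z dz] := sphere_exists hT q_gt1 o (d x y).
by move=> /(_ (spherical q e o 0 z)) []; exists z.
Qed.

Section RealExponent.
Variable p : R.
Hypothesis p_ge1 : 1 <= p.
Let p_gt0 : 0 < p. Proof. exact: lt_le_trans p_ge1. Qed.
Local Notation al := (subcritical_rate q p : R).

Lemma weightE y : weight q e o p%:E y =
  (if p < 2 then q%:R `^ p^-1 else Num.sqrt q%:R) ^+ d y o.
Proof.
rewrite /weight lte_fin /= !powR_natdiv powR12_sqrt ?(ltW q_gt0) //.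
by case: ifP.
Qed.

(** At s = 1/p - 1/2 the exponents of [gamma_mean] are 1/p and 1 - 1/p, so the eigenvalue is that of
    the powers of al. *)
Lemma spherical_deltaE y : spherical_delta q e o p%:E y =
  (if p < 2 then sphere_mean e q o (al^-1 + q%:R * al) (d y o) else ground (d y o))%:C.
Proof.
rewrite /spherical_delta /delta lte_fin; case: ifP => p2; last exact: spherical0.
rewrite spherical_imaginary /= subrK /subcritical_rate powRN invrK -powRN opprB addrA.
rewrite (_ : 2^-1 + 2^-1 = 1 :> R); last lra.
rewrite powRD; last by apply/implyP => _; rewrite gt_eqF.
by rewrite powRr1 // ltW.
Qed.

Lemma mass_function_estimate (f M : T -> R[i]) eps :
  (l1_weight q e o p%:E f /\ M = mass q nu p%:E f) \/
  [/\ radial e o f, l1_delta q e o p%:E f & M = (fun=> mass_radial q e o p%:E f)] ->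
  0 < eps -> \forall t \near +oo, sum_le (fun x =>
    normc (heat_solution q e f t x - M x * (heat_kernel q e t x o)%:C) `^ p)
    (eps * energy q p t).
Proof.
move=> [[fw ->]|[frad fphi ->]] eps0.
  have [A0 {}fw] : exists A0, sum_le (fun y => normc (f y) * weight q e o p%:E y) A0.
    apply: summable_sum_le fw => y.
    by rewrite mulr_ge0 ?normc_ge0 // /weight; case: ifP => _; exact: powR_ge0.
  have [p2|p2] := ltP p 2.
    have fw' : sum_le (fun y => normc (f y) * (q%:R `^ p^-1) ^+ d y o) A0.
      by apply: sum_le_le fw => y; rewrite weightE p2.
    apply: (subcritical_weighted hT q_gt1 p_ge1 p2 (m := fun y x =>
      average nu (boundary_arc e o x : set (boundary e o))
        (fun w => q%:R `^ ((height e o w y)%:~R / p))) _ _ fw' _ eps0).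
    - move=> y x; apply: (average_bounds hT hnu) => w [wr _].
      rewrite powR_ge0 -powR_natdiv ler_powR ?ler1n ?(ltnW q_gt1) //.
      by rewrite ler_pM2r ?invr_gt0 // -[leRHS]mulrz_nat ler_int natz; exact: (height_le hT y wr).
    - move=> y x yx; apply: (average_const hT hnu) => w wx.
      rewrite (height_far hT wx yx) intrB mulrBl powRB; last first.
        by apply/implyP => _; rewrite gt_eqF.
      by rewrite !powR_natdiv /subcritical_rate powRN !exprVn invrK mulrC.
    - by move=> x; rewrite /mass lte_fin p2.
  have fw' : sum_le (fun y => normc (f y) * Num.sqrt q%:R ^+ d y o) A0.
    by apply: sum_le_le fw => y; rewrite weightE ltNge p2.
  apply: (ground_weighted hT q_gt1 p2 fw' _ eps0) => x.
  by rewrite /mass lte_fin ltNge p2 /= convolution_spherical0 spherical0.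
pose phi n := if p < 2 then sphere_mean e q o (al^-1 + q%:R * al) n else ground n.
have phiE y : spherical_delta q e o p%:E y = (phi (d y o))%:C := spherical_deltaE y.
have fE : mass_radial q e o p%:E f = csum (fun y => f y * (phi (d y o))%:C).
  by congr csum; apply/funext => y; rewrite phiE.
have phi0 n : 0 < phi n.
  rewrite /phi; case: ifP => _; last exact: ground_profile_gt0.
  rewrite divr_gt0 ?(sphere_coef_gt0 hT q_gt1) ?subcritical_rate_gt0 //.
  by rewrite ltr0n (sphere_size_gt0 hT q_gt1 o n).
have [A0 {}fphi] : exists A0, sum_le (fun y => normc (f y) * phi (d y o)) A0.
  apply: summable_sum_le => [y|]; first by rewrite mulr_ge0 ?normc_ge0 // ltW.
  have E : (fun y => (normc (f y) * phi (d y o))%:E) =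
      (fun y => (normc (f y) * complex.Re (spherical_delta q e o p%:E y))%:E).
    by apply/funext => y; rewrite phiE.
  by rewrite E.
rewrite fE; move: fphi; rewrite /phi; case: (ltP p 2) => p2 fphi.
  exact: (subcritical_radial hT q_gt1 p_ge1 p2 frad fphi).
exact: (ground_radial hT q_gt1 p2 frad fphi).
Qed.

Lemma heat_lpnorm : \forall t \near +oo,
  ((energy q p t `^ p^-1)%:E <= lpnorm p%:E (fun x => (heat_kernel q e t x o)%:C) < +oo)%E.
Proof.
near=> t; have t0 : 0 <= t by near: t; exact: nbhs_pinfty_ge.
have hp0 n : 0 <= heat_profile q t n `^ p := powR_ge0 _ _.
have hE x : normc (heat_kernel q e t x o)%:C `^ p = heat_profile q t (d x o) `^ p.
  by rewrite normc_real (heat_kernelE hT q_gt1) ger0_norm // heat_profile_ge0.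
have hL : sum_le (fun x => normc (heat_kernel q e t x o)%:C `^ p) (2 * energy q p t).
  have hs := sum_le_radial hT q_gt1 o hp0 (fun K => energy_ge_partial q_gt1 K p_ge1 t0).
  by apply: sum_le_le hs => x; rewrite hE.
apply/andP; split; last by apply: le_lt_trans (lpnorm_le p_gt0 hL) (ltry _).
apply: lpnorm_ge => //; first exact: ltW (energy_gt0 q_gt1 p_ge1 t0).
have [E [-> hS _]] := esum_approx (fun x => powR_ge0 _ _) hL.
rewrite lee_fin; apply: energy_le => // K.
apply: le_trans (sum_ball_radial_ge hT q_gt1 o K hp0) _.
apply: le_trans (hS _ (ball_uniq hT o K)).
by apply: ler_sum => x _; rewrite hE.
Unshelve. all: by end_near. Qed.

End RealExponent.
End MassEstimate.

Theorem theorem2 (R : realType) (q : nat) (hq : (2 <= q)%N)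
    (T : choiceType) (e : rel T) (hT : homogeneous_tree e q) (o : T)
    (nu : probability (boundary e o) R) (hnu : harmonic_measure nu)
    (p : \bar R) (hp : (1 <= p)%E) (f : T -> R[i]) (M : T -> R[i])
    (hM : (l1_weight q e o p f /\ M = mass q nu p f) \/
          [/\ radial e o f, l1_delta q e o p f
            & M = (fun=> mass_radial q e o p f)]) :
  let h (t : R) (x : T) : R[i] := (heat_kernel q e t x o)%:C in
  let u (t : R) (x : T) : R[i] := heat_solution q e f t x in
  (lpnorm p (fun x => u t x - M x * h t x)%R / lpnorm p (h t))%E
    @[t --> +oo%R] --> 0%E.
Proof.
move=> h u; case: p hp hM => [p| |//] hp hM.
  rewrite lee_fin in hp; have p0 : 0 < p := lt_le_trans ltr01 hp.
  apply: (ratio_cvg0 (b := fun t => energy q p t `^ p^-1)).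
  - have hl := heat_lpnorm hT hq o hp; near=> t; split; last by near: t.
    by rewrite powR_gt0 // energy_gt0 //; near: t; exact: nbhs_pinfty_ge.
  - by move=> t; exact: lpnorm_ge0 o.
  - move=> eps eps0; have ep0 : 0 < eps `^ p := powR_gt0 _ eps0.
    have := mass_function_estimate hT hq hnu hp hM ep0; apply: filterS2 (nbhs_pinfty_ge (num_real 0)).
    move=> t t0 /(lpnorm_le p0) ht; apply: le_trans ht _; rewrite lee_fin.
    rewrite powRM ?(ltW ep0) ?(ltW (energy_gt0 hq hp t0)) //.
    by rewrite -powRrM mulfV ?gt_eqF // powRr1 // ltW.
(* For p = +oo the weight and the mass functions are those of p = 3, the sup
   norm is at most the l^3 norm, and both norms of h t have order h t o. *)
have h31 : 1 <= 3 :> R by rewrite ler1n.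
have n3 : (3%:E < 2%:E :> \bar R)%E = false by rewrite lte_fin ltr_nat.
have noo : (+oo < 2%:E :> \bar R)%E = false by [].
have {}hM : (l1_weight q e o 3%:E f /\ M = mass q nu 3%:E f) \/
    [/\ radial e o f, l1_delta q e o 3%:E f & M = (fun=> mass_radial q e o 3%:E f)].
  move: hM; rewrite /l1_weight /l1_delta /mass_radial /spherical_delta /delta /weight /mass.
  by rewrite n3 noo.
have h23 : 2 < 3 :> R by rewrite ltr_nat.
have [C C0 hC] := supercritical_energy hq h23.
apply: (ratio_cvg0 (b := fun t => heat_profile q t 0)).
- near=> t; have t0 : 0 <= t by near: t; exact: nbhs_pinfty_ge.
  have hp0 n : 0 <= heat_profile q t n := heat_profile_ge0 hq n t0.
  have hE x : Normc.normc (h t x) = heat_profile q t (dist e x o).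
    by rewrite normc_real (heat_kernelE hT hq) ger0_norm.
  split; first exact: heat_profile0_gt0.
  apply/andP; split.
    by apply: ereal_sup_ubound; exists o => //; rewrite hE (dist_refl hT).
  apply: le_lt_trans (ltry (energy q 3 t `^ 3^-1)); apply: ge_ereal_sup => _ [x _ <-].
  rewrite hE lee_fin.
  apply: (profile_bounded hq (h := fun=> heat_profile q t) (L := fun=> energy q 3 t) h31 _ (t := 0)).
    by move=> _; exact: hp0.
  by move=> K; exact: energy_ge_partial.
- by move=> t; exact: lpnorm_ge0 o.
(* As the energy is at most C h_t(o)^3, this choice bounds the cube of every pointwise error by (eps
   h_t(o))^3. *)
move=> eps eps0; have d0 : 0 < eps `^ 3 / (C + 1).
  by rewrite divr_gt0 ?powR_gt0 // ltr_wpDl.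
have hm := mass_function_estimate hT hq hnu h31 hM d0.
near=> t; have t0 : 0 <= t by near: t; exact: nbhs_pinfty_ge.
have hCt : energy q 3 t <= C * heat_profile q t 0 `^ 3 by near: t.
have hmt : sum_le (fun x => Normc.normc (u t x - M x * h t x) `^ 3)
  (eps `^ 3 / (C + 1) * energy q 3 t) by near: t.
have hp0 := heat_profile_ge0 hq 0 t0.
apply: ge_ereal_sup => _ [x _ <-]; rewrite lee_fin.
have e0 : 0 <= eps * heat_profile q t 0 by rewrite mulr_ge0 // ltW.
rewrite -[leRHS](powRr1 e0) -[X in _ `^ X](mulfV (_ : 3 != 0 :> R)) ?pnatr_eq0 //.
rewrite powRrM; apply: (powR_le_root h31); first exact: normc_ge0.
apply: le_trans (sum_le_point x hmt) _.
rewrite powRM ?(ltW eps0) // -mulrA ler_wpM2l ?powR_ge0 //.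
rewrite mulrC ler_pdivrMr ?ltr_wpDl // mulrC; apply: le_trans hCt _.
by rewrite ler_wpM2r ?powR_ge0 // lerDl.
Unshelve. all: by end_near. Qed.
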